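(* Let $\mathsf{k}$ be a commutative ring, $A$ a countable set, and $\diamond$ a commutative associative $\mathsf{k}$-bilinear product on $\mathsf{k}A$. Let $\mathcal{Y}$ be the Young tableaux algebra with product $\ast$ and cutting coproduct $\Delta_{cut}$, and let $L_\diamond:\mathcal{Y}\to\mathsf{k}\langle A\rangle$ be the linearization map. Then: (1) $(\mathcal{Y},\ast,\Delta_{cut},S)$ is a connected commutative graded Hopf algebra (graded by the number of boxes, with $S$ its antipode). (2) $L_\diamond$ induces an isomorphism of Hopf algebras $(\mathcal{Y}_\diamond,\ast,\Delta_{cut})\cong(\mathsf{k}\langle A\rangle,\ast_\diamond,\Delta_{dec})$, where $\mathcal{Y}_\diamond=\mathcal{Y}/\ker(L_\diamond)$ carries the induced structure.
   Context: $\mathsf{k}A$ is the free $\mathsf{k}$-module with basis $A$. $\mathsf{k}\langle A\rangle$ is the free associative $\mathsf{k}$-algebra on $A$ (basis: words, $\mathbf 1$ the empty word). The quasi-shuffle product $\ast_\diamond$ on $\mathsf{k}\langle A\rangle$ is the $\mathsf{k}$-bilinear product with $\mathbf 1\ast_\diamond w=w\ast_\diamond\mathbf 1=w$ and $aw\ast_\diamond bv=a(w\ast_\diamond bv)+b(aw\ast_\diamond v)+(a\diamond b)(w\ast_\diamond v)$ for $a,b\in A$ and words $w,v$. The deconcatenation coproduct is $\Delta_{dec}(w)=\sum_{uv=w}u\otimes v$; $(\mathsf{k}\langle A\rangle,\ast_\diamond,\Delta_{dec})$ is known to be a Hopf algebra. Tableaux. For partitions $\mu\subseteq\lambda$ (padded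 by zeros), $D(\lambda/\mu)=\{(i,j):\mu_i<j\le\lambda_i\}$ ($i$ row index increasing downwards, $j$ column index). A Young tableau of shape $\mathrm{sh}(\mathbf h)=\lambda/\mu$ with entries in $A$ is a family $\mathbf h=(h_{i,j})_{(i,j)\in D(\lambda/\mu)}$, $h_{i,j}\in A$; no monotonicity is imposed. $\mathrm{YT}(A)$ is the set of all of them; $\mathbf 1$ is the empty tableau. For $\mathbf h$ of shape $\lambda/\mu$, $\lambda=(\lambda_1,\dots,\lambda_r)$, cut $\mathbf h$ after every row $i$ with $\mu_i\ge\lambda_{i+1}$ ($\lambda_{r+1}:=0$); translate each resulting piece (a set of consecutive rows) up and to the left so that it starts in row $1$ and as far left as possible (a piece without boxes becomes $\mathbf 1$). The resulting multiset of tableaux is $\mathrm{SC}(\mathbf h)$ (shifted connected components). $\mathcal{Y}$ (written $\mathsf{k}\boxed{A}$ in the paper) is the commutative $\mathsf{k}$-algebra $\mathsf{k}[\mathrm{YT}(A)]$ modulo the relations $\mathbf h=\prod_{\mathbf i\in\mathrm{SC}(\mathbf h)}\mathbf i$, with $\mathbf 1$ identified with the unit; its product is denoted $\ast$. The cutting coproduct is the linear map given on a tableau $w$ of shape $\lambda/\mu$ by $\Delta_{cut}(w)=\sum_{\mu\subseteq\eta\subseteq\lambda}w_{\eta/\mu}\otimes w_{\lambda/\eta}$ (sum over partitions $\eta$; $w_\alpha$ is the restriction of $w$ to $D(\alpha)$); the counit satisfies $\epsilon(\mathbf 1)=1$ and $\epsilon(w)=0$ for nonempty tableaux $w$. Linearization.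 A skew shape is a horizontal strip if no column contains two boxes. A semi-standard decomposition of $\lambda/\mu$ is a tuple $(D_1,\dots,D_r)$, $D_t=D(\eta^{(t)}/\eta^{(t-1)})$, coming from a chain of partitions $\mu=\eta^{(0)}\subsetneq\eta^{(1)}\subsetneq\cdots\subsetneq\eta^{(r)}=\lambda$ with every $\eta^{(t)}/\eta^{(t-1)}$ a horizontal strip; $\mathrm{SSD}(\lambda/\mu)$ is the set of these (the empty chain if $\lambda=\mu$). $L_\diamond$ is the $\mathsf{k}$-linear map with $L_\diamond(\mathbf h)=\sum_{(D_1,\dots,D_r)\in\mathrm{SSD}(\mathrm{sh}(\mathbf h))}|\mathbf h_{D_1}|_\diamond\cdots|\mathbf h_{D_r}|_\diamond$ (concatenation), where $|\mathbf h_{D}|_\diamond\in\mathsf{k}A$ is the $\diamond$-product of all $h_{i,j}$, $(i,j)\in D$, and $L_\diamond(\mathbf 1)=\mathbf 1$. *)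

(* Defs.v *)
(* Mathematical Components, with the classical axioms of mathcomp.classical.boolp
   used to turn membership in a generated submodule into a boolean. *)
From HB Require Import structures.
From mathcomp Require Import all_boot all_order all_algebra finmap boolp.
From mathcomp Require Import zify.
From mathcomp.multinomials Require Import monalg.

Set Implicit Arguments.
Unset Strict Implicit.
Unset Printing Implicit Defensive.

Import GRing.Theory.
Local Open Scope ring_scope.
Local Open Scope quotient_scope.

Section Span.
Variables (k : comNzRingType) (V : lmodType k).

Definition submodule (W : V -> Prop) : Prop :=
  W 0 /\ forall (c : k) (x y : V), W x -> W y -> W (c *: x + y).

Definition span (S : V -> Prop) (v : V) : Prop :=
  forall W : V -> Prop, submodule W -> (forall s, S s -> W s) -> W v.

Lemma submodule_span (S : V -> Prop) : submodule (span S).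
Proof.
split=> [W [W0 _] _ //|c x y Sx Sy W sW SW].
by case: (sW) => _; apply; [apply: Sx | apply: Sy].
Qed.

Lemma span_gen (S : V -> Prop) s : S s -> span S s.
Proof. by move=> Ss W _; apply. Qed.

Lemma spanZ (S : V -> Prop) c x : span S x -> span S (c *: x).
Proof.
by move=> Sx; rewrite -[_ *: _]addr0; apply: (submodule_span S).2 => //;
  exact: (submodule_span S).1.
Qed.

Definition in_span (S : V -> Prop) : {pred V} := fun v => `[< span S v >].

Lemma in_spanP (S : V -> Prop) v : reflect (span S v) (v \in in_span S).
Proof. exact: asboolP. Qed.

Fact in_span_zmod_closed (S : V -> Prop) : zmod_closed (in_span S).
Proof.
split=> [|x y /in_spanP Sx /in_spanP Sy]; apply/in_spanP.
  exact: (submodule_span S).1.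
by rewrite addrC -scaleN1r; apply: (submodule_span S).2.
Qed.

HB.instance Definition _ (S : V -> Prop) :=
  GRing.isZmodClosed.Build V (in_span S) (in_span_zmod_closed S).

Definition quotmod (S : V -> Prop) : Type := Quotient.quot (in_span S).

HB.instance Definition _ (S : V -> Prop) := GRing.Zmodule.on (quotmod S).
HB.instance Definition _ (S : V -> Prop) := Quotient.on (quotmod S).

End Span.

(* The canonical projection onto the quotient, and a choice of representatives.
   Both are locked to keep conversion away from the choice operator. *)
HB.lock Definition qpi (k : comNzRingType) (V : lmodType k) (S : V -> Prop)
  (v : V) : quotmod S := \pi_(Quotient.quot (in_span S)) v.
HB.lock Definition qrepr (k : comNzRingType) (V : lmodType k) (S : V -> Prop)
  (x : quotmod S) : V := repr x.
Arguments qpi {k V} S v.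
Arguments qrepr {k V S} x.

Section QuotientModule.
Variables (k : comNzRingType) (V : lmodType k) (S : V -> Prop).

Local Notation qpi := (qpi S).

Lemma qreprK x : qpi (qrepr x) = x.
Proof. by rewrite qpi.unlock qrepr.unlock; apply: reprK. Qed.

Lemma eq_qpi (v w : V) : qpi v = qpi w <-> span S (v - w).
Proof.
rewrite qpi.unlock; split=> [/eqP e|e].
  by apply/in_spanP; rewrite Quotient.idealrBE.
by apply/eqP; rewrite -Quotient.idealrBE; apply/in_spanP.
Qed.

Lemma qpiB : {morph qpi : v w / v - w}.
Proof. by move=> v w; rewrite qpi.unlock !piE. Qed.

Lemma qpiD : {morph qpi : v w / v + w}.
Proof. by move=> v w; rewrite qpi.unlock !piE. Qed.

Definition qscale (c : k) (x : quotmod S) : quotmod S := qpi (c *: qrepr x).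

Lemma qpiZ c v : qscale c (qpi v) = qpi (c *: v).
Proof.
apply/eq_qpi; rewrite -scalerBr; apply: spanZ.
by apply/eq_qpi; rewrite qreprK.
Qed.

Fact qscaleA a b x : qscale a (qscale b x) = qscale (a * b) x.
Proof. by rewrite -[x]qreprK !qpiZ scalerA. Qed.
Fact qscale1 : left_id 1 qscale.
Proof. by move=> x; rewrite -[x]qreprK qpiZ scale1r. Qed.
Fact qscaleDr : right_distributive qscale +%R.
Proof. by move=> a x y; rewrite -[x]qreprK -[y]qreprK -qpiD !qpiZ scalerDr qpiD. Qed.
Fact qscaleDl x : {morph qscale^~ x : a b / a + b}.
Proof. by move=> a b; rewrite -[x]qreprK !qpiZ scalerDl qpiD. Qed.

HB.instance Definition _ := GRing.Zmodule_isLmodule.Build k (quotmod S)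
  qscaleA qscale1 qscaleDr qscaleDl.

Fact qpi_linear : linear qpi.
Proof. by move=> c v w; rewrite qpiD -qpiZ. Qed.
HB.instance Definition _ := GRing.isLinear.Build k V (quotmod S) _ qpi qpi_linear.

End QuotientModule.

Section QuotientAlgebra.
Variables (k : comNzRingType) (R : comAlgType k) (G : R -> Prop).

(* Spanning set, as a module, of the ideal generated by G. *)
Variant ideal_rel : R -> Prop :=
| IdealRel (q g : R) of G g : ideal_rel (q * g).

Definition quotalg : Type := quotmod ideal_rel.
HB.instance Definition _ := GRing.Lmodule.on quotalg.

Lemma span_idealM (p q : R) : span ideal_rel p -> span ideal_rel (q * p).
Proof.
move=> /(_ (fun p => span ideal_rel (q * p))); apply.
  split=> [|c x y sx sy]; first by rewrite mulr0; exact: (submodule_span _).1.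
  by rewrite mulrDr -scalerAr; exact: (submodule_span _).2.
by move=> _ [q' g Gg]; rewrite mulrA; apply: span_gen; exact: IdealRel.
Qed.

Definition qone : quotalg := qpi ideal_rel 1.
Definition qmul (x y : quotalg) : quotalg := qpi ideal_rel (qrepr x * qrepr y).

Lemma qmulE (p q : R) : qmul (qpi _ p) (qpi _ q) = qpi ideal_rel (p * q).
Proof.
have mulE (r x : R) : qpi ideal_rel (r * qrepr (qpi ideal_rel x)) = qpi _ (r * x).
  apply/eq_qpi; rewrite -mulrBr; apply: span_idealM.
  by apply/(eq_qpi ideal_rel); rewrite qreprK.
by rewrite /qmul mulE mulrC mulE mulrC.
Qed.

Fact qmul_bilinear : bilinear_for *:%R *:%R qmul.
Proof.
split=> [y c x x'|x c y y'] /=.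
  rewrite -[x]qreprK -[x']qreprK -[y]qreprK -linearP !qmulE -linearP.
  by rewrite mulrDl scalerAl.
rewrite -[x]qreprK -[y']qreprK -[y]qreprK -linearP !qmulE -linearP.
by rewrite mulrDr scalerAr.
Qed.
HB.instance Definition _ :=
  bilinear_isBilinear.Build k quotalg quotalg quotalg _ _ qmul qmul_bilinear.

Fact qmulA : associative qmul.
Proof.
by move=> x y z; rewrite -[x]qreprK -[y]qreprK -[z]qreprK !qmulE mulrA.
Qed.
Fact qmulC : commutative qmul.
Proof. by move=> x y; rewrite -[x]qreprK -[y]qreprK !qmulE mulrC. Qed.
Fact qmul1 : left_id qone qmul.
Proof. by move=> x; rewrite -[x]qreprK qmulE mul1r. Qed.
Fact qmulDl : left_distributive qmul +%R.
Proof.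
move=> x y z; rewrite -[x]qreprK -[y]qreprK -[z]qreprK.
by rewrite -qpiD !qmulE -qpiD mulrDl.
Qed.
HB.instance Definition _ := GRing.Zmodule_isComPzRing.Build quotalg
  qmulA qmulC qmul1 qmulDl.

End QuotientAlgebra.

Section Free.
Variables (k : comNzRingType) (K : choiceType) (V : lmodType k).

Definition lext (f : K -> V) (g : {malg k[K]}) : V :=
  \sum_(x <- msupp g) g@_x *: f x.

Lemma lextEw f (g : {malg k[K]}) (D : {fset K}) : (msupp g `<=` D)%fset ->
  lext f g = \sum_(x <- D) g@_x *: f x.
Proof.
move=> le; rewrite /lext (big_fset_incl _ le) // => x _ xg.
by rewrite mcoeff_outdom // scale0r.
Qed.

Fact lext_linear f : linear (lext f).
Proof.
move=> c g h; pose D := (msupp g `|` msupp h `|` msupp (c *: g + h))%fset.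
rewrite !(@lextEw _ _ D) /D; last first.
- exact: fsubsetUr.
- by rewrite -fsetUA fsubsetUl.
- by rewrite fsetUAC fsubsetUr.
rewrite scaler_sumr -big_split /=; apply: eq_bigr => x _.
by rewrite mcoeffD mcoeffZ scalerDl scalerA.
Qed.
HB.instance Definition _ f :=
  GRing.isLinear.Build k {malg k[K]} V _ (lext f) (lext_linear f).

Lemma lextD c f g (y : {malg k[K]}) :
  lext (fun x => c *: f x + g x) y = c *: lext f y + lext g y.
Proof.
rewrite /lext scaler_sumr -big_split /=; apply: eq_bigr => x _.
by rewrite scalerDr !scalerA mulrC.
Qed.

Lemma lextU f x : lext f << x >> = f x.
Proof.
by rewrite (@lextEw _ _ [fset x]%fset) ?msuppU_le // big_seq_fset1 mcoeffUU scale1r.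
Qed.

End Free.

Section Tensor.
Variables (k : comNzRingType) (M N : lmodType k).

Local Notation F := {malg k[(M * N)%type]}.

Variant tensor_rel : F -> Prop :=
| TensorRelL c (x x' : M) (y : N) :
    tensor_rel (<< (c *: x + x', y) >> - (c *: << (x, y) >> + << (x', y) >>))
| TensorRelR c (x : M) (y y' : N) :
    tensor_rel (<< (x, c *: y + y') >> - (c *: << (x, y) >> + << (x, y') >>)).

Definition tensor : Type := quotmod tensor_rel.
HB.instance Definition _ := GRing.Lmodule.on tensor.

Definition tens (x : M) (y : N) : tensor := qpi tensor_rel << (x, y) >>.

Fact tens_bilinear : bilinear_for *:%R *:%R tens.
Proof.
split=> [y c x x'|x c y y'];
  rewrite /= /tens -[RHS](linearP (qpi tensor_rel));
  apply/(eq_qpi tensor_rel); apply: span_gen.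
- exact: TensorRelL.
- exact: TensorRelR.
Qed.
HB.instance Definition _ :=
  bilinear_isBilinear.Build k M N tensor _ _ tens tens_bilinear.

End Tensor.

Notation "M ⊗ N" := (tensor M N) (at level 40, left associativity) : type_scope.
Notation "x ⊗ y" := (tens x y) (at level 40, left associativity) : ring_scope.

Section TensorMaps.
Variable k : comNzRingType.

(* The linear map x ⊗ y |-> f x y, for f bilinear (junk otherwise). *)
Definition tlift (M N P : lmodType k) (f : M -> N -> P) (t : (M ⊗ N)%type) : P :=
  lext (fun xy => f xy.1 xy.2) (qrepr t).

Section Lift.
Variables (M N P : lmodType k) (f : M -> N -> P).
Hypothesis fL : bilinear_for *:%R *:%R f.

Lemma tlift_qpi (g : {malg k[(M * N)%type]}) :
  tlift f (qpi (@tensor_rel k M N) g) = lext (fun xy => f xy.1 xy.2) g.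
Proof.
apply/eqP; rewrite -subr_eq0 -raddfB /=.
set h := (_ - _); have : span (@tensor_rel k M N) h.
  by apply/eq_qpi; rewrite qreprK.
move: h => h /(_ (fun h => lext (fun xy => f xy.1 xy.2) h = 0)) -> //.
  split=> [|c x y x0 y0]; first exact: raddf0.
  by rewrite linearP /= x0 y0 scaler0 addr0.
move=> _ [c x x' y|c x y y']; rewrite raddfB /= linearP /= !lextU /=.
  by rewrite fL.1 subrr.
by rewrite fL.2 subrr.
Qed.

Lemma tliftE x y : tlift f (x ⊗ y) = f x y.
Proof. by rewrite tlift_qpi lextU. Qed.

Lemma tlift_linear : linear (tlift f).
Proof.
move=> c s t; rewrite -[s]qreprK -[t]qreprK -linearP !tlift_qpi /=.
exact: linearP.
Qed.

End Lift.

Definition tmap (M N M' N' : lmodType k) (f : M -> M') (g : N -> N') :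
  (M ⊗ N)%type -> (M' ⊗ N')%type := tlift (fun x y => f x ⊗ g y).

Definition tassoc (M N P : lmodType k) :
  ((M ⊗ N) ⊗ P)%type -> (M ⊗ (N ⊗ P))%type :=
  tlift (fun t z => tlift (fun x y => x ⊗ (y ⊗ z)) t).

Definition tmul (H : lmodType k) (mul : H -> H -> H) (s t : (H ⊗ H)%type) :
  (H ⊗ H)%type :=
  tlift (fun a b => tlift (fun c d => mul a c ⊗ mul b d) t) s.

End TensorMaps.

Section Hopf.
Variable k : comNzRingType.

Record hopf_ops (H : lmodType k) := HopfOps {
  hmul : {bilinear H -> H -> H};
  hone : H;
  hcomul : {linear H -> (H ⊗ H)%type};
  hcounit : {scalar H};
  hanti : {linear H -> H}
}.

Record is_algebra (H : lmodType k) (D : hopf_ops H) : Prop := {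
  alg_mulA : associative (hmul D);
  alg_mul1l : left_id (hone D) (hmul D);
  alg_mul1r : right_id (hone D) (hmul D)
}.

Record is_coalgebra (H : lmodType k) (D : hopf_ops H) : Prop := {
  coalg_coassoc : forall x,
    tassoc (tmap (hcomul D) id (hcomul D x)) = tmap id (hcomul D) (hcomul D x);
  coalg_counitl : forall x, tlift (fun a b => hcounit D a *: b) (hcomul D x) = x;
  coalg_counitr : forall x, tlift (fun a b => hcounit D b *: a) (hcomul D x) = x
}.

Record is_hopf_algebra (H : lmodType k) (D : hopf_ops H) : Prop := {
  hopf_algebra : is_algebra D;
  hopf_coalgebra : is_coalgebra D;
  hopf_comulM : forall x y,
    hcomul D (hmul D x y) = tmul (hmul D) (hcomul D x) (hcomul D y);
  hopf_comul1 : hcomul D (hone D) = hone D ⊗ hone D;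
  hopf_counitM : forall x y, hcounit D (hmul D x y) = hcounit D x * hcounit D y;
  hopf_counit1 : hcounit D (hone D) = 1;
  hopf_antil : forall x,
    tlift (fun a b => hmul D (hanti D a) b) (hcomul D x) = hcounit D x *: hone D;
  hopf_antir : forall x,
    tlift (fun a b => hmul D a (hanti D b)) (hcomul D x) = hcounit D x *: hone D
}.

Record is_grading (H : lmodType k) (G : nat -> H -> Prop) : Prop := {
  grading_sub : forall n, submodule (G n);
  grading_sum : forall x, exists (m : nat) (f : nat -> H),
    (forall n, G n (f n)) /\ x = \sum_(n < m) f n;
  grading_direct : forall (m : nat) (f : nat -> H),
    (forall n, G n (f n)) -> \sum_(n < m) f n = 0 ->
    forall n, (n < m)%N -> f n = 0
}.

Record is_graded_hopf (H : lmodType k) (D : hopf_ops H) (G : nat -> H -> Prop)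
    : Prop := {
  graded_grading : is_grading G;
  graded_mul : forall m n x y, G m x -> G n y -> G (m + n)%N (hmul D x y);
  graded_one : G 0%N (hone D);
  graded_comul : forall n x, G n x ->
    span (fun t => exists i j a b,
            [/\ (i + j)%N = n, G i a, G j b & t = a ⊗ b]) (hcomul D x);
  graded_counit : forall n x, G n x -> (0 < n)%N -> hcounit D x = 0;
  graded_anti : forall n x, G n x -> G n (hanti D x)
}.

(* The unit c |-> c *: 1 is an isomorphism of k onto the degree 0 component. *)
Definition is_connected (H : lmodType k) (D : hopf_ops H) (G : nat -> H -> Prop)
    : Prop :=
  (forall x, G 0%N x <-> exists c : k, x = c *: hone D) /\
  injective (fun c : k => c *: hone D).

Record is_hopf_morphism (H H' : lmodType k) (D : hopf_ops H) (D' : hopf_ops H')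
    (f : {linear H -> H'}) : Prop := {
  hmor_mul : forall x y, f (hmul D x y) = hmul D' (f x) (f y);
  hmor_one : f (hone D) = hone D';
  hmor_comul : forall x, tmap f f (hcomul D x) = hcomul D' (f x);
  hmor_counit : forall x, hcounit D' (f x) = hcounit D x;
  hmor_anti : forall x, f (hanti D x) = hanti D' (f x)
}.

(* f is the only linear map with property P. *)
Definition is_the_linear (U : lmodType k) (V : zmodType)
    (s : k -> V -> V) (P : {linear U -> V | s} -> Prop)
    (f : {linear U -> V | s}) : Prop :=
  P f /\ forall g, P g -> g =1 f.

End Hopf.

Section QuasiShuffle.
Variables (k : comNzRingType) (A : choiceType).

Definition words := {malg k[{fmonom A}]}.
HB.instance Definition _ := GRing.Lalgebra.on words.

Definition word (w : seq A) : words := << FMonom w >>.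

Definition letters : {malg k[A]} -> words := lext (fun a => word [:: a]).

Variable d : {malg k[A]} -> {malg k[A]} -> {malg k[A]}.

Fixpoint qshuffle_word (w : seq A) : seq A -> words :=
  match w with
  | [::] => word
  | a :: w' =>
    fix qsh (v : seq A) : words :=
      match v with
      | [::] => word (a :: w')
      | b :: v' =>
          word [:: a] * qshuffle_word w' (b :: v') + word [:: b] * qsh v'
          + letters (d << a >> << b >>) * qshuffle_word w' v'
      end
  end.

Definition qshuffle (x y : words) : words :=
  lext (fun w : {fmonom A} => lext (fun v : {fmonom A} => qshuffle_word w v) y) x.

Fact qshuffle_bilinear : bilinear_for *:%R *:%R qshuffle.
Proof.
split=> [y|x c y y']; first exact: lext_linear.
rewrite /= /qshuffle -lextD; congr (lext _ x).
by apply/funext => w; rewrite linearP.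
Qed.
HB.instance Definition _ :=
  bilinear_isBilinear.Build k words words words _ _ qshuffle qshuffle_bilinear.

Definition deconc : words -> (words ⊗ words)%type :=
  lext (fun w : {fmonom A} =>
    \sum_(i < (size w).+1) word (take i w) ⊗ word (drop i w)).
HB.instance Definition _ := GRing.Linear.on deconc.

Definition words_counit (x : words) : k := x@_(FMonom [::]).
Fact words_counit_linear : scalar words_counit.
Proof. by move=> c x y; rewrite /words_counit mcoeffD mcoeffZ. Qed.
HB.instance Definition _ :=
  GRing.isLinear.Build k words k _ words_counit words_counit_linear.

End QuasiShuffle.

(* A partition is a nonincreasing sequence of naturals, padded by zeros when
   read with [nth 0].  Rows and columns are numbered from 0, so that the box
   in row i and column j of λ/μ satisfies μ_i <= j < λ_i. *)

Section Shapes.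
Implicit Types mu eta lam : seq nat.

Definition part_le mu lam : bool :=
  all (fun i => nth 0%N mu i <= nth 0%N lam i)%N (iota 0 (size mu)).

Definition in_diagram mu lam (i j : nat) : bool :=
  (nth 0%N mu i <= j < nth 0%N lam i)%N.

Definition horizontal_strip mu lam : bool :=
  [forall i : 'I_(size lam), forall i' : 'I_(size lam), forall j : 'I_(head 0%N lam),
     in_diagram mu lam i j && in_diagram mu lam i' j ==> (i == i')].

Lemma part_leP mu lam :
  reflect (forall i, nth 0%N mu i <= nth 0%N lam i)%N (part_le mu lam).
Proof.
apply: (iffP allP) => [le i|le i _]; last exact: le.
have [lt_i|ge_i] := ltnP i (size mu); last by rewrite nth_default.
by apply: le; rewrite mem_iota.
Qed.

Lemma sorted_geq_nth mu i j :
  sorted geq mu -> (i <= j)%N -> (nth 0%N mu j <= nth 0%N mu i)%N.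
Proof.
move=> s_mu le_ij; have [lt_j|ge_j] := ltnP j (size mu); last first.
  by rewrite [X in (X <= _)%N]nth_default.
apply: (sorted_leq_nth _ _ _ s_mu) => //.
- by move=> y x z /= le_yx le_zy; apply: leq_trans le_yx.
- by move=> x /=.
- by rewrite inE (leq_ltn_trans le_ij).
Qed.

(* One step of a chain of partitions of the same (padded) length. *)
Definition strip_step eta eta' : bool :=
  [&& sorted geq eta', part_le eta eta', eta != eta' & horizontal_strip eta eta'].

End Shapes.

(* A tableau of shape λ/μ, λ = (λ_1 >= ... >= λ_r > 0), is the list of its r
   rows from top to bottom, row i being stored as the pair of μ_i and of the
   list of length λ_i - μ_i of its entries from left to right. *)

Section Tableaux.
Variable A : choiceType.

Implicit Types h : seq (nat * seq A).

Definition inner h : seq nat := [seq r.1 | r <- h].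
Definition outer h : seq nat := [seq (r.1 + size r.2)%N | r <- h].

Definition is_tableau h : bool :=
  [&& sorted geq (inner h), sorted geq (outer h) & 0%N \notin outer h].

Record tableau := Tableau { rows :> seq (nat * seq A); _ : is_tableau rows }.
HB.instance Definition _ := [isSub for rows].
HB.instance Definition _ := [Choice of tableau by <:].

Definition empty_tableau : tableau := @Tableau [::] isT.

Definition nboxes h : nat := sumn [seq size r.2 | r <- h].

Definition entries h : seq A := flatten [seq r.2 | r <- h].

Definition trim h := [seq r <- h | (r.1 + size r.2 != 0)%N].

(* For partitions μ ⊆ eta ⊆ eta' ⊆ λ, the restriction of h to D(eta'/eta). *)
Definition restrict_rows h (eta eta' : seq nat) : seq (nat * seq A) :=
  trim (mkseq (fun i =>
    let r := nth (0%N, [::]) h i in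
    (nth 0%N eta i,
     drop (nth 0%N eta i - r.1) (take (nth 0%N eta' i - r.1) r.2))) (size h)).

Definition restrict (h : tableau) (eta eta' : seq nat) : tableau :=
  insubd empty_tableau (restrict_rows h eta eta').

Lemma trim_tableau h :
  sorted geq (inner h) -> sorted geq (outer h) -> is_tableau (trim h).
Proof.
have geq_tr : transitive geq.
  by move=> y x z /= le_yx le_zy; apply: leq_trans le_yx.
move=> s_in s_out; apply/and3P; split.
- by apply: subseq_sorted s_in => //; apply/map_subseq/filter_subseq.
- by apply: subseq_sorted s_out => //; apply/map_subseq/filter_subseq.
by apply/mapP=> -[r]; rewrite mem_filter => /andP[/negP r_n0 _] /esym/eqP.
Qed.

Lemma restrict_rows_tableau h eta eta' :
    sorted geq eta -> sorted geq eta' -> part_le (inner h) eta ->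
    part_le eta eta' -> part_le eta' (outer h) ->
  is_tableau (restrict_rows h eta eta').
Proof.
move=> s_e s_e' /part_leP le1 /part_leP le2 /part_leP le3.
have homo_mkseq f n : (forall i j, (i <= j)%N -> (f j <= f i)%N) ->
    sorted geq (mkseq f n).
  by move=> hf; apply: (homo_sorted (e := leq)) (iota_sorted 0 n) => i j /hf.
apply: trim_tableau.
  rewrite /inner /mkseq -map_comp.
  by apply: homo_mkseq => i j; apply: sorted_geq_nth.
have -> : outer (mkseq (fun i => let r := nth (0%N, [::]) h i in
    (nth 0%N eta i, drop (nth 0%N eta i - r.1)
       (take (nth 0%N eta' i - r.1) r.2))) (size h))
    = mkseq (nth 0%N eta') (size h).
  rewrite /outer /mkseq -map_comp; apply/eq_in_map => i; rewrite mem_iota /=.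
  move=> lt_ih; have := le1 i; have := le2 i; have := le3 i.
  rewrite /inner /outer !(nth_map (0%N, [::])) //.
  case: (nth _ h i) => m s /=.
  move: (nth 0%N eta i) (nth 0%N eta' i) => e e' le_e' le_ee' le_me.
  by rewrite size_drop size_takel; lia.
by apply: homo_mkseq => i j; apply: sorted_geq_nth.
Qed.

Lemma val_restrict (h : tableau) eta eta' :
    sorted geq eta -> sorted geq eta' -> part_le (inner h) eta ->
    part_le eta eta' -> part_le eta' (outer h) ->
  val (restrict h eta eta') = restrict_rows h eta eta'.
Proof.
by move=> *; rewrite /restrict val_insubd restrict_rows_tableau.
Qed.

(* [cut h] cuts after every row i with μ_i >= λ_(i+1). *)
Fixpoint cut h : seq (seq (nat * seq A)) :=
  if h isn't r :: h' then [::]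
  else if (head 0%N (outer h') <= r.1)%N then [:: r] :: cut h'
  else if cut h' is p :: ps then (r :: p) :: ps else [:: [:: r]].

(* In a piece the inner offset of the last row is the smallest one, and that
   row has a box unless the piece has no box at all, in which case trimming
   leaves the empty tableau. *)
Definition translate_rows h : seq (nat * seq A) :=
  let c := (last (0%N, [::]) h).1 in trim [seq ((r.1 - c)%N, r.2) | r <- h].

Definition translate h : tableau := insubd empty_tableau (translate_rows h).

Lemma flatten_cut h : flatten (cut h) = h.
Proof.
elim: h => //= r h IHh; case: ifP => _ /=; first by rewrite IHh.
by case: (cut h) IHh => [|p ps] /= <-.
Qed.

Lemma subseq_cut h p : p \in cut h -> subseq p h.
Proof.
move=> p_h; rewrite -[h in X in subseq _ X]flatten_cut.
case/splitPr: p_h => s1 s2; rewrite flatten_cat /=.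
by apply: subseq_trans (suffix_subseq _ _); apply: prefix_subseq.
Qed.

Lemma translate_rows_tableau h p :
  is_tableau h -> p \in cut h -> is_tableau (translate_rows p).
Proof.
have geq_tr : transitive geq.
  by move=> y x z /= le_yx le_zy; apply: leq_trans le_yx.
case/and3P=> s_in s_out _ /subseq_cut p_h.
have {s_in} s_in : sorted geq (inner p).
  by apply: subseq_sorted s_in => //; apply: map_subseq.
have {s_out} s_out : sorted geq (outer p).
  by apply: subseq_sorted s_out => //; apply: map_subseq.
rewrite /translate_rows; set c := (last _ _).1.
have le_c r : r \in p -> (c <= r.1)%N.
  rewrite /c; case: p s_in {p_h s_out c} => // r0 p /=.
  elim: p r0 r => [|r1 p IHp] r0 r /=; first by rewrite inE => _ /eqP->.
  case/andP=> le10 s_p; rewrite inE => /predU1P[->|]; last exact: IHp.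
  by apply: leq_trans le10; apply: IHp (mem_head _ _).
apply: trim_tableau.
  rewrite /inner -map_comp; have -> : map (fst \o (fun r => (r.1 - c, r.2)%N)) p
      = [seq (m - c)%N | m <- inner p] by rewrite -map_comp.
  by apply: homo_sorted s_in => m n /= ?; lia.
have -> : outer [seq (r.1 - c, r.2)%N | r <- p] = [seq (m - c)%N | m <- outer p].
  rewrite /outer -!map_comp; apply/eq_in_map => r /le_c /=; lia.
by apply: homo_sorted s_out => m n /= ?; lia.
Qed.

Lemma val_translate (h : tableau) p :
  p \in cut h -> val (translate p) = translate_rows p.
Proof.
by move=> ph; rewrite val_insubd (translate_rows_tableau (valP h) ph).
Qed.

Definition SC (h : tableau) : seq tableau := [seq translate p | p <- cut h].

End Tableaux.

Section TableauxAlgebra.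
Variables (k : comNzRingType) (A : choiceType).

Definition tabpoly : Type := {malg k[{cmonom (tableau A)}]}.
HB.instance Definition _ := GRing.ComAlgebra.on tabpoly.

Definition gen (h : tableau A) : tabpoly := << ucm h >>.

(* SC of the empty tableau is empty: the relation identifies it with the unit. *)
Variant ytab_rel : tabpoly -> Prop :=
| YtabRel (h : tableau A) : ytab_rel (gen h - \prod_(i <- SC h) gen i).

Definition ytab : Type := quotalg ytab_rel.
HB.instance Definition _ := GRing.Lmodule.on ytab.
HB.instance Definition _ := GRing.ComPzRing.on ytab.

Definition tab (h : tableau A) : ytab := qpi (ideal_rel ytab_rel) (gen h).

(* A partition contained in λ has at most as many nonzero parts as λ, none of
   them larger than λ_1; it is padded by zeros to the length of λ. *)
Definition subpart (w : tableau A) := (size w).-tuple 'I_(head 0%N (outer w)).+1.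

Definition parts (w : tableau A) (eta : subpart w) : seq nat := map val eta.

Definition is_between (w : tableau A) (eta : subpart w) : bool :=
  [&& sorted geq (parts eta), part_le (inner w) (parts eta)
    & part_le (parts eta) (outer w)].

Definition is_cut_coproduct (D : {linear ytab -> (ytab ⊗ ytab)%type}) : Prop :=
  forall w : tableau A, D (tab w) =
    \sum_(eta : subpart w | is_between eta)
      tab (restrict w (inner w) (parts eta)) ⊗
      tab (restrict w (parts eta) (outer w)).

Definition is_tableau_counit (e : {scalar ytab}) : Prop :=
  e (tab (empty_tableau A)) = 1 /\
  forall w : tableau A, (0 < nboxes w)%N -> e (tab w) = 0.

Definition ytab_deg (n : nat) : ytab -> Prop :=
  span (fun x => exists2 w : tableau A, nboxes w = n & x = tab w).

End TableauxAlgebra.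

Section Linearization.
Variables (k : comNzRingType) (A : choiceType).
Variable d : {malg k[A]} -> {malg k[A]} -> {malg k[A]}.

(* The d-product of the letters of s; d need not have a unit, and only nonempty
   sequences occur. *)
Definition dprod (s : seq A) : {malg k[A]} :=
  if s is a :: s' then foldl (fun x b => d x << b >>) << a >> s' else 0.

(* c = (eta^(1), ..., eta^(n)) is a chain from μ = eta^(0) to λ = eta^(n). *)
Definition is_ssd (w : tableau A) (c : seq (subpart w)) : bool :=
  let etas := map (@parts A w) c in
  path strip_step (inner w) etas && (last (inner w) etas == outer w).

Definition ssd_word (w : tableau A) (c : seq (subpart w)) : words k A :=
  let etas := map (@parts A w) c in
  \prod_(p <- zip (inner w :: etas) etas)
     letters (dprod (entries (restrict w p.1 p.2))).

(* A strict chain has at most as many steps as w has boxes. *)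
Definition is_linearization (L : {linear ytab k A -> words k A}) : Prop :=
  forall w : tableau A, L (tab k w) =
    \sum_(n < (nboxes w).+1) \sum_(c : n.-tuple (subpart w) | is_ssd c)
      ssd_word c.

End Linearization.

(* Main.v *)
(* The algebra of tableaux is the universal target of the functions on tableaux
   that are multiplicative along the cuts of SC and invariant under translation
   (cut_mult).  The sum over all ways of cutting a tableau in two, the indicator
   of the shapes without boxes and the sum over semi-standard decompositions are
   three such functions, with values in Y ⊗ Y, in k and in the quasi-shuffle
   algebra: they define Delta, eps and the algebra morphism L.  Coassociativity is
   the exchange of two nested sums over partitions.  Since Y is graded and
   connected, the antipode is the geometric series of the convolution powers of
   u∘eps - id, where u is the unit.

   Deconcatenating the word of a chain of partitions cuts the chain, so L is a
   coalgebra morphism, and it is onto because a one-column tableau has a unique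
   semi-standard decomposition.  Apart from commutativity and associativity of the
   quasi-shuffle product, which are needed to define L, all Hopf algebra axioms for
   words are therefore inherited from Y, and Y / ker L is words transported along
   the induced bijection. *)

Require Import Defs.
From HB Require Import structures.
From mathcomp Require Import all_boot all_order all_algebra finmap boolp.
From mathcomp Require Import zify.
From mathcomp.multinomials Require Import monalg.

Set Implicit Arguments.
Unset Strict Implicit.
Unset Printing Implicit Defensive.

Import GRing.Theory.
Local Open Scope ring_scope.

(** * Linear maps and tensor products *)

(** Multiplicativity rests on one observation. Where SC cuts, the inner end of the row above is at
    least the outer end of the row below, so both the monotonicity of a partition and the
    interlacing condition for a strip hold across the cut, whatever happens on the two sides.
    Partitions and single strips of the whole are therefore free pairs of those of the pieces, which
    settles the coproduct. Chains do not split in this way, since the chains of two pieces have to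
    be merged; sorted by their first strip they satisfy a recursion whose terms, according to
    whether that strip meets one piece or both, are those of the quasi-shuffle. The obstacle in
    passing to the quotient is the antipode: ker L must be stable under it. The geometric series
    decides this. Each convolution power is built from the bialgebra operations, which L respects,
    so L applied to its value at x depends only on L x. *)

Local Notation bil f := (bilinear_for *:%R *:%R f).

Section LinearProp.
Variables (k : comNzRingType) (U V : lmodType k) (f : U -> V).
Hypothesis fL : linear f.

Definition pack_linear : {linear U -> V} := HB.pack f (GRing.isLinear.Build _ _ _ _ f fL).

Lemma lin0 : f 0 = 0. Proof. exact: (raddf0 pack_linear). Qed.
Lemma linD x y : f (x + y) = f x + f y. Proof. exact: (raddfD pack_linear). Qed.
Lemma linZ c x : f (c *: x) = c *: f x. Proof. exact: (linearZ_LR pack_linear). Qed.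
Lemma lin_sum I (r : seq I) (P : pred I) (E : I -> U) :
  f (\sum_(i <- r | P i) E i) = \sum_(i <- r | P i) f (E i).
Proof. exact: (raddf_sum pack_linear). Qed.
End LinearProp.

Section LinearComp.
Variables (k : comNzRingType) (U V W : lmodType k).

Lemma lin_comp (f : V -> W) (g : U -> V) : linear f -> linear g -> linear (f \o g).
Proof. by move=> fL gL c x y /=; rewrite gL fL. Qed.

Lemma lin_id : linear (id : U -> U). Proof. by []. Qed.

Lemma lin_subset (P : V -> Prop) (f : U -> V) : linear f -> submodule P ->
  submodule (fun x => P (f x)).
Proof.
move=> fL [P0 PD]; split=> [|c x y Px Py]; first by rewrite (lin0 fL).
by rewrite fL; apply: PD.
Qed.

Lemma lin_eq_submodule (f g : U -> V) : linear f -> linear g ->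
  submodule (fun x => f x = g x).
Proof.
move=> fL gL; split=> [|c x y fx fy]; first by rewrite !lin0.
by rewrite fL gL fx fy.
Qed.

Lemma lin_sumf (I : Type) (r : seq I) (f : I -> U -> V) :
  (forall i, linear (f i)) -> linear (fun x => \sum_(i <- r) f i x).
Proof.
move=> fL c x y; rewrite scaler_sumr -big_split; apply: eq_bigr => i _.
exact: fL.
Qed.

Lemma lin_add (f g : U -> V) : linear f -> linear g -> linear (fun x => f x + g x).
Proof. by move=> fL gL c x y; rewrite fL gL scalerDr addrACA. Qed.

End LinearComp.

Section Submodules.
Variables (k : comNzRingType) (V : lmodType k) (P : V -> Prop).
Hypothesis sP : submodule P.

Lemma submodule0 : P 0. Proof. by case: sP. Qed.
Lemma submoduleD x y : P x -> P y -> P (x + y).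
Proof. by rewrite -[x]scale1r; case: sP => _ + ? ?; apply=> //; rewrite -[x]scale1r. Qed.
Lemma submoduleZ c x : P x -> P (c *: x).
Proof. by move=> Px; rewrite -[_ *: _]addr0; case: sP => P0 +; apply. Qed.
Lemma submodule_sum I (r : seq I) (Q : pred I) (E : I -> V) :
  (forall i, Q i -> P (E i)) -> P (\sum_(i <- r | Q i) E i).
Proof. by move=> PE; apply: big_ind => //; [exact: submodule0 | exact: submoduleD]. Qed.
End Submodules.

Section Induction.
Variables (k : comNzRingType).

Lemma malg_submodule_ind (K : choiceType) (P : {malg k[K]} -> Prop) :
  submodule P -> (forall x, P << x >>) -> forall g, P g.
Proof.
move=> sP Px g; rewrite [g]monalgE; apply: (submodule_sum sP) => i _.
have -> : << g@_i *g i >> = g@_i *: << i >> :> {malg k[K]}.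
  by apply/malgP => j; rewrite mcoeffZ !mcoeffU mulrnAr mulr1.
exact: submoduleZ.
Qed.

Variables M N : lmodType k.

Lemma tensor_submodule_ind (P : (M ⊗ N)%type -> Prop) :
  submodule P -> (forall x y, P (x ⊗ y)) -> forall t, P t.
Proof.
move=> sP Pxy t; rewrite -[t]qreprK.
pose Q g := P (qpi (@tensor_rel k M N) g).
suff Qall : forall g, Q g by exact: Qall.
apply: malg_submodule_ind => [|[x y]]; last exact: Pxy.
by apply: lin_subset => // c x y; rewrite linearP.
Qed.

Lemma tensor_ext (P : lmodType k) (f g : (M ⊗ N)%type -> P) :
    linear f -> linear g -> (forall x y, f (x ⊗ y) = g (x ⊗ y)) ->
  f =1 g.
Proof.
by move=> fL gL; apply: tensor_submodule_ind; apply: lin_eq_submodule.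
Qed.

End Induction.

Section TensorLemmas.
Variables (k : comNzRingType).
Implicit Types M N P : lmodType k.

Lemma tensP M N : bil (@tens k M N).
Proof. by split=> [y|x] c u v; rewrite /= ?linearPl ?linearPr. Qed.

Lemma tensPl M N c (x x' : M) (y : N) : (c *: x + x') ⊗ y = c *: (x ⊗ y) + x' ⊗ y.
Proof. exact: (tensP M N).1. Qed.
Lemma tensPr M N c (x : M) (y y' : N) : x ⊗ (c *: y + y') = c *: (x ⊗ y) + x ⊗ y'.
Proof. exact: (tensP M N).2. Qed.

Lemma tens_suml M N I (r : seq I) (Q : pred I) (E : I -> M) (y : N) :
  (\sum_(i <- r | Q i) E i) ⊗ y = \sum_(i <- r | Q i) E i ⊗ y.
Proof. exact: linear_sumlz. Qed.
Lemma tens_sumr M N I (r : seq I) (Q : pred I) (E : I -> N) (x : M) :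
  x ⊗ (\sum_(i <- r | Q i) E i) = \sum_(i <- r | Q i) x ⊗ E i.
Proof. exact: linear_sumr. Qed.

Lemma bil_comp M N M' N' P (f : M' -> N' -> P) (g : M -> M') (h : N -> N') :
  bil f -> linear g -> linear h -> bil (fun x y => f (g x) (h y)).
Proof. by move=> fB gL hL; split=> [y|x] c u v /=; rewrite ?gL ?hL ?fB.1 ?fB.2. Qed.

Lemma bil_linear M N P P' (f : M -> N -> P) (g : P -> P') :
  bil f -> linear g -> bil (fun x y => g (f x y)).
Proof. by move=> fB gL; split=> [y|x] c u v /=; rewrite ?fB.1 ?fB.2 gL. Qed.

Lemma bil_suml M N P (f : M -> N -> P) (fB : bil f)
  I (r : seq I) (Q : pred I) (E : I -> M) (y : N) :
  f (\sum_(i <- r | Q i) E i) y = \sum_(i <- r | Q i) f (E i) y.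
Proof. exact: (lin_sum (fB.1 y)). Qed.
Lemma bil_sumr M N P (f : M -> N -> P) (fB : bil f)
  I (r : seq I) (Q : pred I) (E : I -> N) (x : M) :
  f x (\sum_(i <- r | Q i) E i) = \sum_(i <- r | Q i) f x (E i).
Proof. exact: (lin_sum (fB.2 x)). Qed.

Lemma bilinearB M N P (f : {bilinear M -> N -> P}) : bil f.
Proof. by split=> [y|x] c u v; rewrite /= ?linearPl ?linearPr. Qed.

Definition pack_bilinear M N P (f : M -> N -> P) (fB : bil f) : {bilinear M -> N -> P} :=
  HB.pack f (bilinear_isBilinear.Build _ _ _ _ _ _ f fB).

Lemma linearL M N (f : {linear M -> N}) : linear f.
Proof. by move=> c x y; rewrite linearP. Qed.

(* Changes the path by which the module structure of the target is inferred. *)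
Lemma linear_to_tensor M N P
    (f : {linear P -> (Defs_tensor__canonical__GRing_Lmodule M N : lmodType k)}) :
  exists g : {linear P -> (M ⊗ N)%type}, forall x, g x = f x.
Proof. by exists f. Qed.

Lemma tmapE M N M' N' (f : M -> M') (g : N -> N') (fL : linear f) (gL : linear g)
  x y : tmap f g (x ⊗ y) = f x ⊗ g y.
Proof. by apply: tliftE; apply: bil_comp => //; exact: tensP. Qed.

Lemma tmap_lin M N M' N' (f : M -> M') (g : N -> N') (fL : linear f) (gL : linear g) :
  linear (tmap f g).
Proof. by apply: tlift_linear; apply: bil_comp => //; exact: tensP. Qed.

Lemma tlift_sum M N P (f : M -> N -> P) (fB : bil f) I (r : seq I) (Q : pred I)
    (E : I -> M) (F : I -> N) :
  tlift f (\sum_(i <- r | Q i) E i ⊗ F i) = \sum_(i <- r | Q i) f (E i) (F i).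
Proof.
rewrite (lin_sum (tlift_linear fB)); apply: eq_bigr => i _; exact: tliftE.
Qed.

Lemma eq_tlift M N P (f g : M -> N -> P) : f =2 g -> tlift f =1 tlift g.
Proof.
move=> fg t; rewrite /tlift /lext; apply: eq_bigr => x _.
by rewrite fg.
Qed.

Lemma eq_tmap M N M' N' (f f' : M -> M') (g g' : N -> N') :
  f =1 f' -> g =1 g' -> tmap f g =1 tmap f' g'.
Proof. by move=> ff gg; apply: eq_tlift => x y; rewrite ff gg. Qed.

(** Both sides expand over the same representative [qrepr t], which reduces linearity in [q] to
    pairs [(x, y)]. *)
Lemma tlift_lin_param M N P (Q : lmodType k) (f : Q -> M -> N -> P) t :
  (forall x y, linear (fun q => f q x y)) -> linear (fun q => tlift (f q) t).
Proof.
move=> fL c p q; rewrite /tlift -lextD; congr lext.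
by apply/funext => -[x y] /=; rewrite fL.
Qed.

Let tens3_bil M N P (z : P) : bil (fun (x : M) (y : N) => x ⊗ (y ⊗ z)).
Proof. by split=> [y|x] b a a' /=; rewrite ?tensPl ?tensPr. Qed.

Let tassoc_bil M N P : bil (fun t (z : P) => tlift (fun (x : M) (y : N) => x ⊗ (y ⊗ z)) t).
Proof.
split=> [z|t] c u v; first by rewrite /= (tlift_linear (@tens3_bil M N P z)).
apply: (@tlift_lin_param _ _ _ _ (fun z (x : M) (y : N) => x ⊗ (y ⊗ z)) t).
by move=> x y b a a'; rewrite !tensPr.
Qed.

Lemma tassocL M N P : linear (@tassoc k M N P).
Proof. exact: (tlift_linear (@tassoc_bil M N P)). Qed.

Lemma tassocE M N P (x : M) (y : N) (z : P) : tassoc (x ⊗ y ⊗ z) = x ⊗ (y ⊗ z).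
Proof. by rewrite /tassoc (tliftE (@tassoc_bil M N P)) (tliftE (@tens3_bil M N P z)). Qed.

Lemma tmap_comp M N M1 N1 M2 N2 (f : M -> M1) (g : N -> N1) (f' : M1 -> M2) (g' : N1 -> N2) :
  linear f -> linear g -> linear f' -> linear g' ->
  forall t, tmap f' g' (tmap f g t) = tmap (f' \o f) (g' \o g) t.
Proof.
move=> fL gL fL' gL'; apply: tensor_ext => [||x y].
- by apply: lin_comp; exact: tmap_lin.
- by apply: tmap_lin; exact: lin_comp.
by rewrite /= !tmapE //; exact: lin_comp.
Qed.

Lemma tlift_tmap M N M1 N1 P (f : M -> M1) (g : N -> N1) (h : M1 -> N1 -> P) :
  linear f -> linear g -> bil h ->
  forall t, tlift h (tmap f g t) = tlift (fun x y => h (f x) (g y)) t.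
Proof.
move=> fL gL hB; apply: tensor_ext => [||x y].
- by apply: lin_comp; [exact: tlift_linear | exact: tmap_lin].
- by apply: tlift_linear; exact: bil_comp.
by rewrite /= tmapE // !tliftE //; exact: bil_comp.
Qed.

Lemma lin_tlift M N P P' (h : M -> N -> P) (g : P -> P') :
  bil h -> linear g -> forall t, g (tlift h t) = tlift (fun x y => g (h x y)) t.
Proof.
move=> hB gL; apply: tensor_ext => [||x y].
- by apply: lin_comp => //; exact: tlift_linear.
- by apply: tlift_linear; exact: bil_linear.
by rewrite /= !tliftE //; exact: bil_linear.
Qed.

Section TMul.
Variables (H : lmodType k) (mul : H -> H -> H).
Hypothesis mB : bil mul.

Let inner_bil a b : bil (fun c d : H => mul a c ⊗ mul b d).
Proof. by split=> [y|x] c u v /=; rewrite mB.2 ?tensPl ?tensPr. Qed.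

Let outer_bil t : bil (fun a b => tlift (fun c d => mul a c ⊗ mul b d) t).
Proof.
split=> [y|x] c u v /=.
  have := @tlift_lin_param _ _ _ _ (fun a c d => mul a c ⊗ mul y d) t; apply.
  by move=> x z b a a'; rewrite mB.1 tensPl.
have := @tlift_lin_param _ _ _ _ (fun b c d => mul x c ⊗ mul b d) t; apply.
by move=> z y b a a'; rewrite mB.1 tensPr.
Qed.

Lemma tmul_bil : bil (tmul mul).
Proof.
split=> [t|s] c u v; first exact: tlift_linear.
apply: (@tlift_lin_param _ _ _ _ (fun t a b => tlift (fun c d => mul a c ⊗ mul b d) t)).
by move=> a b; apply: tlift_linear.
Qed.

Lemma tmulE a b c d : tmul mul (a ⊗ b) (c ⊗ d) = mul a c ⊗ mul b d.
Proof. by rewrite /tmul !tliftE. Qed.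

Lemma tmulA : associative mul -> associative (tmul mul).
Proof.
move=> mA s t u; move: s; apply: tensor_ext => [||a b].
- by move=> c x y; rewrite tmul_bil.1.
- by move=> c x y; rewrite tmul_bil.1 tmul_bil.1.
move: t; apply: tensor_ext => [||a' b'].
- by move=> c x y; rewrite tmul_bil.1 tmul_bil.2.
- by move=> c x y; rewrite tmul_bil.2 tmul_bil.1.
move: u; apply: tensor_ext => [||a2 b2].
- by move=> c x y; rewrite !tmul_bil.2.
- by move=> c x y; rewrite tmul_bil.2.
by rewrite !tmulE !mA.
Qed.

Lemma tmulC : commutative mul -> commutative (tmul mul).
Proof.
move=> mC s t; move: s; apply: tensor_ext => [||a b].
- by move=> c x y; rewrite tmul_bil.1.
- by move=> c x y; rewrite tmul_bil.2.
move: t; apply: tensor_ext => [||a' b'].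
- by move=> c x y; rewrite tmul_bil.2.
- by move=> c x y; rewrite tmul_bil.1.
by rewrite !tmulE mC (mC b).
Qed.

Lemma tmul1l one : left_id one mul -> left_id (one ⊗ one) (tmul mul).
Proof.
move=> m1; apply: tensor_ext => [||a b] //; last by rewrite tmulE !m1.
by move=> c x y; rewrite tmul_bil.2.
Qed.

End TMul.

Lemma tmul_tmap (H H' : lmodType k) (mul : H -> H -> H) (mul' : H' -> H' -> H')
    (f : H -> H') : bil mul -> bil mul' -> linear f ->
    (forall x y, f (mul x y) = mul' (f x) (f y)) ->
  forall s t, tmap f f (tmul mul s t) = tmul mul' (tmap f f s) (tmap f f t).
Proof.
move=> mB mB' fL fM s t; have fT := tmap_lin fL fL.
move: s; apply: tensor_ext => [||a b].
- by move=> c x y; rewrite (tmul_bil mB).1 fT.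
- by move=> c x y; rewrite fT (tmul_bil mB').1.
move: t; apply: tensor_ext => [||a' b'].
- by move=> c x y; rewrite (tmul_bil mB).2 fT.
- by move=> c x y; rewrite fT (tmul_bil mB').2.
by rewrite !tmulE // !tmapE // tmulE // !fM.
Qed.

End TensorLemmas.

(** * Bialgebras and antipodes *)

Record is_bialgebra (k : comNzRingType) (H : lmodType k) (D : hopf_ops H) : Prop := {
  bialg_algebra : is_algebra D;
  bialg_coalgebra : is_coalgebra D;
  bialg_comulM : forall x y,
    hcomul D (hmul D x y) = tmul (hmul D) (hcomul D x) (hcomul D y);
  bialg_comul1 : hcomul D (hone D) = hone D ⊗ hone D;
  bialg_counitM : forall x y, hcounit D (hmul D x y) = hcounit D x * hcounit D y;
  bialg_counit1 : hcounit D (hone D) = 1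
}.

(** Replaces the placeholder that [hanti] contains as long as only the bialgebra structure is
    known. *)
Definition with_antipode (k : comNzRingType) (H : lmodType k) (D : hopf_ops H)
    (S : {linear H -> H}) : hopf_ops H :=
  HopfOps (hmul D) (hone D) (hcomul D) (hcounit D) S.

Section Convolution.
Variables (k : comNzRingType) (H : lmodType k) (D : hopf_ops H).

Definition conv (f g : H -> H) (x : H) : H :=
  tlift (fun a b => hmul D (f a) (g b)) (hcomul D x).

Implicit Types f g h : H -> H.

Let mulB : bil (hmul D) := bilinearB (hmul D).

Lemma conv_bil f g : linear f -> linear g -> bil (fun a b => hmul D (f a) (g b)).
Proof. exact: bil_comp mulB. Qed.

Lemma conv_linear f g : linear f -> linear g -> linear (conv f g).
Proof.
move=> fL gL c x y; rewrite /conv linearP.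
by rewrite (tlift_linear (conv_bil fL gL)).
Qed.

Lemma eq_conv f f' g g' : f =1 f' -> g =1 g' -> conv f g =1 conv f' g'.
Proof. by move=> ff gg x; apply: eq_tlift => a b; rewrite ff gg. Qed.

Hypothesis DB : is_bialgebra D.

(** Coassociativity moves the brackets of the coproduct; on pure tensors there remains the
    associativity of the product. *)
Lemma convA f g h : linear f -> linear g -> linear h ->
  conv f (conv g h) =1 conv (conv f g) h.
Proof.
move=> fL gL hL x.
have mA := alg_mulA (bialg_algebra DB).
have ghL := conv_bil gL hL; have fgL := conv_bil fL gL.
have cL : linear (hcomul D) by exact: linearL.
have B1 : bil (fun a s => hmul D (f a) (tlift (fun b c => hmul D (g b) (h c)) s)).
  by apply: bil_comp => //; exact: tlift_linear.
have -> : conv f (conv g h) x =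
    tlift (fun a s => hmul D (f a) (tlift (fun b c => hmul D (g b) (h c)) s))
      (tmap id (hcomul D) (hcomul D x)).
  by rewrite (tlift_tmap (@lin_id _ _) cL B1).
rewrite -(coalg_coassoc (bialg_coalgebra DB)).
have fghB : bil (fun a b => hmul D (conv f g a) (h b)).
  by apply: conv_bil => //; exact: conv_linear.
rewrite /conv; move: (hcomul D x).
apply: tensor_ext => [||a b].
- apply: lin_comp; first exact: tlift_linear.
  by apply: lin_comp; [exact: tassocL | exact: tmap_lin].
- exact: tlift_linear fghB.
rewrite (tliftE fghB) tmapE // /conv.
move: (hcomul D a); apply: tensor_ext => [||a1 a2].
- apply: lin_comp; first exact: tlift_linear.
  by apply: lin_comp; [exact: tassocL | exact: (tensP _ _).1].
- move=> c u v; rewrite (tlift_linear fgL); exact: mulB.1.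
by rewrite tassocE tliftE // !tliftE // mA.
Qed.

Definition conv_unit (x : H) : H := hcounit D x *: hone D.

Lemma conv_unitL : linear conv_unit.
Proof. by move=> c x y; rewrite /conv_unit linearP scalerDl scalerA. Qed.

Lemma conv1f f : linear f -> conv conv_unit f =1 f.
Proof.
move=> fL x; rewrite -[in RHS](coalg_counitl (bialg_coalgebra DB) x).
have eB : bil (fun (a b : H) => hcounit D a *: b).
  by split=> [y|z] c u v /=; rewrite ?linearP ?scalerDl ?scalerDr !scalerA // mulrC.
rewrite (lin_tlift eB fL); apply: eq_tlift => a b.
by rewrite /conv_unit linearZl_LR (alg_mul1l (bialg_algebra DB)) (linZ fL).
Qed.

Lemma convf1 f : linear f -> conv f conv_unit =1 f.
Proof.
move=> fL x; rewrite -[in RHS](coalg_counitr (bialg_coalgebra DB) x).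
have eB : bil (fun (a b : H) => hcounit D b *: a).
  by split=> [y|z] c u v /=; rewrite ?linearP ?scalerDl ?scalerDr !scalerA // mulrC.
rewrite (lin_tlift eB fL); apply: eq_tlift => a b.
by rewrite /conv_unit linearZr_LR (alg_mul1r (bialg_algebra DB)) (linZ fL).
Qed.

Definition conv_defect (x : H) : H := conv_unit x - x.

Lemma conv_defectL : linear conv_defect.
Proof.
move=> c x y; rewrite /conv_defect conv_unitL scalerBr opprD.
by rewrite addrACA.
Qed.

(* The powers of u∘ε - id whose sum is the geometric series inverting id. *)
Fixpoint conv_pow n : H -> H :=
  if n is n'.+1 then conv (conv_pow n') conv_defect else conv_unit.

Lemma conv_powL n : linear (conv_pow n).
Proof.
elim: n => [|n IHn]; first exact: conv_unitL.
exact: conv_linear conv_defectL.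
Qed.

(** [conv_pow] multiplies by the defect on the right; the left-hand form is what the computation
    with [id] on the left requires. *)
Lemma conv_powSl n : conv_pow n.+1 =1 conv conv_defect (conv_pow n).
Proof.
elim: n => [|n IHn] x.
  by rewrite /= (conv1f conv_defectL) (convf1 conv_defectL).
rewrite [LHS]/= (eq_conv IHn (frefl _)) -convA //.
- exact: conv_defectL.
- exact: conv_powL.
- exact: conv_defectL.
Qed.

(** With p = u∘ε - id one has id = u∘ε - p, hence p^n * id = p^n - p^(n+1): the general term of a
    telescoping sum. *)
Lemma conv_pow_id n x : conv (conv_pow n) id x = conv_pow n x - conv_pow n.+1 x.
Proof.
have pL := conv_powL n.
have Bid := conv_bil pL (@lin_id _ H); have Bdef := conv_bil pL conv_defectL.
apply/eqP; rewrite eq_sym subr_eq -{1}(convf1 pL x); apply/eqP; rewrite addrC -/conv.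
rewrite /= /conv; move: (hcomul D x); apply: tensor_ext => [||a b].
- exact: tlift_linear (conv_bil pL conv_unitL).
- move=> c u v; rewrite (tlift_linear Bid) (tlift_linear Bdef).
  by rewrite scalerDr addrACA.
rewrite (tliftE Bid) (tliftE Bdef) (tliftE (conv_bil pL conv_unitL)).
by rewrite -linearDr subrK.
Qed.

Lemma conv_id_pow n x : conv id (conv_pow n) x = conv_pow n x - conv_pow n.+1 x.
Proof.
have pL := conv_powL n.
have Bid := conv_bil (@lin_id _ H) pL; have Bdef := conv_bil conv_defectL pL.
apply/eqP; rewrite eq_sym subr_eq conv_powSl -{1}(conv1f pL x); apply/eqP; rewrite addrC.
rewrite /= /conv; move: (hcomul D x); apply: tensor_ext => [||a b].
- exact: tlift_linear (conv_bil conv_unitL pL).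
- move=> c u v; rewrite (tlift_linear Bid) (tlift_linear Bdef).
  by rewrite scalerDr addrACA.
rewrite (tliftE Bid) (tliftE Bdef) (tliftE (conv_bil conv_unitL pL)).
by rewrite -linearDl subrK.
Qed.

End Convolution.

Lemma hopf_of_bialgebra (k : comNzRingType) (H : lmodType k) (D : hopf_ops H)
    (S : {linear H -> H}) : is_bialgebra D ->
    (forall x, conv D S id x = conv_unit D x) ->
    (forall x, conv D id S x = conv_unit D x) ->
  is_hopf_algebra (with_antipode D S).
Proof. by case=> -[? ? ?] [? ? ?] *; split. Qed.

(** The cut-off is chosen point by point, but the sum does not depend on it; a cut-off common to [x]
    and [y] then gives linearity. *)
Lemma locally_finite_sum (k : comNzRingType) (U V : lmodType k) (P : nat -> U -> V) :
  (forall n, linear (P n)) ->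
  (forall x, exists N, forall n, (N <= n)%N -> P n x = 0) ->
  exists S : {linear U -> V}, forall x N, (forall n, (N <= n)%N -> P n x = 0) ->
    S x = \sum_(n < N) P n x.
Proof.
move=> PL Pfin.
have [N HN] := choice Pfin.
pose S x := \sum_(n < N x) P n x.
have SE x M : (forall n, (M <= n)%N -> P n x = 0) -> S x = \sum_(n < M) P n x.
  have trunc a b : (forall n, (a <= n)%N -> P n x = 0) -> (a <= b)%N ->
      \sum_(n < b) P n x = \sum_(n < a) P n x.
    move=> Pa le_ab; rewrite -!(big_mkord xpredT (fun n => P n x)).
    rewrite (big_cat_nat (leq0n a) le_ab) //= [X in _ + X]big1_seq ?addr0 // => n.
    by rewrite mem_index_iota => /andP[_ /andP[/Pa]].
  move=> PM; have [le|/ltnW le] := leqP M (N x); first by rewrite /S (trunc M).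
  by rewrite /S (trunc (N x)) //; exact: HN.
have SL : linear S.
  move=> c x y; pose M := (N x + N y)%N.
  have Px n : (M <= n)%N -> P n x = 0.
    by move=> le; apply: HN; apply: leq_trans le; exact: leq_addr.
  have Py n : (M <= n)%N -> P n y = 0.
    by move=> le; apply: HN; apply: leq_trans le; exact: leq_addl.
  rewrite (SE x M) // (SE y M) // (SE _ M) => [|n le]; last first.
    by rewrite PL Px // Py // scaler0 addr0.
  by rewrite scaler_sumr -big_split; apply: eq_bigr => n _; rewrite PL.
by exists (pack_linear SL).
Qed.

(** Directness comes from the projections: applied to a vanishing sum of homogeneous terms, the
    projection onto degree [n] leaves the n-th term alone. *)
Lemma grading_by_projections (k : comNzRingType) (H : lmodType k) (G : nat -> H -> Prop) :
    (forall n, submodule (G n)) ->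
    (forall P, submodule P -> (forall n x, G n x -> P x) -> forall x, P x) ->
    (forall n, exists F : {linear H -> H}, forall i x, G i x -> F x = if i == n then x else 0) ->
  is_grading G.
Proof.
move=> sG Gind Gproj; split=> // [x|m f fG f0 n lt_nm].
  move: x; apply: Gind => [|n x Gx]; last first.
    exists n.+1, (fun i => if i == n then x else 0); split.
      by move=> i; case: eqP => [->|_] //; exact: submodule0.
    by rewrite (bigD1 ord_max) //= eqxx big1 ?addr0 // => i /negPf; rewrite -val_eqE /= => ->.
  split=> [|c x y [m [f [fG ->]]] [m' [f' [f'G ->]]]].
    by exists 0%N, (fun _ => 0); split=> [n|]; [exact: submodule0 | rewrite big_ord0].
  exists (m + m')%N, (fun n => c *: (if (n < m)%N then f n else 0) +
                              (if (n < m')%N then f' n else 0)); split.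
    by move=> n; apply: (sG n).2; case: ifP => // _; exact: submodule0.
  rewrite scaler_sumr big_split /=; congr (_ + _).
    rewrite (big_ord_widen_cond (m + m') xpredT (fun i => c *: f i)) ?leq_addr //=.
    by rewrite big_mkcond; apply: eq_bigr => i _; case: ifP => // _; rewrite scaler0.
  rewrite (big_ord_widen_cond (m + m') xpredT f') ?leq_addl //=.
  by rewrite big_mkcond.
have [F FG] := Gproj n.
have := congr1 F f0; rewrite linear_sum linear0 (bigD1 (Ordinal lt_nm)) //=.
rewrite (FG n) // eqxx big1 ?addr0 // => i; rewrite -val_eqE /= => /negPf ne.
by rewrite (FG i) // ne.
Qed.

Section GradedAntipode.
Variables (k : comNzRingType) (H : lmodType k) (D : hopf_ops H) (G : nat -> H -> Prop).
Hypotheses (DB : is_bialgebra D) (GG : is_grading G).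
Hypothesis Gmul : forall m n x y, G m x -> G n y -> G (m + n)%N (hmul D x y).
Hypothesis Gone : G 0%N (hone D).
Hypothesis Gcomul : forall n x, G n x ->
  Defs.span (fun t => exists i j a b,
     [/\ (i + j)%N = n, G i a, G j b & t = a ⊗ b]) (hcomul D x).
Hypothesis Gcounit : forall n x, G n x -> (0 < n)%N -> hcounit D x = 0.
Hypothesis Gconn : forall x, G 0%N x -> exists c : k, x = c *: hone D.

Let conv_defect0 x : G 0%N x -> conv_defect D x = 0.
Proof.
move=> /Gconn[c ->]; rewrite /conv_defect /conv_unit linearZ_LR /=.
by rewrite (bialg_counit1 DB) mulr1 subrr.
Qed.

Let conv_unitG n x : G n x -> G n (conv_unit D x).
Proof.
case: n => [|n] Gx; first by apply: submoduleZ => //; exact: grading_sub.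
rewrite /conv_unit (Gcounit Gx) // scale0r.
exact: (submodule0 (grading_sub GG _)).
Qed.

Let conv_defectG n x : G n x -> G n (conv_defect D x).
Proof.
move=> Gx; have sG := grading_sub GG n; rewrite /conv_defect -scaleN1r addrC.
by apply: sG.2 => //; exact: conv_unitG.
Qed.

Lemma conv_pow_graded n m x : G m x -> G m (conv_pow D n x).
Proof.
elim: n m x => [|n IHn] m x Gx /=; first exact: conv_unitG.
have B := conv_bil D (conv_powL D n) (conv_defectL D).
rewrite /conv; apply: (Gcomul Gx (W := fun t => G m (tlift _ t)))
  => [|_ [i [j [a [b [ij Ga Gb ->]]]]]].
  by apply: lin_subset (tlift_linear B) _; exact: grading_sub.
by rewrite (tliftE B) -ij; apply: Gmul; [exact: IHn | exact: conv_defectG].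
Qed.

(** By connectedness the defect vanishes in degree 0, so each of the [n] convolution factors uses up
    at least one degree. *)
Lemma conv_pow_nilp n m x : G m x -> (m < n)%N -> conv_pow D n x = 0.
Proof.
elim: n m x => [//|n IHn] m x Gx lt_mn /=.
have B := conv_bil D (conv_powL D n) (conv_defectL D).
apply: (Gcomul Gx (W := fun t => tlift _ t = 0)) => [|_ [i [j [a [b [eij Ga Gb ->]]]]]].
  split=> [|c u v u0 v0]; first exact: lin0 (tlift_linear B).
  by rewrite (tlift_linear B) u0 v0 scaler0 addr0.
rewrite (tliftE B); case: j eij Gb => [|j] eij Gb.
  by rewrite (conv_defect0 Gb) linear0r.
by rewrite (IHn i) ?linear0l //; lia.
Qed.

Let conv_pow_fin x : exists N, forall n, (N <= n)%N -> conv_pow D n x = 0.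
Proof.
have [m [f [Gf ->]]] := grading_sum GG x; exists m => n le_mn.
rewrite (lin_sum (conv_powL D n)) big1 // => i _.
by apply: (conv_pow_nilp (Gf i)); exact: leq_trans le_mn.
Qed.

(** The last clause keeps the antipode as a pointwise finite sum of convolution powers, the form in
    which a bialgebra morphism carries it over. *)
Lemma graded_antipode : exists S : {linear H -> H},
  [/\ is_hopf_algebra (with_antipode D S),
      forall n x, G n x -> G n (S x) &
      forall x, exists N, S x = \sum_(n < N) conv_pow D n x].
Proof.
have [S HS] := locally_finite_sum (conv_powL D) conv_pow_fin.
have SG m x N : G m x -> (m < N)%N -> S x = \sum_(n < N) conv_pow D n x.
  move=> Gx lt_mN; apply: HS => n le_Nn.
  by apply: (conv_pow_nilp Gx); exact: leq_trans le_Nn.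
have SL := linearL S.
(* The power [m.+1] vanishes at [x], so only the zeroth power [conv_unit] survives. *)
have telescope m x : G m x ->
    \sum_(n < m.+1) (conv_pow D n x - conv_pow D n.+1 x) = conv_unit D x.
  move=> Gx; rewrite -[RHS]subr0 -[X in _ - X](conv_pow_nilp Gx (ltnSn m)).
  elim: m.+1 => [|M IHM]; first by rewrite big_ord0 subrr.
  by rewrite big_ord_recr /= IHM addrA subrK.
have S_id m x : G m x -> conv D S id x = conv_unit D x.
  move=> Gx; rewrite -(telescope m x Gx).
  under eq_bigr do rewrite -(conv_pow_id DB).
  have B n := conv_bil D (conv_powL D n) (@lin_id _ H).
  (* All tensor factors in the coproduct of [x] have degree at most [m], so the single cut-off
     [m.+1] computes [S] on each of them. *)
  apply: (Gcomul Gx (W := fun t => tlift _ t = \sum_(n < m.+1) tlift _ t)).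
    apply: lin_eq_submodule; first exact: tlift_linear (conv_bil D SL (@lin_id _ H)).
    by apply: lin_sumf => n; exact: tlift_linear (B n).
  move=> _ [i [j [a [b [eij Ga Gb ->]]]]].
  rewrite (tliftE (conv_bil D SL (@lin_id _ H))) (SG _ _ m.+1 Ga); last by lia.
  by rewrite linear_sumlz; apply: eq_bigr => n _; rewrite (tliftE (B n)).
have id_S m x : G m x -> conv D id S x = conv_unit D x.
  move=> Gx; rewrite -(telescope m x Gx).
  under eq_bigr do rewrite -(conv_id_pow DB).
  have B n := conv_bil D (@lin_id _ H) (conv_powL D n).
  apply: (Gcomul Gx (W := fun t => tlift _ t = \sum_(n < m.+1) tlift _ t)).
    apply: lin_eq_submodule; first exact: tlift_linear (conv_bil D (@lin_id _ H) SL).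
    by apply: lin_sumf => n; exact: tlift_linear (B n).
  move=> _ [i [j [a [b [eij Ga Gb ->]]]]].
  rewrite (tliftE (conv_bil D (@lin_id _ H) SL)) (SG _ _ m.+1 Gb); last by lia.
  by rewrite linear_sumr; apply: eq_bigr => n _; rewrite (tliftE (B n)).
have Gind (f g : H -> H) : linear f -> linear g ->
    (forall m x, G m x -> f x = g x) -> forall x, f x = g x.
  move=> fL gL fg x; have [m [e [Ge ->]]] := grading_sum GG x.
  rewrite (lin_sum fL) (lin_sum gL); apply: eq_bigr => i _; exact: fg (Ge i).
exists S; split=> [|m x Gx|x].
- apply: hopf_of_bialgebra => //.
    exact: (Gind _ _ (conv_linear D SL (@lin_id _ H)) (conv_unitL D) S_id).
  exact: (Gind _ _ (conv_linear D (@lin_id _ H) SL) (conv_unitL D) id_S).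
- rewrite (SG m x m.+1 Gx) //; apply: (submodule_sum (grading_sub GG m)) => n _.
  exact: conv_pow_graded.
by have [N HN] := conv_pow_fin x; exists N; exact: HS.
Qed.

End GradedAntipode.

(** * Hopf structures along surjections and bijections *)

Section HopfSurjection.
Variables (k : comNzRingType) (H H' : lmodType k).
Variables (D : hopf_ops H) (D' : hopf_ops H') (f : {linear H -> H'}).
Hypothesis f_surj : forall y, exists x, f x = y.
Hypothesis fM : forall x y, f (hmul D x y) = hmul D' (f x) (f y).
Hypothesis f1 : f (hone D) = hone D'.
Hypothesis f_comul : forall x, tmap f f (hcomul D x) = hcomul D' (f x).
Hypothesis f_counit : forall x, hcounit D' (f x) = hcounit D x.

Let fL : linear f := linearL f.

(** Convolution powers involve only the product, unit, coproduct and counit, all of which [f]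
    respects. *)
Lemma conv_pow_morph n x : f (conv_pow D n x) = conv_pow D' n (f x).
Proof.
elim: n x => [|n IHn] x /=.
  by rewrite /conv_unit linearZ_LR f1 f_counit.
rewrite /conv -f_comul .
have B := conv_bil D (conv_powL D n) (conv_defectL D).
have B' := conv_bil D' (conv_powL D' n) (conv_defectL D').
rewrite (lin_tlift B fL) (tlift_tmap fL fL B').
apply: eq_tlift => a b; rewrite fM IHn; congr (hmul D' _ _).
by rewrite /conv_defect /conv_unit linearB linearZ_LR f1 f_counit.
Qed.

(** Every element of [H'] has the form [f x], and there each axiom is the image of the corresponding
    axiom of [H]. *)
Lemma surj_bialgebra : is_bialgebra D -> is_bialgebra D'.
Proof.
case=> -[mA m1l m1r] [cA cl cr] cM c1 eM e1.
have cL := linearL (hcomul D); have cL' := linearL (hcomul D').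
have eB (E : lmodType k) (e : {scalar E}) : bil (fun (a b : E) => e a *: b).
  by split=> [y|z] c u v /=; rewrite ?linearP ?scalerDl ?scalerDr !scalerA // mulrC.
have eB' (E : lmodType k) (e : {scalar E}) : bil (fun (a b : E) => e b *: a).
  by split=> [y|z] c u v /=; rewrite ?linearP ?scalerDl ?scalerDr !scalerA // mulrC.
split.
- split=> [y1 y2 y3|y|y].
  + have [x1 <-] := f_surj y1; have [x2 <-] := f_surj y2.
    by have [x3 <-] := f_surj y3; rewrite -!fM mA.
  + by have [x <-] := f_surj y; rewrite -f1 -fM m1l.
  by have [x <-] := f_surj y; rewrite -f1 -fM m1r.
- split=> y; have [x <-] := f_surj y; rewrite -f_comul.
  + have tfL := tmap_lin fL fL.
    (* Naturality of the associator, which lets coassociativity pass through [f]. *)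
    have f3E t : tassoc (tmap (tmap f f) f t) = tmap f (tmap f f) (tassoc t).
      have f3L := tmap_lin fL tfL.
      move: t; apply: tensor_ext => [||t c].
      * by apply: lin_comp; [exact: tassocL | exact: tmap_lin].
      * by apply: lin_comp => //; exact: tassocL.
      move: t; apply: tensor_ext => [||a b].
      * apply: lin_comp (@tassocL k H' H' H') _.
        by apply: lin_comp (tmap_lin tfL fL) _; exact: (tensP _ _).1.
      * apply: lin_comp f3L _.
        by apply: lin_comp (@tassocL k H H H) _; exact: (tensP _ _).1.
      rewrite (tmapE tfL fL) (tmapE fL fL) (tassocE a b c) (tassocE (f a)).
      by rewrite (tmapE fL tfL) (tmapE fL fL).
    have E1 : tmap (hcomul D') id (tmap f f (hcomul D x)) =
        tmap (tmap f f) f (tmap (hcomul D) id (hcomul D x)).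
      rewrite (tmap_comp fL fL cL' (@lin_id _ _)) (tmap_comp cL (@lin_id _ _) tfL fL).
      by apply: eq_tmap => // a; rewrite /= f_comul.
    have E2 : tmap id (hcomul D') (tmap f f (hcomul D x)) =
        tmap f (tmap f f) (tmap id (hcomul D) (hcomul D x)).
      rewrite (tmap_comp fL fL (@lin_id _ _) cL') (tmap_comp (@lin_id _ _) cL fL tfL).
      by apply: eq_tmap => // a; rewrite /= f_comul.
    by rewrite E1 E2 -cA f3E.
  + rewrite -[in RHS](cl x) .
    rewrite (tlift_tmap fL fL (eB _ _)) (lin_tlift (eB _ _) fL).
    by apply: eq_tlift => a b; rewrite linearZ_LR f_counit.
  rewrite -[in RHS](cr x) .
  rewrite (tlift_tmap fL fL (eB' _ _)) (lin_tlift (eB' _ _) fL).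
  by apply: eq_tlift => a b; rewrite linearZ_LR f_counit.
- move=> y1 y2; have [x1 <-] := f_surj y1; have [x2 <-] := f_surj y2.
  rewrite -fM -!f_comul cM.
  exact: (tmul_tmap (bilinearB (hmul D)) (bilinearB (hmul D')) fL fM).
- by rewrite -f1 -f_comul c1 tmapE.
- move=> y1 y2; have [x1 <-] := f_surj y1; have [x2 <-] := f_surj y2.
  by rewrite -fM !f_counit eM.
by rewrite -f1 f_counit.
Qed.

Hypothesis DH : is_hopf_algebra D.
Hypothesis kerS : forall x, f x = 0 -> f (hanti D x) = 0.

Lemma hopf_bialgebra : is_bialgebra D.
Proof. by case: DH. Qed.

(** By [kerS] the antipode factors through [f]; its two identities are then the images of those in
    [H]. *)
Lemma surj_hopf : exists S' : {linear H' -> H'},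
  is_hopf_algebra (with_antipode D' S') /\ is_hopf_morphism D (with_antipode D' S') f.
Proof.
have [r rK] := choice f_surj.
(* The value does not depend on the preimage [r y]: two preimages differ by an element of the
   kernel, to which [kerS] applies. *)
pose S' y := f (hanti D (r y)).
have S'E x : S' (f x) = f (hanti D x).
  apply/eqP; rewrite -subr_eq0 /S' -!linearB; apply/eqP; apply: kerS.
  by rewrite linearB rK subrr.
have S'L : linear S'.
  move=> c u v; rewrite -[u]rK -[v]rK -linearP !S'E -linearP.
  by rewrite -linearP.
have DB' := surj_bialgebra hopf_bialgebra.
exists (pack_linear S'L); split; last by split.
have hL := linearL (hanti D).
apply: hopf_of_bialgebra => // y; have [x <-] := f_surj y.
  rewrite /conv /conv_unit -f_comul f_counit -f1 -linearZ_LR -(hopf_antil DH).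
    rewrite (tlift_tmap fL fL (conv_bil D' S'L (@lin_id _ _))).
  rewrite (lin_tlift (conv_bil D hL (@lin_id _ _)) fL).
  by apply: eq_tlift => a b; rewrite fM S'E.
rewrite /conv /conv_unit -f_comul f_counit -f1 -linearZ_LR -(hopf_antir DH).
rewrite (tlift_tmap fL fL (conv_bil D' (@lin_id _ _) S'L)).
rewrite (lin_tlift (conv_bil D (@lin_id _ _) hL) fL).
by apply: eq_tlift => a b; rewrite fM S'E.
Qed.

End HopfSurjection.

Lemma hopf_morphism_comp (k : comNzRingType) (H1 H2 H3 : lmodType k)
    (D1 : hopf_ops H1) (D2 : hopf_ops H2) (D3 : hopf_ops H3)
    (f : {linear H1 -> H2}) (g : {linear H2 -> H3}) (h : {linear H1 -> H3}) :
    is_hopf_morphism D1 D2 f -> is_hopf_morphism D2 D3 g -> (forall x, g (f x) = h x) ->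
  is_hopf_morphism D1 D3 h.
Proof.
move=> fH gH hE.
have fL := linearL f; have gL := linearL g.
split=> [x y||x|x|x].
- by rewrite -!hE (hmor_mul fH) (hmor_mul gH).
- by rewrite -hE (hmor_one fH) (hmor_one gH).
- rewrite -hE -(hmor_comul gH) -(hmor_comul fH) (tmap_comp fL fL gL gL).
  by apply: eq_tmap => y; rewrite -hE.
- by rewrite -hE (hmor_counit gH) (hmor_counit fH).
by rewrite -!hE (hmor_anti fH) (hmor_anti gH).
Qed.

Section HopfTransport.
Variables (k : comNzRingType) (H H' : lmodType k) (D : hopf_ops H).
Variables (f : {linear H' -> H}) (g : {linear H -> H'}).
Hypotheses (fK : cancel f g) (gK : cancel g f).

Let fL : linear f := linearL f.
Let gL : linear g := linearL g.

Let mul' (x y : H') : H' := g (hmul D (f x) (f y)).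
Let mulB : bil mul'.
Proof. exact: bil_linear (bil_comp (bilinearB (hmul D)) fL fL) gL. Qed.

Let comul' (x : H') : (H' ⊗ H')%type := tmap g g (hcomul D (f x)).
Let comulL : linear comul'.
Proof. exact: lin_comp (tmap_lin gL gL) (lin_comp (linearL (hcomul D)) fL). Qed.

Let counit' (x : H') : k := hcounit D (f x).
Let counitL : scalar counit'.
Proof. by move=> c x y; rewrite /counit' !linearP. Qed.

(** Only the bialgebra operations are transported by hand, with the identity in place of the
    antipode; [surj_hopf] along [g] then supplies the antipode, its kernel condition being trivial
    because [g] is injective. *)
Lemma hopf_transport : is_hopf_algebra D -> exists D' : hopf_ops H',
  [/\ is_hopf_algebra D', is_hopf_morphism D D' g & is_hopf_morphism D' D f].
Proof.
move=> DH.
pose cm : {linear H' -> (H' ⊗ H')%type} := HB.pack comul' (GRing.isLinear.Build _ _ _ _ _ comulL).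
pose cu : {scalar H'} := HB.pack counit' (GRing.isLinear.Build _ _ _ _ _ counitL).
pose D0 := HopfOps (pack_bilinear mulB) (g (hone D)) cm cu (pack_linear (@lin_id k H')).
have g_surj y : exists x, g x = y by exists (f y).
have gM x y : g (hmul D x y) = hmul D0 (g x) (g y) by rewrite /= /mul' !gK.
have g_comul x : tmap g g (hcomul D x) = hcomul D0 (g x) by rewrite /= /comul' gK.
have g_counit x : hcounit D0 (g x) = hcounit D x by rewrite /= /counit' gK.
have kerS x : g x = 0 -> g (hanti D x) = 0.
  by move=> gx; rewrite -[x]gK gx !linear0.
have [S [SH SM]] := surj_hopf g_surj gM (erefl _) g_comul g_counit DH kerS.
exists (with_antipode D0 S); split=> //; split=> [x y||x|x|x].
- by rewrite /= /mul' gK.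
- by rewrite /= gK.
- rewrite /= /comul' (tmap_comp gL gL fL fL).
  have fgL : linear (f \o g) by exact: lin_comp.
  move: (hcomul D (f x)); apply: tensor_ext => [||a b] //; first exact: tmap_lin.
  by rewrite tmapE //= !gK.
- by rewrite /= /counit'.
by rewrite -[x in LHS]fK -(hmor_anti SM) gK.
Qed.

End HopfTransport.

(** * Partitions between two partitions *)

Section Between.
Implicit Types mu eta lam e : seq nat.
Local Open Scope nat_scope.

(* The partitions eta with mu ⊆ eta ⊆ lam, padded to the common length of mu and lam. *)
Fixpoint btw mu lam : seq (seq nat) :=
  match mu, lam with
  | m :: mu', l :: lam' =>
      [seq x :: e | e <- btw mu' lam', x <- [seq x <- iota m (l.+1 - m) | head 0 e <= x]]
  | _, _ => [:: [::]]
  end.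

Lemma all2_leq_refl e : all2 leq e e.
Proof. by elim: e => //= x e ->; rewrite leqnn. Qed.

Lemma all2_leq_trans e1 e2 e3 : all2 leq e1 e2 -> all2 leq e2 e3 -> all2 leq e1 e3.
Proof.
elim: e1 e2 e3 => [|x1 e1 IHe] [|x2 e2] [|x3 e3] //= /andP[le12 le] /andP[le23 le'].
by rewrite (leq_trans le12 le23) (IHe e2).
Qed.

Lemma all2_leq_size e1 e2 : all2 leq e1 e2 -> size e1 = size e2.
Proof. by rewrite all2E => /andP[/eqP]. Qed.

Lemma part_le_all2 e1 e2 : size e1 = size e2 -> part_le e1 e2 = all2 leq e1 e2.
Proof.
move=> sz; apply/part_leP/idP.
  elim: e1 e2 sz => [|x1 e1 IHe] [|x2 e2] //= [sz] le.
  by rewrite (le 0) /=; apply: IHe => // i; exact: (le i.+1).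
move=> le i; elim: e1 e2 le {sz} i => [|x1 e1 IHe] [|x2 e2] //= /andP[le12 le] [|i] //=.
exact: IHe.
Qed.

Lemma sorted_geq_cons x e : sorted geq (x :: e) = (head 0 e <= x) && sorted geq e.
Proof. by case: e. Qed.

Lemma sorted_geq_cat e1 e2 : sorted geq e1 -> sorted geq e2 ->
  head 0 e2 <= last (head 0 e2) e1 -> sorted geq (e1 ++ e2).
Proof.
elim: e1 => // x e1 IHe; rewrite cat_cons !sorted_geq_cons => /andP[le_x s1] s2 le.
rewrite IHe //; last by case: e1 le {IHe le_x s1}.
by rewrite andbT; case: e1 le_x le {IHe s1}.
Qed.

Lemma mem_btw mu lam eta : size mu = size lam ->
  (eta \in btw mu lam) = [&& sorted geq eta, all2 leq mu eta & all2 leq eta lam].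
Proof.
elim: mu lam eta => [|m mu IHm] [|l lam] //= eta.
  by rewrite inE; case: eta => //= *; rewrite andbF.
move=> [sz]; apply/allpairsPdep/idP => [[e [x [e_btw + ->]]]|].
  rewrite mem_filter mem_iota => /andP[le_ex le_mxl].
  move: e_btw; rewrite IHm // => /and3P[se le1 le2].
  by rewrite sorted_geq_cons le_ex se /= le1 le2; lia.
case: eta => [|x e] /=; first by [].
rewrite -/(sorted geq (x :: e)) sorted_geq_cons.
case/and3P=> /andP[le_ex se] /andP[le_mx le1] /andP[le_xl le2].
exists e, x; rewrite IHm // se le1 le2 mem_filter le_ex mem_iota; split=> //=; lia.
Qed.

Lemma uniq_btw mu lam : uniq (btw mu lam).
Proof.
elim: mu lam => [|m mu IHm] [|l lam] //=.
apply: allpairs_uniq_dep => //; first by move=> e _; rewrite filter_uniq // iota_uniq.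
by move=> [e x] [e' x'] /= _ _ [-> ->].
Qed.

Lemma btw_sub_l mu lam eta : size mu = size lam -> eta \in btw mu lam ->
  perm_eq (btw mu eta) [seq e <- btw mu lam | all2 leq e eta].
Proof.
move=> sz; rewrite mem_btw // => /and3P[se le1 le2].
apply: uniq_perm; rewrite ?filter_uniq ?uniq_btw // => e.
have sz1 := all2_leq_size le1; rewrite mem_filter !mem_btw //.
apply/and3P/and4P=> [[? ? le]|[? ? ? _]]; last by split.
by split=> //; exact: all2_leq_trans le2.
Qed.

Lemma btw_sub_r mu lam eta : size mu = size lam -> eta \in btw mu lam ->
  perm_eq (btw eta lam) [seq e <- btw mu lam | all2 leq eta e].
Proof.
move=> sz; rewrite mem_btw // => /and3P[se le1 le2].
apply: uniq_perm; rewrite ?filter_uniq ?uniq_btw // => e.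
have sz2 := all2_leq_size le2; rewrite mem_filter !mem_btw //.
apply/and3P/and4P=> [[? le ?]|[? ? _ ?]]; last by split.
by split=> //; exact: all2_leq_trans le.
Qed.

Section Sums.
Variable V : nmodType.
Local Open Scope ring_scope.

Lemma sum_btw_cons m mu l lam (F : seq nat -> V) :
  \sum_(e <- btw (m :: mu) (l :: lam)) F e =
  \sum_(e <- btw mu lam) \sum_(x <- iota m (l.+1 - m) | (head 0 e <= x)%N) F (x :: e).
Proof.
rewrite /= big_allpairs_dep; apply: eq_bigr => e _.
by rewrite big_filter.
Qed.

(** Both sides run over the pairs [e] ⊆ [eta] of partitions between [mu] and [lam]. The condition
    [P] makes room for the first strip of a chain as well as for plain double cuts. *)
Lemma exchange_btw mu lam (P Q : rel (seq nat)) (F : seq nat -> seq nat -> V) :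
    size mu = size lam ->
  \sum_(eta <- btw mu lam) \sum_(e <- btw mu eta | P e eta) F e eta =
  \sum_(e <- btw mu lam) \sum_(eta <- btw e lam | P e eta) F e eta.
Proof.
move=> sz.
transitivity (\sum_(eta <- btw mu lam) \sum_(e <- btw mu lam | all2 leq e eta && P e eta)
                F e eta).
  rewrite big_seq [RHS]big_seq; apply: eq_bigr => eta eta_btw.
  by rewrite (perm_big _ (btw_sub_l sz eta_btw)) big_filter_cond.
rewrite (exchange_big_dep xpredT) //= big_seq [RHS]big_seq; apply: eq_bigr => e e_btw.
by rewrite (perm_big _ (btw_sub_r sz e_btw)) big_filter_cond.
Qed.

(** The last part of [e1] is at least that of [mu1], hence at least the first part of [lam2], hence
    of [e2]: every concatenation [e1 ++ e2] is decreasing. The default of [last] makes the condition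
    hold when [mu1] is empty. *)
Lemma sum_btw_cat mu1 mu2 lam1 lam2 (F : seq nat -> V) :
    size mu1 = size lam1 -> size mu2 = size lam2 ->
    (head 0 lam2 <= last (head 0 lam2) mu1)%N ->
  \sum_(e <- btw (mu1 ++ mu2) (lam1 ++ lam2)) F e =
  \sum_(e1 <- btw mu1 lam1) \sum_(e2 <- btw mu2 lam2) F (e1 ++ e2).
Proof.
move=> + sz2; elim: mu1 lam1 F => [|m mu1 IHm] [|l lam1] // F.
  by rewrite /= big_seq1.
case=> sz1 junct; rewrite !cat_cons !sum_btw_cons IHm //; last first.
  by case: mu1 junct {IHm sz1} => //=.
rewrite big_seq [RHS]big_seq; apply: eq_bigr => e1.
rewrite mem_btw // => /and3P[_ /all2_leq_size sz_e1 _].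
rewrite [RHS]exchange_big /= big_seq [RHS]big_seq; apply: eq_bigr => e2.
rewrite mem_btw // => /and3P[_ _ le2].
(* The new part [x] meets the head of [e2] only if [e1] is empty; then [junct] bounds that head by
   [m], and [m] is at most [x]. *)
case: e1 sz_e1 => [|x1 e1 _] //= /size0nil mu1_nil.
rewrite big_seq_cond [RHS]big_seq_cond; apply: eq_bigl => x.
rewrite mem_iota; have [/andP[le_mx _]|//] := boolP (m <= x < _)%N.
apply: leq_trans le_mx; rewrite mu1_nil /= in junct; apply: leq_trans junct.
by case: e2 lam2 le2 {IHm sz2} => [|x2 e2] [|l2 lam2] //= /andP[].
Qed.

Lemma sum_btw_shift c mu lam (F : seq nat -> V) :
  \sum_(e <- btw [seq (x + c)%N | x <- mu] [seq (x + c)%N | x <- lam]) F e =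
  \sum_(e <- btw mu lam) F [seq (x + c)%N | x <- e].
Proof.
elim: mu lam F => [|m mu IHm] [|l lam] F; rewrite ?big_seq1 // !map_cons !sum_btw_cons IHm.
apply: eq_bigr => e _; have -> : ((l + c).+1 - (m + c) = l.+1 - m)%N by lia.
rewrite addnC iotaDl big_map; apply: eq_big => [x|x _]; last by rewrite addnC.
by case: e => //= y e; rewrite addnC leq_add2l.
Qed.

End Sums.

(** The interlacing condition eta_(i+1) <= mu_i, a row-by-row form of being a horizontal strip that
    is compatible with concatenation. *)
Fixpoint strip mu eta : bool :=
  match mu, eta with
  | m :: mu', x :: eta' => (head 0 eta' <= m) && strip mu' eta'
  | _, _ => true
  end.

Lemma strip_self mu : sorted geq mu -> strip mu mu.
Proof.
elim: mu => //= m mu IHm; rewrite -/(sorted geq (m :: mu)) sorted_geq_cons.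
by case/andP=> -> /IHm.
Qed.

Lemma strip_cat mu1 mu2 e1 e2 : size mu1 = size e1 -> 
    (head 0 e2 <= last (head 0 e2) mu1)%N ->
  strip (mu1 ++ mu2) (e1 ++ e2) = strip mu1 e1 && strip mu2 e2.
Proof.
elim: mu1 e1 => [|m mu1 IHm] [|x1 e1] //= [sz] junct.
rewrite IHm //; last by case: mu1 junct {IHm sz}.
case: e1 sz {IHm} => [|x e1] /= sz; last by rewrite andbA.
by rewrite (size0nil sz) /= in junct *; rewrite junct.
Qed.

Lemma stripP mu eta : size mu = size eta ->
  reflect (forall i, nth 0 eta i.+1 <= nth 0 mu i) (strip mu eta).
Proof.
elim: mu eta => [|m mu IHm] [|x eta] //=.
  by move=> _; apply: ReflectT => i; rewrite nth_nil.
move=> [sz]; apply: (iffP andP) => [[le /(IHm _ sz) st] [|i]|st].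
- by rewrite nth0.
- exact: st.
by split; [rewrite -nth0; exact: (st 0) | apply/IHm => // i; exact: (st i.+1)].
Qed.

(** If interlacing fails at row i, the column eta_i contains boxes of rows i and i+1. If it holds,
    boxes of rows i < i' in a column j would give eta_i <= j < eta'_(i') <= eta'_(i+1) <= eta_i. *)
Lemma horizontal_strip_btw eta eta' :
    sorted geq eta -> sorted geq eta' -> all2 leq eta eta' ->
  horizontal_strip eta eta' = strip eta eta'.
Proof.
move=> s s' le; have sz := all2_leq_size le.
have /part_leP le_nth : part_le eta eta' by rewrite part_le_all2.
apply/idP/(stripP sz) => [/'forall_'forall_'forall_implyP hs i|st].
  rewrite leqNgt; apply/negP => lt.
  have i_lt : i.+1 < size eta'.
    by rewrite ltnNge; apply/negP => /(nth_default 0) e0; rewrite e0 in lt.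
  pose j := nth 0 eta i.
  have j_lt0 : j < nth 0 eta' 0.
    by apply: leq_trans lt _; exact: sorted_geq_nth.
  have j_lt : j < head 0 eta' by rewrite -nth0.
  have := hs (Ordinal (ltnW i_lt)) (Ordinal i_lt) (Ordinal j_lt).
  rewrite /in_diagram /= leqnn lt /= (sorted_geq_nth s (leqnSn i)) andbT.
  by rewrite (leq_trans lt) ?(sorted_geq_nth s') // => /(_ isT)/eqP[]; lia.
apply/'forall_'forall_'forall_implyP => i i' j; rewrite /in_diagram.
case/andP=> /andP[le1 lt1] /andP[le2 lt2]; apply/eqP/val_inj => /=.
wlog lt_ii : i i' le1 lt1 le2 lt2 / i < i'.
  case: (ltngtP i i') => // lt_ii wl; first exact: wl.
  by apply/esym; exact: wl.
have := st i; have := sorted_geq_nth s' (lt_ii : i.+1 <= i'); lia.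
Qed.

End Between.

(** * Cutting rows *)

Section Rows.
Variable A : choiceType.
Implicit Types (h p q : seq (nat * seq A)) (eta e : seq nat).
Local Open Scope nat_scope.

(* A tableau possibly padded by rows (0, [::]): such rows appear when a tableau
   is cut, and restrict removes them. *)
Definition is_pre h : bool := sorted geq (inner h) && sorted geq (outer h).

(* SC cuts h1 ++ h2 between h1 and h2. *)
Definition junction h1 h2 : bool :=
  head 0 (outer h2) <= last (head 0 (outer h2)) (inner h1).

Definition shift c h : seq (nat * seq A) := [seq (r.1 + c, r.2) | r <- h].

(* For h of shape λ/μ: the restrictions of h to eta/μ and to λ/eta. *)
Definition lo h eta : seq (nat * seq A) :=
  [seq (x.1.1, take (x.2 - x.1.1) x.1.2) | x <- zip h eta].
Definition up h eta : seq (nat * seq A) :=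
  [seq (x.2, drop (x.2 - x.1.1) x.1.2) | x <- zip h eta].

Definition cuts h : seq (seq nat) := btw (inner h) (outer h).

Lemma geq_trans : transitive geq.
Proof. by move=> y x z /= le_yx le_zy; apply: leq_trans le_yx. Qed.

Lemma inner_cat h1 h2 : inner (h1 ++ h2) = inner h1 ++ inner h2.
Proof. exact: map_cat. Qed.

Lemma outer_cat h1 h2 : outer (h1 ++ h2) = outer h1 ++ outer h2.
Proof. exact: map_cat. Qed.

Lemma outer_shift c h : outer (shift c h) = [seq x + c | x <- outer h].
Proof. by rewrite /outer /shift -!map_comp; apply: eq_map => r /=; lia. Qed.

Lemma inner_shift c h : inner (shift c h) = [seq x + c | x <- inner h].
Proof. by rewrite /inner /shift -!map_comp. Qed.

Lemma size_inner h : size (inner h) = size h.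
Proof. exact: size_map. Qed.

Lemma size_outer h : size (outer h) = size h.
Proof. exact: size_map. Qed.

Lemma all2_inner_outer h : all2 leq (inner h) (outer h).
Proof. by elim: h => //= r h ->; rewrite leq_addr. Qed.

Lemma nboxes_cat h1 h2 : nboxes (h1 ++ h2) = nboxes h1 + nboxes h2.
Proof. by rewrite /nboxes map_cat sumn_cat. Qed.

Lemma entries_cat h1 h2 : entries (h1 ++ h2) = entries h1 ++ entries h2.
Proof. by rewrite /entries map_cat flatten_cat. Qed.

Lemma size_entries h : size (entries h) = nboxes h.
Proof. by elim: h => //= r h IHh; rewrite size_cat IHh. Qed.

Lemma nboxes_eq0 h : (nboxes h == 0) = (inner h == outer h).
Proof.
by elim: h => //= r h IHh; rewrite /nboxes /= addn_eq0 -/(nboxes h) IHh eqseq_cons; lia.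
Qed.

Lemma is_pre_cons r h :
  is_pre (r :: h) = [&& head 0 (inner h) <= r.1, head 0 (outer h) <= r.1 + size r.2 & is_pre h].
Proof.
by rewrite /is_pre ![sorted _ (_ (r :: h))]sorted_geq_cons -!andbA; congr (_ && _); rewrite andbCA.
Qed.

Lemma is_pre_cat h1 h2 : is_pre (h1 ++ h2) -> is_pre h1 /\ is_pre h2.
Proof.
rewrite /is_pre inner_cat outer_cat => /andP[s s']; split; apply/andP; split.
- by apply: subseq_sorted (prefix_subseq _ _) s; exact: geq_trans.
- by apply: subseq_sorted (prefix_subseq _ _) s'; exact: geq_trans.
- by apply: subseq_sorted (suffix_subseq _ _) s; exact: geq_trans.
by apply: subseq_sorted (suffix_subseq _ _) s'; exact: geq_trans.
Qed.

Lemma is_pre_tableau (w : tableau A) : is_pre w.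
Proof. by case/and3P: (valP w) => s s' _; rewrite /is_pre s. Qed.

Lemma tableau_is_pre h : is_tableau h -> is_pre h.
Proof. by case/and3P=> s s' _; rewrite /is_pre s. Qed.

Section LowerUpper.
Variables (h : seq (nat * seq A)) (eta : seq nat).
Hypotheses (le1 : all2 leq (inner h) eta) (le2 : all2 leq eta (outer h)).

Lemma inner_outer_lo_up : [/\ inner (lo h eta) = inner h, outer (lo h eta) = eta,
  inner (up h eta) = eta & outer (up h eta) = outer h].
Proof.
elim: h eta le1 le2 => [|r h' IHh] [|x e] //= /andP[le_rx le] /andP[le_xr le'].
have := IHh e le le'; rewrite /lo /up /inner /outer => -[-> -> -> ->].
rewrite size_take size_drop; split=> //; congr (_ :: _); last lia.
by case: ifP; lia.
Qed.

Lemma inner_lo : inner (lo h eta) = inner h. Proof. by case: inner_outer_lo_up. Qed.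
Lemma outer_lo : outer (lo h eta) = eta. Proof. by case: inner_outer_lo_up. Qed.
Lemma inner_up : inner (up h eta) = eta. Proof. by case: inner_outer_lo_up. Qed.
Lemma outer_up : outer (up h eta) = outer h. Proof. by case: inner_outer_lo_up. Qed.

Lemma is_pre_lo : is_pre h -> sorted geq eta -> is_pre (lo h eta).
Proof. by rewrite /is_pre inner_lo outer_lo => /andP[-> _] ->. Qed.

Lemma is_pre_up : is_pre h -> sorted geq eta -> is_pre (up h eta).
Proof. by rewrite /is_pre inner_up outer_up => /andP[_ ->] ->. Qed.

Lemma nboxes_lo_up : nboxes (lo h eta) + nboxes (up h eta) = nboxes h.
Proof.
elim: h eta le1 le2 => [|r h' IHh] [|x e] //= /andP[le_rx le] /andP[le_xr le'].
rewrite /nboxes /= -/(nboxes (lo h' e)) -/(nboxes (up h' e)) -/(nboxes h').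
rewrite -(IHh e) // size_take size_drop; case: ifP; lia.
Qed.

End LowerUpper.

Lemma lo_lo h eta e : all2 leq e eta -> lo (lo h eta) e = lo h e.
Proof.
elim: h eta e => [|r h IHh] [|x eta] [|y e] //= /andP[le_yx le].
have := IHh _ _ le; rewrite /lo /= => ->; congr ((_, _) :: _).
by apply: take_takel; lia.
Qed.

Lemma up_up h eta e : all2 leq (inner h) eta -> all2 leq eta e -> up (up h eta) e = up h e.
Proof.
elim: h eta e => [|r h IHh] [|x eta] [|y e] //= /andP[le_rx le1] /andP[le_xy le2].
have := IHh _ _ le1 le2; rewrite /up /= => ->; rewrite drop_drop.
congr ((_, drop _ _) :: _); lia.
Qed.

(** Two descriptions of the part of [h] between [e] and [eta], the middle factor of a double cut. *)
Lemma up_lo h eta e : all2 leq (inner h) e -> all2 leq e eta ->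
  up (lo h eta) e = lo (up h e) eta.
Proof.
elim: h eta e => [|r h IHh] [|x eta] [|y e] //= /andP[le_ry le1] /andP[le_yx le2].
have := IHh _ _ le1 le2; rewrite /up /lo /= => ->; rewrite take_drop.
by congr ((_, drop _ (take _ _)) :: _); lia.
Qed.

Lemma up_self h : up h (inner h) = h.
Proof.
elim: h => //= -[m s] h; rewrite /up /= => IHh.
by rewrite IHh subnn drop0.
Qed.

Lemma lo_self h : lo h (outer h) = h.
Proof.
elim: h => //= -[m s] h; rewrite /lo /= => IHh.
by rewrite IHh take_oversize // addnC addnK.
Qed.

Lemma lo_cat h1 h2 e1 e2 : size e1 = size h1 ->
  lo (h1 ++ h2) (e1 ++ e2) = lo h1 e1 ++ lo h2 e2.
Proof. by move=> sz; rewrite /lo zip_cat // map_cat. Qed.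

Lemma up_cat h1 h2 e1 e2 : size e1 = size h1 ->
  up (h1 ++ h2) (e1 ++ e2) = up h1 e1 ++ up h2 e2.
Proof. by move=> sz; rewrite /up zip_cat // map_cat. Qed.

Lemma mem_cuts h eta :
  (eta \in cuts h) = [&& sorted geq eta, all2 leq (inner h) eta & all2 leq eta (outer h)].
Proof. by rewrite mem_btw // size_inner size_outer. Qed.

Lemma size_cuts h eta : eta \in cuts h -> size eta = size h.
Proof. by rewrite mem_cuts => /and3P[_ /all2_leq_size <- _]; exact: size_inner. Qed.

Lemma inner_cuts h : is_pre h -> inner h \in cuts h.
Proof. by case/andP=> s _; rewrite mem_cuts s all2_leq_refl all2_inner_outer. Qed.

Lemma outer_cuts h : is_pre h -> outer h \in cuts h.
Proof. by case/andP=> _ s; rewrite mem_cuts s all2_leq_refl all2_inner_outer. Qed.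

Lemma nboxes_lo0 h eta : eta \in cuts h -> (nboxes (lo h eta) == 0) = (eta == inner h).
Proof.
rewrite mem_cuts => /and3P[_ le1 le2].
by rewrite nboxes_eq0 (inner_lo le1 le2) (outer_lo le1 le2) eq_sym.
Qed.

Lemma nboxes_up0 h eta : eta \in cuts h -> (nboxes (up h eta) == 0) = (eta == outer h).
Proof.
rewrite mem_cuts => /and3P[_ le1 le2].
by rewrite nboxes_eq0 (inner_up le1 le2) (outer_up le1 le2).
Qed.

(** Makes the number of boxes a decreasing measure for the recursion on first strips. *)
Lemma up_cuts_lt h eta : eta \in cuts h -> eta != inner h -> nboxes (up h eta) < nboxes h.
Proof.
move=> eta_h; rewrite -(nboxes_lo0 eta_h); move: eta_h.
by rewrite mem_cuts => /and3P[_ le1 le2]; have := nboxes_lo_up le1 le2; lia.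
Qed.

Lemma cuts_lo h eta : eta \in cuts h -> cuts (lo h eta) = btw (inner h) eta.
Proof.
by rewrite mem_cuts /cuts => /and3P[_ le1 le2]; rewrite (inner_lo le1 le2) (outer_lo le1 le2).
Qed.

Lemma cuts_up h eta : eta \in cuts h -> cuts (up h eta) = btw eta (outer h).
Proof.
by rewrite mem_cuts /cuts => /and3P[_ le1 le2]; rewrite (inner_up le1 le2) (outer_up le1 le2).
Qed.

Lemma cuts_pre h eta : is_pre h -> eta \in cuts h -> is_pre (lo h eta) /\ is_pre (up h eta).
Proof.
move=> ph; rewrite mem_cuts => /and3P[s le1 le2].
by rewrite (is_pre_lo le1 le2) // (is_pre_up le1 le2).
Qed.

Lemma sum_cuts_cat (V : nmodType) h1 h2 (F : seq nat -> V) : junction h1 h2 ->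
  (\sum_(e <- cuts (h1 ++ h2)) F e =
   \sum_(e1 <- cuts h1) \sum_(e2 <- cuts h2) F (e1 ++ e2))%R.
Proof.
by move=> j; rewrite /cuts inner_cat outer_cat sum_btw_cat // ?size_inner ?size_outer.
Qed.

Lemma sum_cuts_shift (V : nmodType) c h (F : seq nat -> V) :
  (\sum_(e <- cuts (shift c h)) F e = \sum_(e <- cuts h) F [seq (x + c)%N | x <- e])%R.
Proof. by rewrite /cuts inner_shift outer_shift sum_btw_shift. Qed.

Lemma head_all2_leq e e' : all2 leq e e' -> head 0 e <= head 0 e'.
Proof. by case: e e' => [|x e] [|x' e'] //= /andP[]. Qed.

Lemma last_all2_leq x y e e' : x <= y -> all2 leq e e' -> last x e <= last y e'.
Proof.
elim: e e' x y => [|z e IHe] [|z' e'] //= x y le /andP[le_z le_e]; exact: IHe.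
Qed.

Lemma junction_leq h1 h2 e1 e2 :
    junction h1 h2 -> all2 leq (inner h1) e1 -> all2 leq e2 (outer h2) ->
  head 0 e2 <= last (head 0 e2) e1.
Proof.
rewrite /junction => j le1 /head_all2_leq le2.
case: h1 e1 j le1 => [|r h1] [|x1 e1] //= j /andP[le_x le1].
by apply: leq_trans (last_all2_leq le_x le1); apply: leq_trans le2 j.
Qed.

(** Restriction can only raise the inner shape of the upper piece and lower the outer shape of the
    lower one, so a place where SC cuts remains one. *)
Lemma junction_cuts h1 h2 h1' h2' :
    junction h1 h2 -> all2 leq (inner h1) (inner h1') -> all2 leq (outer h2') (outer h2) ->
  junction h1' h2'.
Proof. exact: junction_leq. Qed.

Lemma cuts_cat h1 h2 e1 e2 : junction h1 h2 -> e1 \in cuts h1 -> e2 \in cuts h2 ->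
  e1 ++ e2 \in cuts (h1 ++ h2).
Proof.
rewrite !mem_cuts inner_cat outer_cat => j /and3P[s1 le1 le1'] /and3P[s2 le2 le2'].
have all2_cat (s s' t t' : seq nat) :
    all2 leq s t -> all2 leq s' t' -> all2 leq (s ++ s') (t ++ t').
  by elim: s t => [|x s IHs] [|y t] //= /andP[-> le] le'; exact: IHs.
by rewrite !all2_cat // !andbT sorted_geq_cat // (junction_leq j).
Qed.

Lemma cut_cons r h : cut (r :: h) =
  if head 0 (outer h) <= r.1 then [:: r] :: cut h
  else if cut h is p :: ps then (r :: p) :: ps else [:: [:: r]].
Proof. by []. Qed.

Lemma cut_cat h1 h2 : junction h1 h2 -> cut (h1 ++ h2) = cut h1 ++ cut h2.
Proof.
rewrite /junction; elim: h1 => // r h1 IHh.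
case: h1 IHh => [|r' h1] IHh junct.
  by rewrite /= in junct; rewrite cat_cons !cut_cons /= junct.
rewrite cat_cons cut_cons IHh // (cut_cons r (_ :: _)) cat_cons.
rewrite -[head 0 (outer (r' :: (h1 ++ h2)))]/(head 0 (outer (r' :: h1))).
case: ifP => _ //; case E : (cut (r' :: h1)) => [|p ps] //.
by have := flatten_cut (r' :: h1); rewrite E.
Qed.

Lemma cut_shift c h : cut (shift c h) = [seq shift c p | p <- cut h].
Proof.
elim: h => //= r h IHh.
have -> : (head 0 (outer (shift c h)) <= r.1 + c) = (head 0 (outer h) <= r.1).
  by case: h {IHh} => //= r' h; lia.
case: ifP => _ /=; rewrite IHh //.
by case: (cut h).
Qed.

Lemma lo_shift c h e : lo (shift c h) [seq x + c | x <- e] = shift c (lo h e).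
Proof.
by elim: h e => [|r h IHh] [|x e] //; have := IHh e; rewrite /lo /= => ->; rewrite subnDr.
Qed.

Lemma up_shift c h e : up (shift c h) [seq x + c | x <- e] = shift c (up h e).
Proof.
by elim: h e => [|r h IHh] [|x e] //; have := IHh e; rewrite /up /= => ->; rewrite subnDr.
Qed.

Lemma is_pre_shift c h : is_pre (shift c h) = is_pre h.
Proof.
rewrite /is_pre inner_shift outer_shift.
have mono s : sorted geq [seq x + c | x <- s] = sorted geq s.
  by apply: mono_sorted => x y /=; rewrite leq_add2r.
by rewrite !mono.
Qed.

Lemma nboxes_shift c h : nboxes (shift c h) = nboxes h.
Proof. by rewrite /nboxes -map_comp. Qed.

Lemma entries_shift c h : entries (shift c h) = entries h.
Proof. by rewrite /entries -map_comp. Qed.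

Lemma cut_first h p ps : cut h = p :: ps ->
  [/\ p != [::], h = p ++ flatten ps, cut (flatten ps) = ps & junction p (flatten ps)].
Proof.
elim: h p ps => //= r h IHh p ps; case: ifP => [le [<- <-]|gt].
  by rewrite flatten_cut.
case E : (cut h) => [|p' ps'] [<- <-].
  by rewrite -(flatten_cut h) E.
have [p'0 -> cutE j] := IHh _ _ E; split=> //.
by case: p' p'0 j {E}.
Qed.

(** The outer ends decrease, so the rows that [trim] removes form a block at the bottom; an outer
    end 0 forces each of them to be [(0, [::])]. *)
Lemma is_pre_trim h : is_pre h -> exists n, h = trim h ++ nseq n (0, [::]).
Proof.
elim: h => [_|[m s] h IHh]; first by exists 0.
rewrite is_pre_cons /= => /and3P[_ le_out ph]; case: ifP => [_|/negbFE/eqP ms0].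
  by have [n {1}->] := IHh ph; exists n.
have [-> /size0nil->] : m = 0 /\ size s = 0 by lia.
have {IHh} h0 : forall r, r \in h -> r = (0, [::]).
  have : all (fun x => x == 0) (outer h).
    case/andP: ph => _ so; rewrite ms0 in le_out.
    case: (outer h) so le_out => //= x o; rewrite leqn0 => so /eqP x0.
    move: so; rewrite x0 => /(order_path_min geq_trans) o0; rewrite eqxx /=.
    by apply: sub_all o0 => y; rewrite -leqn0.
  move=> /allP h0 [m' s'] /(map_f (fun r => r.1 + size r.2)) /h0 /=.
  by rewrite addn_eq0 => /andP[/eqP-> /nilP->].
exists (size h).+1; have -> : trim h = [::].
  by apply/eqP; rewrite -[_ == _]negbK -has_filter; apply/hasPn => r /h0->.
by congr (_ :: _); apply/all_pred1P/allP => r /h0->; rewrite /= eqxx.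
Qed.

(** The offset [c] of the last row is the smallest one, so subtracting it from every row truncates
    nothing and can be undone by a shift. *)
Lemma pre_translate h p : is_pre h -> p \in cut h ->
  is_pre p /\ exists c q, [/\ is_pre q, p = shift c q & translate_rows p = trim q].
Proof.
case/andP=> s_in s_out /subseq_cut p_h.
have {s_in} s_in : sorted geq (inner p).
  by apply: subseq_sorted s_in; [exact: geq_trans | exact: map_subseq].
have {s_out} s_out : sorted geq (outer p).
  by apply: subseq_sorted s_out; [exact: geq_trans | exact: map_subseq].
have pp : is_pre p by rewrite /is_pre s_in.
split=> //; set c := (last (0, [::]) p).1.
have le_c r : r \in p -> c <= r.1.
  rewrite /c; case: p s_in {p_h s_out c pp} => // r0 p /=.
  elim: p r0 r => [|r1 p IHp] r0 r /=; first by rewrite inE => _ /eqP->.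
  case/andP=> le10 s_p; rewrite inE => /predU1P[->|]; last exact: IHp.
  by apply: leq_trans le10; apply: IHp (mem_head _ _).
have pE : p = shift c [seq (r.1 - c, r.2) | r <- p].
  rewrite /shift -map_comp -[LHS]map_id; apply/eq_in_map => -[m s] /le_c /= le.
  by rewrite subnK.
exists c, [seq (r.1 - c, r.2) | r <- p]; split=> //.
by rewrite -(is_pre_shift c) -pE.
Qed.

Lemma translate_rows_shift c p : translate_rows (shift c p) = translate_rows p.
Proof.
case: p => // r p; rewrite /translate_rows.
have -> : (last (0, [::]) (shift c (r :: p))).1 = (last (0, [::]) (r :: p)).1 + c.
  by rewrite /= last_map.
rewrite /shift -map_comp; congr trim; apply: eq_map => x /=.
by rewrite subnDr.
Qed.

Lemma restrict_rowsE h eta eta' : size eta = size h -> size eta' = size h ->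
  restrict_rows h eta eta' = trim (up (lo h eta') eta).
Proof.
move=> sz sz'; congr trim.
apply: (@eq_from_nth _ (0, [::])).
  by rewrite size_mkseq !(size_map, size_zip) sz sz' !minnn.
rewrite size_mkseq => i lt_i; rewrite nth_mkseq //.
rewrite /up /lo (nth_map ((0, [::]), 0)) ?nth_zip ?(size_map, size_zip) ?sz ?sz' ?minnn //.
by rewrite (nth_map ((0, [::]), 0)) ?nth_zip ?(size_map, size_zip) ?sz ?sz' ?minnn.
Qed.

Lemma entries_trim h : entries (trim h) = entries h.
Proof.
elim: h => //= -[m s] h IHh; case: ifP => /= [_|/eqP e0]; rewrite /entries /= -/(entries _) IHh //.
by have /size0nil-> : size s = 0 by lia.
Qed.

Lemma nboxes_trim h : nboxes (trim h) = nboxes h.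
Proof. by rewrite -!size_entries entries_trim. Qed.

End Rows.

(** * Maps out of the algebra of tableaux *)

Lemma quotmod_lift (k : comNzRingType) (V W : lmodType k) (S : V -> Prop)
    (f : {linear V -> W}) : (forall s, S s -> f s = 0) ->
  exists g : {linear quotmod S -> W}, forall v, g (qpi S v) = f v.
Proof.
move=> fS; pose g (x : quotmod S) := f (qrepr x).
have gE v : g (qpi S v) = f v.
  apply/eqP; rewrite -subr_eq0 /g -linearB; apply/eqP.
  have : Defs.span S (qrepr (qpi S v) - v) by apply/eq_qpi; rewrite qreprK.
  move/(_ (fun x => f x = 0)); apply; last exact: fS.
  by split=> [|c x y fx fy]; rewrite ?linear0 // linearP fx fy scaler0 addr0.
have gL : linear g.
  by move=> c x y; rewrite -[x]qreprK -[y]qreprK -linearP !gE linearP.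
by exists (pack_linear gL).
Qed.

Lemma malgUM (k : comNzRingType) (K : monomType) (m m' : K) :
  << m >> * << m' >> = << mmul m m' >> :> {malg k[K]}.
Proof. by rewrite malgM_def fgmulUU mulr1. Qed.

Section ComAlg.
Variables (k : comNzRingType) (B : lmodType k) (mul : {bilinear B -> B -> B}) (one : B).

(** A copy of [B] indexed by the laws of [mul], so that it can carry the ring structure with product
    [mul] in which monomials are evaluated. *)
Definition comalg of associative mul & commutative mul & left_id one mul : Type := B.

Variables (mA : associative mul) (mC : commutative mul) (m1 : left_id one mul).
Local Notation R := (comalg mA mC m1).
HB.instance Definition _ := GRing.Lmodule.copy R B.

Fact comalg_mulDl : left_distributive (mul : R -> R -> R) +%R.
Proof. by move=> x y z; apply: linearDl. Qed.
HB.instance Definition _ := GRing.Zmodule_isComPzRing.Build R mA mC m1 comalg_mulDl.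

Variables (I : choiceType) (f : I -> B).

Definition ev_monom (m : {cmonom I}) : R := \prod_(i <- finsupp m) (f i : R) ^+ m i.

Lemma ev_monomEw (m : {cmonom I}) (D : {fset I}) : (finsupp m `<=` D)%fset ->
  ev_monom m = \prod_(i <- D) (f i : R) ^+ m i.
Proof.
move=> le; rewrite /ev_monom (big_fset_incl _ le) // => i _ im.
by have /eqP-> : m i == 0%N by rewrite cmE_eq0.
Qed.

Lemma ev_monomM m m' : ev_monom (mmul m m') = ev_monom m * ev_monom m'.
Proof.
pose D := finsupp (mmul m m').
have D1 : (finsupp m `<=` D)%fset by rewrite /D mdomD fsubsetUl.
have D2 : (finsupp m' `<=` D)%fset by rewrite /D mdomD fsubsetUr.
rewrite (ev_monomEw D1) (ev_monomEw D2) -big_split; apply: eq_bigr => i _.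
by rewrite cmM exprD.
Qed.

Lemma ev_monom1 : ev_monom mone = 1.
Proof. by rewrite /ev_monom mdom1 big_seq_fset0. Qed.

Lemma ev_monomU i : ev_monom (ucm i) = f i.
Proof. by rewrite /ev_monom mdomU big_seq_fset1 cmUU expr1. Qed.

Lemma morph_submodulel (S : comAlgType k) (F : {linear S -> B}) q :
  submodule (fun p => F (p * q) = mul (F p) (F q)).
Proof.
split=> [|c x y Ex Ey]; first by rewrite mul0r linear0 linear0l.
by rewrite mulrDl -scalerAl (linearL F c (x * q)) (linearL F c x) (bilinearB mul).1 Ex Ey.
Qed.

Lemma morph_submoduler (S : comAlgType k) (F : {linear S -> B}) p :
  submodule (fun q => F (p * q) = mul (F p) (F q)).
Proof.
split=> [|c x y Ex Ey]; first by rewrite mulr0 linear0 linear0r.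
by rewrite mulrDr -scalerAr (linearL F c (p * x)) (linearL F c x) (bilinearB mul).2 Ex Ey.
Qed.

(** The universal property of the polynomial algebra, with the target product as a parameter: it is
    applied to the product of a tensor square and to the quasi-shuffle, while words already carry
    concatenation as their ring product. *)
Lemma comalg_lift : exists F : {linear {malg k[{cmonom I}]} -> B},
  [/\ forall p q, F (p * q) = mul (F p) (F q), F 1 = one &
      forall i, F << ucm i >> = f i].
Proof.
have [F FE] : exists F : {linear {malg k[{cmonom I}]} -> B}, forall m, F << m >> = ev_monom m.
  by exists (@lext k _ B ev_monom) => m; exact: (@lextU k _ B ev_monom m).
exists F; split=> /=; last first.
- by move=> i; rewrite FE ev_monomU.
- by rewrite FE ev_monom1.
move=> p q; move: p; apply: malg_submodule_ind => [|m]; first exact: morph_submodulel.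
move: q; apply: malg_submodule_ind => [|m']; first exact: morph_submoduler.
rewrite malgUM; apply: etrans (FE _) _; rewrite ev_monomM.
by congr (mul _ _); apply: esym; apply: FE.
Qed.

End ComAlg.

Lemma cmonom_ind (I : choiceType) (P : {cmonom I} -> Prop) :
  P mone -> (forall i m, P m -> P (mmul (ucm i) m)) -> forall m, P m.
Proof.
move=> P1 PM m; have [n] := ubnP (mdeg m); elim: n m => // n IHn m lt_mn.
have [->|] := eqVneq m mone; first exact: P1.
rewrite -mdeg_eq0 => m_n0.
have [i i_m] : exists i, i \in finsupp m.
  apply/fset0Pn; apply: contra m_n0 => /eqP m0.
  by rewrite mdegE m0 big_seq_fset0.
have mE : m = mmul (ucm i) (divcm m (ucm i)).
  apply/eqP/cmP => j; rewrite cmM divcmE cmU.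
  by case: eqP => [<-|_] /=; rewrite ?add0n ?subn0 // subnKC // lt0n cmE_neq0.
rewrite mE; apply/PM/IHn; rewrite mE mdegM mdegU in lt_mn; lia.
Qed.

Section CutMult.
Variables (A : choiceType) (B : Type) (mul : B -> B -> B) (one : B).
Implicit Types h : seq (nat * seq A).

(* The functions on tableaux compatible with the relations of ytab. *)
Record cut_mult (Phi : seq (nat * seq A) -> B) : Prop := {
  cm_nil : Phi [::] = one;
  cm_cat : forall h1 h2, is_pre (h1 ++ h2) -> junction h1 h2 ->
    Phi (h1 ++ h2) = mul (Phi h1) (Phi h2);
  cm_shift : forall c h, is_pre h -> Phi (shift c h) = Phi h;
  cm_zero : Phi [:: (0%N, [::])] = one
}.

Hypothesis m1r : right_id one mul.
Variable Phi : seq (nat * seq A) -> B.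
Hypothesis PhiM : cut_mult Phi.

(** The rows [(0, [::])] at the bottom are cut off one at a time, each contributing a factor
    [one]. *)
Lemma cut_mult_trim h : is_pre h -> Phi (trim h) = Phi h.
Proof.
move=> ph; have [n hE] := is_pre_trim ph.
rewrite [in RHS]hE (cm_cat PhiM); last first.
- by rewrite /junction; case: n {hE}.
- by rewrite -hE.
suff -> : Phi (nseq n (0%N, [::])) = one by rewrite m1r.
elim: n {hE} => [|n IHn]; first exact: cm_nil.
rewrite -[nseq _ _]/([:: (0%N, [::])] ++ nseq n (0%N, [::])) (cm_cat PhiM).
- by rewrite IHn m1r (cm_zero PhiM).
- by rewrite /is_pre; apply/andP; split; elim: n {IHn} => //= -[|n].
by case: n {IHn}.
Qed.

Lemma cut_mult_translate h p : is_pre h -> p \in cut h -> Phi (translate p) = Phi p.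
Proof.
move=> ph p_h; have [pp [c [q [pq pE tE]]]] := pre_translate ph p_h.
rewrite {2}pE (cm_shift PhiM) // -(cut_mult_trim pq) -tE /translate val_insubd tE.
by case/andP: pq => s s'; rewrite trim_tableau.
Qed.

(** This is the defining relation of [ytab] read through [Phi]: the value at [h] is the product of
    the values at the members of SC. *)
Lemma cut_mult_foldr h : is_pre h ->
  Phi h = foldr mul one [seq Phi (translate p) | p <- cut h].
Proof.
move=> ph.
have -> : [seq Phi (translate p) | p <- cut h] = [seq Phi p | p <- cut h].
  by apply/eq_in_map => p p_h; exact: cut_mult_translate ph p_h.
move hE : (cut h) => ps; elim: ps h hE ph => [|p ps IHps] h hE ph.
  have -> : h = [::] by rewrite -(flatten_cut h) hE.
  exact: cm_nil.
have [_ hE' psE j] := cut_first hE.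
rewrite hE' in ph *; have [_ ph'] := is_pre_cat ph.
by rewrite (cm_cat PhiM) //= (IHps _ psE ph').
Qed.

End CutMult.

Section YtabLift.
Variables (k : comNzRingType) (A : choiceType).
Implicit Types (h : seq (nat * seq A)) (w : tableau A).
Local Notation Y := (ytab k A).

(* The class of a padded tableau. *)
Definition rtab h : Y := \prod_(p <- cut h) tab k (translate p).

Lemma qpi_prod (I : Type) (r : seq I) (F : I -> tabpoly k A) :
  qpi (ideal_rel (@ytab_rel k A)) (\prod_(i <- r) F i) =
  \prod_(i <- r) (qpi (ideal_rel (@ytab_rel k A)) (F i) : Y).
Proof.
elim: r => [|i r IHr]; first by rewrite !big_nil.
by rewrite !big_cons -IHr; exact: esym (qmulE _ _ _).
Qed.

Lemma rtab_tableau w : rtab w = tab k w.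
Proof.
rewrite /rtab -(big_map _ xpredT (fun i => tab k i)) -/(SC w) -qpi_prod.
apply/esym/eq_qpi; apply: span_gen.
by have := IdealRel 1 (YtabRel k w); rewrite mul1r.
Qed.

Lemma tab_empty : tab k (empty_tableau A) = 1.
Proof. by rewrite -rtab_tableau /rtab big_nil. Qed.

Lemma rtab_cut_mult : cut_mult *%R 1 rtab.
Proof.
split=> [|h1 h2 _ j|c h _|]; first by rewrite /rtab big_nil.
- by rewrite /rtab cut_cat // big_cat.
- rewrite /rtab cut_shift big_map; apply: eq_bigr => p _; congr tab.
  by rewrite /translate translate_rows_shift.
rewrite /rtab /= big_seq1 -tab_empty; congr tab; apply: val_inj.
by rewrite /translate val_insubd /=.
Qed.

Lemma ytab_lift (B : lmodType k) (mul : B -> B -> B) (one : B)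
    (Phi : seq (nat * seq A) -> B) :
    bil mul -> associative mul -> commutative mul -> left_id one mul -> cut_mult mul one Phi ->
  exists F : {linear Y -> B}, [/\ forall h, is_pre h -> F (rtab h) = Phi h, F 1 = one &
    forall x y, F (x * y) = mul (F x) (F y)].
Proof.
move=> mB mA mC m1l PhiM; have m1r : right_id one mul by move=> x; rewrite mC.
have [F0 [F0M F01 F0U]] :=
  @comalg_lift k B (pack_bilinear mB) one mA mC m1l _ (fun w : tableau A => Phi w).
rewrite /= in F0M.
have F0_cut h : is_pre h -> F0 (\prod_(p <- cut h) gen k (translate p)) = Phi h.
  move=> ph; rewrite (cut_mult_foldr m1r PhiM ph).
  elim: (cut h) => [|p s IHs]; first by rewrite big_nil.
  by rewrite big_cons F0M /= IHs F0U.
have F0rel g : ideal_rel (@ytab_rel k A) g -> F0 g = 0.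
  case=> q _ [h]; rewrite F0M linearB /= F0U /SC big_map (F0_cut _ (is_pre_tableau h)) subrr.
  exact: lin0 (mB.2 _).
have [F FE] : exists F : {linear Y -> B}, forall q, F (qpi _ q) = F0 q.
  exact: quotmod_lift F0rel.
have FM (x y : Y) : F (x * y) = mul (F x) (F y).
  by rewrite -[x]qreprK -[y]qreprK [_ * _]qmulE !FE F0M.
have F1 : F 1 = one by rewrite -F01 -FE.
exists F; split=> // h ph; by rewrite -(F0_cut h ph) -FE qpi_prod.
Qed.

(** With [w1] placed above [w2] and shifted right by the outer end of the first row of [w2], SC cuts
    between the two. A product of tableaux is thus the class of one tableau, so tableaux span the
    algebra as a module. *)
Lemma tabM w1 w2 : exists2 w : tableau A,
  tab k w = tab k w1 * tab k w2 & nboxes w = (nboxes w1 + nboxes w2)%N.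
Proof.
pose c := head 0%N (outer w2); pose h := shift c w1 ++ w2.
have pre_w1 : is_pre (shift c w1) by rewrite is_pre_shift is_pre_tableau.
have c_le : (c <= last c [seq (x + c)%N | x <- inner w1])%N.
  by case: (inner w1) => //= y s; rewrite (last_map (fun x => (x + c)%N)) leq_addl.
have j : junction (shift c w1) w2 by rewrite /junction inner_shift c_le.
have h_tab : is_tableau h.
  have /and3P[i1 o1 n1] := valP w1; have /and3P[i2 o2 n2] := valP w2.
  apply/and3P; rewrite !inner_cat !outer_cat inner_shift outer_shift; split.
  - apply: sorted_geq_cat i2 _; first by apply: homo_sorted i1 => x y /=; lia.
    case: (inner w1) => //= x s; rewrite (last_map (fun x => (x + c)%N)).
    by apply: leq_trans (leq_addl _ _); exact: head_all2_leq (all2_inner_outer w2).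
  - apply: sorted_geq_cat o2 _; first by apply: homo_sorted o1 => x y /=; lia.
    by case: (outer w1) => //= x s; rewrite (last_map (fun x => (x + c)%N)) leq_addl.
  rewrite mem_cat (negPf n2) orbF; apply: contra n1 => /mapP[x x_in /esym/eqP].
  by rewrite addn_eq0 => /andP[/eqP<- _].
exists (Tableau h_tab); last by rewrite /= nboxes_cat nboxes_shift.
rewrite -(rtab_tableau w1) -(rtab_tableau w2) -(rtab_tableau (Tableau h_tab)).
apply: etrans (cm_cat rtab_cut_mult (tableau_is_pre h_tab) j) _.
by rewrite (cm_shift rtab_cut_mult _ (is_pre_tableau w1)).
Qed.

Lemma ytab_ind (P : Y -> Prop) : submodule P -> (forall w, P (tab k w)) -> forall y, P y.
Proof.
move=> sP Ptab y; rewrite -[y]qreprK; move: (qrepr y).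
have qL : linear (qpi (ideal_rel (@ytab_rel k A))) by move=> c u v; rewrite linearP.
apply: malg_submodule_ind; first exact: (lin_subset qL).
move=> m; suff [w ->] : exists w, qpi (ideal_rel (@ytab_rel k A)) << m >> = tab k w by [].
elim/cmonom_ind: m => [|i m [w IHw]].
  by exists (empty_tableau A); rewrite tab_empty.
have [w' wE _] := tabM i w; exists w'.
rewrite wE -IHw [RHS]qmulE /gen; congr (qpi _ _).
exact: esym (malgUM _ _ _).
Qed.

End YtabLift.

(** * The Hopf algebra of tableaux *)

Section Subparts.
Variables (A : choiceType) (w : tableau A).

Lemma size_parts (eta : subpart w) : size (parts eta) = size w.
Proof. by rewrite size_map size_tuple. Qed.

Lemma is_between_cuts (eta : subpart w) : is_between eta = (parts eta \in cuts w).
Proof.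
rewrite /is_between mem_cuts !part_le_all2 ?size_parts ?size_inner //.
by rewrite size_outer.
Qed.

Lemma subpartP e : e \in cuts w -> exists eta : subpart w, parts eta = e.
Proof.
rewrite mem_cuts => /and3P[s le1 le2].
have sz : size e == size w by rewrite (all2_leq_size le2) size_outer.
have e_lt : all (fun x => (x < (head 0%N (outer w)).+1)%N) e.
  apply/allP => x x_e; rewrite ltnS; apply: leq_trans (head_all2_leq le2).
  case: e s x_e {sz le1 le2} => // y e; rewrite /= inE => /(order_path_min geq_trans).
  by move=> /allP le_y /predU1P[->|/le_y].
pose f x : 'I_(head 0%N (outer w)).+1 := inord x.
have sz' : size (map f e) == size w by rewrite size_map.
exists (Tuple sz'); rewrite /parts /= -map_comp -[RHS]map_id.
by apply/eq_in_map => x /(allP e_lt) lt_x; rewrite /= inordK.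
Qed.

Lemma parts_inj : injective (@parts A w).
Proof. by move=> e e' /(inj_map val_inj) /val_inj. Qed.

(** Passes from the bounded tuples of the definitions to the recursive enumeration [btw]. *)
Lemma sum_subpart (V : nmodType) (P : pred (subpart w)) (Q : pred (seq nat))
    (F : seq nat -> V) :
    (forall eta, P eta = (parts eta \in cuts w) && Q (parts eta)) ->
  \sum_(eta : subpart w | P eta) F (parts eta) = \sum_(e <- cuts w | Q e) F e.
Proof.
move=> PQ; rewrite -big_filter -[RHS]big_filter -(big_map (@parts A w) xpredT F).
apply: perm_big; apply: uniq_perm.
- by rewrite (map_inj_uniq parts_inj) filter_uniq // index_enum_uniq.
- by rewrite filter_uniq // uniq_btw.
move=> e; rewrite mem_filter; apply/mapP/andP => [[eta + ->]|[Qe e_w]].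
  by rewrite mem_filter mem_index_enum PQ andbT => /andP[].
have [eta eE] := subpartP e_w; exists eta; rewrite // mem_filter mem_index_enum PQ.
by rewrite eE e_w Qe.
Qed.

End Subparts.

Section TableauxHopf.
Variables (k : comNzRingType) (A : choiceType).
Implicit Types (h : seq (nat * seq A)) (w : tableau A).
Local Notation Y := (ytab k A).
Local Notation rtab := (@rtab k A).

Lemma rtab_trim h : is_pre h ->
  exists w, [/\ val w = trim h, rtab h = tab k w & nboxes w = nboxes h].
Proof.
move=> ph; have th : is_tableau (trim h) by case/andP: ph; exact: trim_tableau.
exists (Tableau th); split=> //; last by rewrite /= nboxes_trim.
by rewrite -rtab_tableau /= (cut_mult_trim (@mulr1 Y) (rtab_cut_mult k A)).
Qed.

Lemma tab_restrict w e e' : sorted geq e -> sorted geq e' ->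
    all2 leq (inner w) e -> all2 leq e e' -> all2 leq e' (outer w) ->
  tab k (restrict w e e') = rtab (up (lo w e') e).
Proof.
move=> s s' le1 le2 le3; have sz1 := all2_leq_size le1; have sz2 := all2_leq_size le2.
have sz : size e = size w by rewrite -sz1 size_inner.
have sz' : size e' = size w by rewrite -sz2.
have le1' := all2_leq_trans le1 le2.
have ph : is_pre (up (lo w e') e).
  apply: is_pre_up => //.
  - by rewrite (inner_lo le1' le3).
  - by rewrite (outer_lo le1' le3).
  by apply: is_pre_lo => //; exact: is_pre_tableau.
have [w' [wE -> _]] := rtab_trim ph; congr tab; apply: val_inj.
rewrite wE val_restrict ?restrict_rowsE // part_le_all2 ?size_inner ?size_outer ?sz ?sz' //.
Qed.

Local Notation YY := (Y ⊗ Y)%type.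
Definition ytab_mul : {bilinear Y -> Y -> Y} := @qmul k (tabpoly k A) (@ytab_rel k A).

Definition rcut h : YY := \sum_(e <- cuts h) rtab (lo h e) ⊗ rtab (up h e).

Let mB := bilinearB ytab_mul.

(** A cut of [h1 ++ h2] is a pair of cuts, and the lower and upper parts both split again at the
    junction of [h1] and [h2], where [rtab] is multiplicative. *)
Lemma rcut_cut_mult : cut_mult (tmul ytab_mul) ((1 : Y) ⊗ (1 : Y)) rcut.
Proof.
have rM := rtab_cut_mult k A.
have tB := tmul_bil mB.
split=> [|h1 h2 ph j|c h ph|].
- by rewrite /rcut /cuts /= big_seq1 (cm_nil rM).
- rewrite /rcut sum_cuts_cat // (bil_suml tB); apply: eq_big_seq => e1 e1_h.
  rewrite (bil_sumr tB); apply: eq_big_seq => e2 e2_h; rewrite (tmulE mB).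
  have [ph1 ph2] := is_pre_cat ph.
  have e12_h : e1 ++ e2 \in cuts (h1 ++ h2).
    exact: cuts_cat.
  have [plo pup] := cuts_pre ph e12_h; have sz := size_cuts e1_h.
  move: e1_h e2_h; rewrite !mem_cuts => /and3P[s1 le1 le1'] /and3P[s2 le2 le2'].
  rewrite (lo_cat _ _ sz) in plo *; rewrite (up_cat _ _ sz) in pup *.
  have jlo : junction (lo h1 e1) (lo h2 e2).
    apply: (junction_cuts j); first by rewrite (inner_lo le1 le1') all2_leq_refl.
    by rewrite (outer_lo le2 le2').
  have jup : junction (up h1 e1) (up h2 e2).
    apply: (junction_cuts j); first by rewrite (inner_up le1 le1').
    by rewrite (outer_up le2 le2') all2_leq_refl.
  by rewrite (cm_cat rM plo jlo) (cm_cat rM pup jup).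
- apply: etrans (sum_cuts_shift c h _) _; apply: eq_big_seq => e e_h.
  have [plo pup] := cuts_pre ph e_h.
  by rewrite lo_shift up_shift (cm_shift rM c plo) (cm_shift rM c pup).
by rewrite /rcut /cuts /= big_seq1 /lo /up /= (cm_zero rM).
Qed.

Lemma ytab_mulE (x y : Y) : ytab_mul x y = x * y. Proof. by []. Qed.

Lemma ytab_mulA : associative ytab_mul. Proof. exact: (@mulrA Y). Qed.
Lemma ytab_mulC : commutative ytab_mul. Proof. exact: (@mulrC Y). Qed.
Lemma ytab_mul1l : left_id (1 : Y) ytab_mul. Proof. exact: (@mul1r Y). Qed.
Lemma ytab_mul1r : right_id (1 : Y) ytab_mul. Proof. exact: (@mulr1 Y). Qed.

Lemma ytab_comul : exists Delta : {linear Y -> YY},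
  [/\ forall h, is_pre h -> Delta (rtab h) = rcut h, Delta 1 = (1 : Y) ⊗ (1 : Y) &
      forall x y, Delta (ytab_mul x y) = tmul ytab_mul (Delta x) (Delta y)].
Proof.
have tA := tmulA mB ytab_mulA; have tC := tmulC mB ytab_mulC.
have t1 := tmul1l mB ytab_mul1l.
have [D [D1 D2 D3]] := ytab_lift (tmul_bil mB) tA tC t1 rcut_cut_mult.
have [D' D'E] := linear_to_tensor D.
exists D'; split=> [h ph||x y]; rewrite ?D'E.
- exact: D1.
- exact: D2.
exact: D3.
Qed.

Lemma rcut_tab w : rcut w = \sum_(eta : subpart w | is_between eta)
  tab k (restrict w (inner w) (parts eta)) ⊗ tab k (restrict w (parts eta) (outer w)).
Proof.
rewrite (eq_bigr (fun eta => rtab (lo w (parts eta)) ⊗ rtab (up w (parts eta)))).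
  have := @sum_subpart A w YY _ xpredT (fun e => rtab (lo w e) ⊗ rtab (up w e)).
  by move=> ->  // eta; rewrite is_between_cuts andbT.
move=> eta; rewrite is_between_cuts mem_cuts => /and3P[s le1 le2].
have /andP[si so] := is_pre_tableau w.
rewrite (tab_restrict si s (all2_leq_refl _) le1 le2).
rewrite (tab_restrict s so le1 le2 (all2_leq_refl _)).
have loE : up (lo w (parts eta)) (inner w) = lo w (parts eta).
  by rewrite -[X in up _ X = _](inner_lo le1 le2) up_self.
by rewrite lo_self loE.
Qed.

Lemma ytab_counit : exists eps : {scalar Y},
  [/\ forall h, is_pre h -> eps (rtab h) = (nboxes h == 0%N)%:R, eps 1 = 1 &
      forall x y, eps (ytab_mul x y) = eps x * eps y].
Proof.
have kB : bil (fun x y : k^o => x * y : k^o).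
  by split=> [y|x] c u v /=; rewrite ?mulrDl ?mulrDr -?scalerAl -?scalerAr.
pose Phi h : k^o := (nboxes h == 0%N)%:R.
have PhiM : cut_mult (fun x y : k^o => x * y : k^o) (1 : k^o) Phi.
  split=> // [h1 h2 _ _|c h _]; last by rewrite /Phi nboxes_shift.
  by rewrite /Phi nboxes_cat addn_eq0 -mulnb natrM.
have [F [F1 F2 F3]] := ytab_lift kB (@mulrA k) (@mulrC k) (@mul1r k) PhiM.
have FL : scalar (F : Y -> k) by move=> c x y; rewrite linearP.
pose eps : {scalar Y} := HB.pack (F : Y -> k) (GRing.isLinear.Build _ _ _ _ _ FL).
by exists eps; split.
Qed.

End TableauxHopf.

(** * Grading by the number of boxes *)

Section MonomialWeight.
Variables (I : choiceType) (wt : I -> nat).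
Implicit Types m : {cmonom I}.

Definition monom_wt m : nat := \sum_(i <- finsupp m) m i * wt i.

Lemma monom_wtEw m (D : {fset I}) : (finsupp m `<=` D)%fset ->
  monom_wt m = (\sum_(i <- D) m i * wt i)%N.
Proof.
move=> le; rewrite /monom_wt (big_fset_incl _ le) // => i _ im.
by have /eqP-> : m i == 0%N by rewrite cmE_eq0.
Qed.

Lemma monom_wtM m m' : monom_wt (mmul m m') = (monom_wt m + monom_wt m')%N.
Proof.
pose D := finsupp (mmul m m').
have D1 : (finsupp m `<=` D)%fset by rewrite /D mdomD fsubsetUl.
have D2 : (finsupp m' `<=` D)%fset by rewrite /D mdomD fsubsetUr.
rewrite (monom_wtEw D1) (monom_wtEw D2) -big_split; apply: eq_bigr => i _.
by rewrite cmM mulnDl.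
Qed.

Lemma monom_wt1 : monom_wt mone = 0%N.
Proof. by rewrite /monom_wt mdom1 big_seq_fset0. Qed.

Lemma monom_wtU i : monom_wt (ucm i) = wt i.
Proof. by rewrite /monom_wt mdomU big_seq_fset1 cmUU mul1n. Qed.

Lemma monom_wt_prod (s : seq I) :
  monom_wt (\big[mmul/mone]_(i <- s) ucm i) = (\sum_(i <- s) wt i)%N.
Proof.
elim: s => [|i s IHs]; first by rewrite !big_nil monom_wt1.
by rewrite !big_cons monom_wtM monom_wtU IHs.
Qed.

End MonomialWeight.

Lemma prod_ucm (k : comNzRingType) (I : choiceType) (s : seq I) :
  \prod_(i <- s) << ucm i >> = << \big[mmul/mone]_(i <- s) ucm i >> :> {malg k[{cmonom I}]}.
Proof.
elim: s => [|i s IHs]; first by rewrite !big_nil.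
rewrite big_cons [in RHS]big_cons IHs; exact: malgUM.
Qed.

Lemma lin_mul_submodule (k : comNzRingType) (R : comAlgType k) (V : lmodType k)
    (F : {linear R -> V}) g : submodule (fun q => F (q * g) = 0).
Proof.
split=> [|c x y Ex Ey]; first by rewrite mul0r linear0.
by rewrite mulrDl -scalerAl (linearL F c (x * g)) Ex Ey scaler0 addr0.
Qed.

Section Grading.
Variables (k : comNzRingType) (A : choiceType).
Implicit Types (h : seq (nat * seq A)) (w : tableau A).
Local Notation Y := (ytab k A).
Local Notation rel := (ideal_rel (@ytab_rel k A)).

Let wt w := nboxes w.

(** The number of boxes is itself a [cut_mult] function, with values in the additive monoid of
    naturals; hence the relations of [ytab] are homogeneous. *)
Lemma nboxes_SC w : (\sum_(i <- SC w) wt i)%N = wt w.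
Proof.
pose Phi h := nboxes h.
have PhiM : cut_mult addn 0%N Phi.
  by split=> // [h1 h2 _ _|c h _]; rewrite /Phi ?nboxes_cat ?nboxes_shift.
rewrite /wt -/(Phi w) (cut_mult_foldr addn0 PhiM (is_pre_tableau w)) foldrE !big_map.
by [].
Qed.

(** The relations are homogeneous for the weight that counts boxes, so the projection of polynomials
    onto weight [n] descends to the quotient. *)
Lemma ytab_proj n : exists F : {linear Y -> Y}, forall w,
  F (tab k w) = if nboxes w == n then tab k w else 0.
Proof.
pose f (m : {cmonom tableau A}) : Y := if monom_wt wt m == n then qpi rel << m >> else 0.
have f_eq a b : monom_wt wt a = monom_wt wt b ->
    qpi rel << a >> = qpi rel << b >> -> f a = f b.
  by move=> ea eb; rewrite /f ea; case: (_ == n); [exact: eb | reflexivity].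
have [F0 F0E] : exists F : {linear tabpoly k A -> Y}, forall m, F << m >> = f m.
  by exists (@lext k _ Y f) => m; exact: (@lextU k _ Y f m).
have F0rel g : rel g -> F0 g = 0.
  case=> q _ [w]; move: q; apply: malg_submodule_ind => [|m].
    exact: lin_mul_submodule.
  (* With [q] a monomial, the relation is a difference of two monomials of equal weight and equal
     class, which [f] cannot distinguish. *)
  pose m' := \big[mmul/mone]_(i <- SC w) ucm i.
  have gE : << m >> * (gen k w - \prod_(i <- SC w) gen k i) =
      << mmul m (ucm w) >> - << mmul m m' >> :> tabpoly k A.
    rewrite /gen prod_ucm mulrBr; congr (_ - _); exact: malgUM.
  have q_eq : qpi rel << mmul m (ucm w) >> = qpi rel << mmul m m' >>.
    apply/eq_qpi; rewrite -gE; apply: span_gen; exact: IdealRel (YtabRel k w).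
  have wtE : monom_wt wt (mmul m (ucm w)) = monom_wt wt (mmul m m').
    by rewrite !monom_wtM monom_wtU monom_wt_prod nboxes_SC.
  rewrite gE linearB; apply/eqP; rewrite subr_eq0; apply/eqP.
  apply: etrans (F0E _) _; apply: etrans _ (esym (F0E _)).
  exact: f_eq wtE q_eq.
have [F FE] : exists F : {linear Y -> Y}, forall q, F (qpi _ q) = F0 q.
  exact: quotmod_lift F0rel.
exists F => w; apply: etrans (FE _) _; apply: etrans (F0E _) _.
by rewrite /f monom_wtU; case: (_ == n); reflexivity.
Qed.

Lemma ytab_deg_tab w : ytab_deg (nboxes w) (tab k w).
Proof. by apply: span_gen; exists w. Qed.

Lemma ytab_grading : is_grading (@ytab_deg k A).
Proof.
have degS n : submodule (@ytab_deg k A n) by exact: submodule_span.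
apply: grading_by_projections => // [P sP GP|n].
  by apply: ytab_ind => // w; apply: (GP (nboxes w)); exact: ytab_deg_tab.
have [F FE] := ytab_proj n; exists F => i x Gx.
apply: (Gx (fun x => F x = if i == n then x else 0)).
  split=> [|c u v Eu Ev]; first by rewrite linear0; case: ifP.
  by rewrite linearP Eu Ev; case: (i == n); rewrite ?scaler0 ?addr0.
by move=> _ [w <- ->]; exact: FE.
Qed.

End Grading.

(* H stands for ytab k A and r for rtab k: over the concrete module conversion
   is intractable. *)
Section CutCoalgebra.
Variables (k : comNzRingType) (A : choiceType) (H : lmodType k).
Variables (Delta : {linear H -> (H ⊗ H)%type}) (eps : {scalar H}).
Variable r : seq (nat * seq A) -> H.
Implicit Types h : seq (nat * seq A).
Hypothesis DeltaE : forall h, is_pre h ->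
  Delta (r h) = \sum_(e <- cuts h) r (lo h e) ⊗ r (up h e).
Hypothesis epsE : forall h, is_pre h -> eps (r h) = (nboxes h == 0%N)%:R.

Let DL : linear Delta := linearL Delta.

Lemma counitl_bil : bil (fun a b : H => eps a *: b).
Proof. by split=> [z|z] c u v /=; rewrite ?linearP ?scalerDl ?scalerDr !scalerA // mulrC. Qed.

Lemma counitr_bil : bil (fun a b : H => eps b *: a).
Proof. by split=> [z|z] c u v /=; rewrite ?linearP ?scalerDl ?scalerDr !scalerA // mulrC. Qed.

Lemma cut_counitl h : is_pre h -> tlift (fun a b => eps a *: b) (Delta (r h)) = r h.
Proof.
move=> ph; rewrite DeltaE // (tlift_sum counitl_bil).
rewrite (bigD1_seq _ (inner_cuts ph) (uniq_btw _ _)) /= big_seq_cond big1 => [|e].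
  rewrite addr0 up_self epsE; last by case: (cuts_pre ph (inner_cuts ph)).
  by rewrite nboxes_lo0 ?inner_cuts // eqxx scale1r.
case/andP=> e_h ne; have [plo _] := cuts_pre ph e_h.
by rewrite epsE // nboxes_lo0 // (negPf ne) scale0r.
Qed.

Lemma cut_counitr h : is_pre h -> tlift (fun a b => eps b *: a) (Delta (r h)) = r h.
Proof.
move=> ph; rewrite DeltaE // (tlift_sum counitr_bil).
rewrite (bigD1_seq _ (outer_cuts ph) (uniq_btw _ _)) /= big_seq_cond big1 => [|e].
  rewrite addr0 lo_self epsE; last by case: (cuts_pre ph (outer_cuts ph)).
  by rewrite nboxes_up0 ?outer_cuts // eqxx scale1r.
case/andP=> e_h ne; have [_ pup] := cuts_pre ph e_h.
by rewrite epsE // nboxes_up0 // (negPf ne) scale0r.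
Qed.

Lemma cut_coassoc h : is_pre h ->
  tassoc (tmap Delta id (Delta (r h))) = tmap id Delta (Delta (r h)).
Proof.
move=> ph; have idL := @lin_id k H; have T1 := tmap_lin DL idL; have T2 := tmap_lin idL DL.
have aL := @tassocL k H H H.
rewrite (DeltaE ph) (lin_sum T1) (lin_sum aL) (lin_sum T2).
(* The threefold cut along [e'] ⊆ [e], to which both iterated coproducts expand. *)
pose G e' e := r (lo h e') ⊗ (r (lo (up h e') e) ⊗ r (up h e)).
have := @exchange_btw _ _ _ (fun _ _ => true) (fun _ _ => true) G
  (etrans (size_inner h) (esym (size_outer h))).
rewrite -/(cuts h) => GE; apply: etrans (etrans GE _).
  apply: eq_big_seq => e e_h; have [plo _] := cuts_pre ph e_h.
  rewrite (tmapE DL idL) (DeltaE plo) tens_suml (lin_sum aL) (cuts_lo e_h).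
  apply: eq_big_seq => e'; rewrite -(cuts_lo e_h) mem_cuts.
  move: e_h; rewrite mem_cuts => /and3P[s le1 le2].
  rewrite (inner_lo le1 le2) (outer_lo le1 le2) => /and3P[s' le1' le2'].
  by rewrite tassocE (lo_lo _ le2') (up_lo le1' le2').
apply: eq_big_seq => e' e'_h; have [_ pup] := cuts_pre ph e'_h.
rewrite (tmapE idL DL) (DeltaE pup) tens_sumr (cuts_up e'_h).
apply: eq_big_seq => e; rewrite -(cuts_up e'_h) mem_cuts.
move: e'_h; rewrite mem_cuts => /and3P[s le1 le2].
rewrite (inner_up le1 le2) (outer_up le1 le2) => /and3P[s' le1' le2'].
by rewrite /G (up_up le1 le1').
Qed.

End CutCoalgebra.

(** * The graded connected bialgebra of tableaux *)

Section YtabHopf.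
Variables (k : comNzRingType) (A : choiceType).
Implicit Types (h : seq (nat * seq A)) (w : tableau A).
Local Notation Y := (ytab k A).
Local Notation YY := (Y ⊗ Y)%type.
Local Notation rtab := (@rtab k A).

Variables (Delta : {linear Y -> YY}) (eps : {scalar Y}) (S : {linear Y -> Y}).
Hypothesis DeltaE : forall h, is_pre h -> Delta (rtab h) = rcut k h.
Hypothesis Delta1 : Delta 1 = (1 : Y) ⊗ (1 : Y).
Hypothesis DeltaM : forall x y, Delta (ytab_mul k A x y) =
  tmul (ytab_mul k A) (Delta x) (Delta y).
Hypothesis epsE : forall h, is_pre h -> eps (rtab h) = (nboxes h == 0%N)%:R.
Hypothesis eps1 : eps 1 = 1.
Hypothesis epsM : forall x y, eps (ytab_mul k A x y) = eps x * eps y.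

Let DL : linear Delta := linearL Delta.

Definition ytab_ops := HopfOps (ytab_mul k A) (1 : Y) Delta eps S.

Lemma ytab_bialgebra : is_bialgebra ytab_ops.
Proof.
have lB := counitl_bil eps; have rB := counitr_bil eps.
have idL := @lin_id k Y; have T1 := tmap_lin DL idL; have T2 := tmap_lin idL DL.
split; last 1 first.
- exact: eps1.
- by split; [exact: ytab_mulA | exact: ytab_mul1l | exact: ytab_mul1r].
- split=> y.
  + move: y; apply: ytab_ind => [|w].
      apply: lin_eq_submodule; last exact: lin_comp T2 DL.
      exact: lin_comp (@tassocL k Y Y Y) (lin_comp T1 DL).
    by rewrite -rtab_tableau; apply: (cut_coassoc DeltaE); exact: is_pre_tableau.
  + move: y; apply: ytab_ind => [|w].
      by apply: lin_eq_submodule idL; exact: lin_comp (tlift_linear lB) DL.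
    by rewrite -rtab_tableau; apply: (cut_counitl DeltaE epsE); exact: is_pre_tableau.
  move: y; apply: ytab_ind => [|w].
    by apply: lin_eq_submodule idL; exact: lin_comp (tlift_linear rB) DL.
  by rewrite -rtab_tableau; apply: (cut_counitr DeltaE epsE); exact: is_pre_tableau.
- exact: DeltaM.
- exact: Delta1.
exact: epsM.
Qed.

Local Notation deg := (@ytab_deg k A).

Lemma ytab_deg_rtab h : is_pre h -> deg (nboxes h) (rtab h).
Proof. by move=> /(rtab_trim k)[w [_ -> <-]]; exact: ytab_deg_tab. Qed.

Lemma ytab_deg_mul m n x y : deg m x -> deg n y -> deg (m + n)%N (ytab_mul k A x y).
Proof.
have mB := bilinearB (ytab_mul k A).
move=> Gx Gy; apply: (Gx (fun x => deg (m + n)%N (ytab_mul k A x y))).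
  by apply: lin_subset (mB.1 y) _; exact: submodule_span.
move=> _ [w1 <- ->]; apply: (Gy (fun y => deg (_ + n)%N (ytab_mul k A _ y))).
  by apply: lin_subset (mB.2 _) _; exact: submodule_span.
move=> _ [w2 <- ->]; have [w wE <-] := tabM k w1 w2.
by rewrite ytab_mulE -wE; exact: ytab_deg_tab.
Qed.

Lemma ytab_deg1 : deg 0%N 1.
Proof. by rewrite -tab_empty; apply: span_gen; exists (empty_tableau A). Qed.

Lemma ytab_deg_comul n x : deg n x -> 
  Defs.span (fun t => exists i j a b, [/\ (i + j)%N = n, deg i a, deg j b & t = a ⊗ b])
    (Delta x).
Proof.
set GG := fun t : YY => _; move=> Gx; apply: (Gx (fun x => Defs.span GG (Delta x))).
  by apply: lin_subset DL _; exact: submodule_span.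
move=> _ [w nw ->]; have pw := is_pre_tableau w.
rewrite -rtab_tableau (DeltaE pw) /rcut big_seq.
apply: (submodule_sum (submodule_span GG)) => e e_w.
have [plo pup] := cuts_pre pw e_w.
apply: span_gen; exists (nboxes (lo w e)), (nboxes (up w e)), (rtab (lo w e)), (rtab (up w e)).
move: e_w; rewrite mem_cuts => /and3P[_ le1 le2].
exact: And4 (etrans (nboxes_lo_up le1 le2) nw) (ytab_deg_rtab plo) (ytab_deg_rtab pup) (erefl _).
Qed.

Lemma eps_tab w : eps (tab k w) = (nboxes w == 0%N)%:R.
Proof. by rewrite -rtab_tableau (epsE (is_pre_tableau w)). Qed.

Lemma ytab_deg_counit n x : deg n x -> (0 < n)%N -> eps x = 0.
Proof.
move=> Gx n_gt0; apply: (Gx (fun x => eps x = 0)).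
  split=> [|c u v Eu Ev]; first exact: linear0.
  by rewrite linearP Eu Ev /= mulr0 addr0.
move=> _ [w nw ->]; rewrite eps_tab nw.
by case: n n_gt0 {Gx nw}.
Qed.

(** If the first row has no box, the inner and outer end agree there, so SC cuts below it; shifted
    back to the left, that row is [(0, [::])], whose class is 1. *)
Lemma rtab_nboxes0 h : is_pre h -> nboxes h = 0%N -> rtab h = 1.
Proof.
have rM := rtab_cut_mult k A.
elim: h => [|[m s] h IHh] ph; first by rewrite (cm_nil rM).
rewrite /nboxes /= => /eqP; rewrite addn_eq0 => /andP[/nilP s0 /eqP n0].
rewrite s0 in ph *.
have [_ ph'] : _ /\ is_pre h := @is_pre_cat _ [:: (m, [::])] h ph.
rewrite -[_ :: h]/([:: (m, [::])] ++ h) (cm_cat rM) //; last first.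
  move: ph; rewrite is_pre_cons addn0 => /and3P[_ le _].
  by rewrite /junction /=.
rewrite (IHh ph' n0) mulr1 -[[:: (m, [::])]]/(shift m [:: (0%N, [::])]) (cm_shift rM) //.
exact: cm_zero rM.
Qed.

Lemma ytab_connected x : deg 0%N x <-> exists c : k, x = c *: (1 : Y).
Proof.
have s0 := submodule_span (fun x : Y => exists2 w : tableau A, nboxes w = 0%N & x = tab k w).
split=> [Gx|[c ->]]; last by apply: (submoduleZ s0); exact: ytab_deg1.
apply: (Gx (fun x => exists c : k, x = c *: (1 : Y))).
  split=> [|c u v [a ->] [b ->]]; first by exists 0; rewrite scale0r.
  by exists (c * a + b); rewrite scalerDl scalerA.
move=> _ [w nw ->]; exists 1.
by rewrite -rtab_tableau (rtab_nboxes0 (is_pre_tableau w) nw) scale1r.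
Qed.

Lemma ytab_unit_inj : injective (fun c : k => c *: (1 : Y)).
Proof.
have epsZ c : eps (c *: (1 : Y)) = c.
  by apply: etrans (linearZ_LR eps c 1) _; rewrite eps1; exact: mulr1.
move=> a b ab; rewrite -[a]epsZ -[b]epsZ; exact: congr1 ab.
Qed.

End YtabHopf.

Lemma ytab_hopf (k : comNzRingType) (A : choiceType) :
  exists (Delta : {linear ytab k A -> (ytab k A ⊗ ytab k A)%type})
         (eps : {scalar ytab k A}) (S : {linear ytab k A -> ytab k A}),
  let D := HopfOps (@qmul k _ (@ytab_rel k A)) 1 Delta eps S in
  [/\ forall h, is_pre h -> Delta (rtab k h) = rcut k h,
      forall h, is_pre h -> eps (rtab k h) = (nboxes h == 0%N)%:R,
      is_hopf_algebra D /\ (forall x, exists N, S x = \sum_(n < N) conv_pow D n x),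
      is_graded_hopf D (@ytab_deg k A) &
      is_connected D (@ytab_deg k A)].
Proof.
have [Delta [DE D1 DM]] := ytab_comul k A.
have [eps [eE e1 eM]] := ytab_counit k A.
(* Fills the antipode field until [graded_antipode] provides the true one. *)
have Y0 : {linear ytab k A -> ytab k A} by exact: idfun.
have B0 := ytab_bialgebra Y0 DE D1 DM eE e1 eM.
have [S [SH SG SN]] := graded_antipode B0 (ytab_grading k A)
  (@ytab_deg_mul k A) (@ytab_deg1 k A) (ytab_deg_comul DE) (ytab_deg_counit eE)
  (fun x => proj1 (ytab_connected x)).
have GD : is_graded_hopf (HopfOps (ytab_mul k A) (1 : ytab k A) Delta eps S) (@ytab_deg k A).
  split.
  - exact: ytab_grading.
  - exact: ytab_deg_mul.
  - exact: ytab_deg1.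
  - exact: ytab_deg_comul DE.
  - exact: ytab_deg_counit eE.
  exact: SG.
exists Delta, eps, S; split.
- exact: DE.
- exact: eE.
- split; [exact: SH | exact: SN].
- exact: GD.
split; [exact: ytab_connected | exact: ytab_unit_inj e1].
Qed.

(** * Quasi-shuffles *)

(* pre x u stands for letters x * u, wd for word k and qs for qshuffle d.  The
   module of words is kept abstract because conversion is intractable on it. *)
Section AbstractQuasiShuffle.
Variables (k : comNzRingType) (A : choiceType) (W : lmodType k).
Variables (d : {malg k[A]} -> {malg k[A]} -> {malg k[A]}) (dB : bil d).
Variables (pre : {malg k[A]} -> W -> W) (preB : bil pre).
Variables (wd : seq A -> W) (qs : W -> W -> W) (qsB : bil qs).

Hypothesis wd_ind : forall P : W -> Prop, submodule P -> (forall w, P (wd w)) -> forall x, P x.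
Hypothesis pre_wd : forall a w, pre << a >> (wd w) = wd (a :: w).
Hypothesis qs_nill : forall w, qs (wd [::]) (wd w) = wd w.
Hypothesis qs_nilr : forall w, qs (wd w) (wd [::]) = wd w.
Hypothesis qs_cons : forall a u b v, qs (wd (a :: u)) (wd (b :: v)) =
  pre << a >> (qs (wd u) (wd (b :: v))) + pre << b >> (qs (wd (a :: u)) (wd v))
  + pre (d << a >> << b >>) (qs (wd u) (wd v)).

Lemma qs1l x : qs (wd [::]) x = x.
Proof.
move: x; apply: wd_ind; last exact: qs_nill.
by apply: lin_eq_submodule (@lin_id _ _); exact: (qsB.2 _).
Qed.

Lemma qs1r x : qs x (wd [::]) = x.
Proof.
move: x; apply: wd_ind; last exact: qs_nilr.
by apply: lin_eq_submodule (@lin_id _ _); exact: (qsB.1 _).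
Qed.

Let lin_add3 (U V : lmodType k) (f g h : U -> V) : linear f -> linear g -> linear h ->
  linear (fun x => f x + g x + h x).
Proof. by move=> fL gL hL; apply: lin_add hL; apply: lin_add. Qed.

(** The recursion on words is linear in every argument and so extends to all of kA; this generality
    is needed because a diamond product of letters need not be a letter. *)
Lemma qs_pre x u y v : qs (pre x u) (pre y v) =
  pre x (qs u (pre y v)) + pre y (qs (pre x u) v) + pre (d x y) (qs u v).
Proof.
move: x; apply: malg_submodule_ind => [|a].
  apply: lin_eq_submodule; first exact: lin_comp (qsB.1 _) (preB.1 u).
  apply: lin_add3; first exact: (preB.1 _).
    exact: lin_comp (preB.2 y) (lin_comp (qsB.1 v) (preB.1 u)).
  exact: lin_comp (preB.1 _) (dB.1 y).
move: y; apply: malg_submodule_ind => [|b].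
  apply: lin_eq_submodule; first exact: lin_comp (qsB.2 _) (preB.1 v).
  apply: lin_add3; last exact: lin_comp (preB.1 _) (dB.2 _).
    exact: lin_comp (preB.2 _) (lin_comp (qsB.2 u) (preB.1 v)).
  exact: (preB.1 _).
move: u; apply: wd_ind => [|u].
  apply: lin_eq_submodule; first exact: lin_comp (qsB.1 _) (preB.2 _).
  apply: lin_add3; first exact: lin_comp (preB.2 _) (qsB.1 _).
    exact: lin_comp (preB.2 _) (lin_comp (qsB.1 v) (preB.2 _)).
  exact: lin_comp (preB.2 _) (qsB.1 _).
move: v; apply: wd_ind => [|v]; last by rewrite !pre_wd qs_cons.
apply: lin_eq_submodule; first exact: lin_comp (qsB.2 _) (preB.2 _).
apply: lin_add3; first exact: lin_comp (preB.2 _) (lin_comp (qsB.2 _) (preB.2 _)).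
  exact: lin_comp (preB.2 _) (qsB.2 _).
exact: lin_comp (preB.2 _) (qsB.2 _).
Qed.

Lemma qsC : commutative d -> commutative qs.
Proof.
move=> dC x y; move: x; apply: wd_ind => [|u].
  by apply: lin_eq_submodule; [exact: (qsB.1 _) | exact: (qsB.2 _)].
move: y; apply: wd_ind => [|v].
  by apply: lin_eq_submodule; [exact: (qsB.2 _) | exact: (qsB.1 _)].
elim: u v => [|a u IHu] v; first by rewrite qs_nill qs_nilr.
elim: v => [|b v IHv]; first by rewrite qs_nill qs_nilr.
by rewrite !qs_cons IHu IHv IHu dC [X in X + _]addrC.
Qed.

(** By induction on the total length. Both sides split into seven groups, according to which
    nonempty subset of the three first letters is multiplied together to form the new first
    letter. *)
Lemma qsA : associative d -> associative qs.
Proof.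
move=> dA x y z; move: x; apply: wd_ind => [|u].
  by apply: lin_eq_submodule; [exact: (qsB.1 _) | exact: lin_comp (qsB.1 z) (qsB.1 y)].
move: y; apply: wd_ind => [|v].
  apply: lin_eq_submodule; first exact: lin_comp (qsB.2 _) (qsB.1 z).
  exact: lin_comp (qsB.1 z) (qsB.2 _).
move: z; apply: wd_ind => [|w].
  by apply: lin_eq_submodule; [exact: lin_comp (qsB.2 _) (qsB.2 _) | exact: (qsB.2 _)].
have [n] := ubnP (size u + size v + size w); elim: n u v w => // n IHn.
move=> [|a u] [|b v] [|c w] lt_n; rewrite ?qs1l ?qs1r //.
rewrite /= in lt_n.
(* Associativity after dropping the first letter from each nonempty subset of the three words: seven
   cases, all of smaller total length. *)
have E1 : qs (wd u) (qs (wd (b :: v)) (wd (c :: w))) = qs (qs (wd u) (wd (b :: v))) (wd (c :: w)).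
  by apply: IHn => /=; lia.
have E2 : qs (wd (a :: u)) (qs (wd v) (wd (c :: w))) = qs (qs (wd (a :: u)) (wd v)) (wd (c :: w)).
  by apply: IHn => /=; lia.
have E3 : qs (wd (a :: u)) (qs (wd (b :: v)) (wd w)) = qs (qs (wd (a :: u)) (wd (b :: v))) (wd w).
  by apply: IHn => /=; lia.
have E12 : qs (wd u) (qs (wd v) (wd (c :: w))) = qs (qs (wd u) (wd v)) (wd (c :: w)).
  by apply: IHn => /=; lia.
have E13 : qs (wd u) (qs (wd (b :: v)) (wd w)) = qs (qs (wd u) (wd (b :: v))) (wd w).
  by apply: IHn => /=; lia.
have E23 : qs (wd (a :: u)) (qs (wd v) (wd w)) = qs (qs (wd (a :: u)) (wd v)) (wd w).
  by apply: IHn => /=; lia.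
have E123 : qs (wd u) (qs (wd v) (wd w)) = qs (qs (wd u) (wd v)) (wd w).
  by apply: IHn => /=; lia.
move: E1 E2 E3 E12 E13 E23 E123; rewrite -!pre_wd.
(* Letters become arbitrary elements of kA, so that [qs_pre] also applies to the products
   [d x y]. *)
move: (wd u) (wd v) (wd w) << a >> << b >> << c >> => U V Z x y z.
have qDl p q r : qs (p + q) r = qs p r + qs q r by exact: (linD (qsB.1 r)).
have qDr p q r : qs r (p + q) = qs r p + qs r q by exact: (linD (qsB.2 r)).
have pD r p q : pre r (p + q) = pre r p + pre r q by exact: (linD (preB.2 r)).
move=> E1 E2 E3 E12 E13 E23 E123.
(* The common value of both sides, sorted by first letter. *)
transitivity (pre x (qs U (qs (pre y V) (pre z Z))) + pre y (qs (pre x U) (qs V (pre z Z)))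
   + pre (d x y) (qs U (qs V (pre z Z))) + pre (d x z) (qs U (qs (pre y V) Z))
   + pre (d y z) (qs (pre x U) (qs V Z)) + pre (d x (d y z)) (qs U (qs V Z))
   + pre z (qs (pre x U) (qs (pre y V) Z))).
  rewrite [qs (pre y V) (pre z Z)]qs_pre !qDr !qs_pre !pD.
  by rewrite [LHS](AC (3*3*3) ((1*4*7)*2*3*6*8*9*5)).
rewrite E1 E2 E3 E12 E13 E23 E123 [qs (pre x U) (pre y V)]qs_pre !qDl !qs_pre !pD dA.
by rewrite [RHS](AC (3*3*3) (1*4*7*3*6*9*(2*5*8))).
Qed.

Variable dec : W -> (W ⊗ W)%type.
Hypothesis decL : linear dec.
Hypothesis dec_wd : forall w, dec (wd w) = \sum_(i < (size w).+1) wd (take i w) ⊗ wd (drop i w).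

(** A cut falls either before the first letter or inside the rest. *)
Lemma dec_pre x u : dec (pre x u) = wd [::] ⊗ pre x u + tmap (pre x) id (dec u).
Proof.
have idL := @lin_id k W; have tL x' := tmap_lin (preB.2 x') idL.
move: u; apply: wd_ind => [|w].
  apply: lin_eq_submodule; first exact: lin_comp decL (preB.2 x).
  by apply: lin_add; [exact: lin_comp ((tensP _ _).2 _) (preB.2 x) | exact: lin_comp (tL x) decL].
have tE x' : tmap (pre x') id (dec (wd w)) =
    \sum_(i < (size w).+1) pre x' (wd (take i w)) ⊗ wd (drop i w).
  rewrite dec_wd (lin_sum (tL x')); apply: eq_bigr => i _.
  by rewrite (tmapE (preB.2 x') idL).
rewrite tE; move: x; apply: malg_submodule_ind => [|a].
  apply: lin_eq_submodule; first exact: lin_comp decL (preB.1 _).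
  apply: lin_add; first exact: lin_comp ((tensP _ _).2 _) (preB.1 _).
  by apply: lin_sumf => i; exact: lin_comp ((tensP _ _).1 _) (preB.1 _).
rewrite pre_wd dec_wd big_ord_recl; congr (_ + _).
by apply: eq_bigr => i _; rewrite pre_wd.
Qed.

End AbstractQuasiShuffle.

(** * Linearization *)

Lemma strip_shift c mu e :
  strip [seq (x + c)%N | x <- mu] [seq (x + c)%N | x <- e] = strip mu e.
Proof.
elim: mu e => [|m mu IHm] [|x e] //=; rewrite IHm; congr (_ && _).
by case: e => //= y e; rewrite leq_add2r.
Qed.

Lemma dprod_cat (k : comNzRingType) (A : choiceType)
    (d : {malg k[A]} -> {malg k[A]} -> {malg k[A]}) s1 s2 :
    associative d -> s1 != [::] -> s2 != [::] ->
  dprod d (s1 ++ s2) = d (dprod d s1) (dprod d s2).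
Proof.
move=> dA; case: s1 => // a s1 _; case: s2 => // b s2 _.
rewrite /= foldl_cat /=; elim: s2 (foldl _ _ _) << b >> => //= c s2 IHs x y.
by rewrite -dA IHs.
Qed.

Section AbstractLinearization.
Variables (k : comNzRingType) (A : choiceType) (W : lmodType k).
Variables (d : {malg k[A]} -> {malg k[A]} -> {malg k[A]}).
Variables (pre : {malg k[A]} -> W -> W) (preB : bil pre).
Variables (one : W) (qs : W -> W -> W) (qsB : bil qs).
Hypothesis dA : associative d.
Hypothesis qs1l : left_id one qs.
Hypothesis qs1r : right_id one qs.
Hypothesis qs_pre : forall x u y v, qs (pre x u) (pre y v) =
  pre x (qs u (pre y v)) + pre y (qs (pre x u) v) + pre (d x y) (qs u v).
Implicit Types h : seq (nat * seq A).

Definition first_strip h e := strip (inner h) e && (e != inner h).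

(** The contribution of the empty chain, which is a decomposition only of a shape without boxes. *)
Definition linearize_base h : W := if nboxes h == 0%N then one else 0.

Definition strip_prod h e : {malg k[A]} := dprod d (entries (lo h e)).

(* The sum over semi-standard decompositions, sorted by their first strip. *)
Fixpoint linearize_rec n h : W :=
  if n is n'.+1 then
    linearize_base h +
    \sum_(e <- cuts h | first_strip h e) pre (strip_prod h e) (linearize_rec n' (up h e))
  else one.

Definition linearize h : W := linearize_rec (nboxes h) h.

(** Every first strip is nonempty, so [nboxes h] rounds exhaust [h] and more fuel changes
    nothing. *)
Lemma linearize_rec_eq n m h : (nboxes h <= n)%N -> (nboxes h <= m)%N ->
  linearize_rec n h = linearize_rec m h.
Proof.
have first_lt h' e : e \in cuts h' -> first_strip h' e -> (nboxes (up h' e) < nboxes h')%N.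
  by move=> e_h /andP[_]; exact: up_cuts_lt.
have lin_rec0 n' h' : nboxes h' = 0%N -> linearize_rec n' h' = one.
  case: n' => //= n' h'0; rewrite /linearize_base h'0 eqxx big1_seq ?addr0 // => e /andP[st e_h].
  by have := first_lt _ _ e_h st; rewrite h'0.
elim: n m h => [|n IHn] [|m] h; rewrite ?leqn0.
- by [].
- by move=> /eqP h0 _; rewrite [RHS]lin_rec0.
- by move=> _ /eqP h0; rewrite [LHS]lin_rec0.
move=> le_n le_m /=; congr (_ + _); rewrite big_seq_cond [RHS]big_seq_cond.
apply: eq_bigr => e /andP[e_h st]; congr (pre _ _).
by have := first_lt _ _ e_h st => lt; apply: IHn; lia.
Qed.

Definition linearize_tail h : W :=
  \sum_(e <- cuts h | first_strip h e) pre (strip_prod h e) (linearize (up h e)).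

Lemma linearizeE h : linearize h = linearize_base h + linearize_tail h.
Proof.
rewrite /linearize (@linearize_rec_eq _ (nboxes h).+1) //=; congr (_ + _).
rewrite /linearize_tail big_seq_cond [RHS]big_seq_cond.
apply: eq_bigr => e /andP[e_h /andP[_ ne]]; congr (pre _ _).
by apply: linearize_rec_eq => //; apply: ltnW; exact: up_cuts_lt.
Qed.

Lemma linearize0 h : nboxes h = 0%N -> linearize h = one.
Proof. by rewrite /linearize => ->. Qed.

Lemma linearize_shift c h : linearize (shift c h) = linearize h.
Proof.
have [n] := ubnP (nboxes h); elim: n h => // n IHn h lt_n.
rewrite !linearizeE /linearize_base nboxes_shift; congr (_ + _).
rewrite /linearize_tail big_mkcond sum_cuts_shift -big_mkcond.
rewrite big_seq_cond [RHS]big_seq_cond; apply: eq_big => e.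
  rewrite /first_strip inner_shift strip_shift; congr (_ && (_ && _)).
  by rewrite inj_eq //; apply: inj_map; exact: addIn.
case/andP=> e_h /andP[_ ne]; rewrite up_shift /strip_prod lo_shift entries_shift.
move: ne; rewrite inner_shift inj_eq => [ne|]; last by apply: inj_map; exact: addIn.
by have := up_cuts_lt e_h ne => lt; rewrite IHn //; lia.
Qed.

Lemma entries_lo_inner h : entries (lo h (inner h)) = [::].
Proof.
apply: size0nil; rewrite size_entries; elim: h => //= -[m s] h IHh.
by rewrite /lo /= subnn take0 /nboxes /=.
Qed.

(** An empty part of the strip contributes no entry, so the diamond product is then that of the
    other part alone. If both parts are empty, every term vanishes. *)
Lemma linearize_cat_term h1 h2 e1 e2 (u : W) : is_pre (h1 ++ h2) -> junction h1 h2 ->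
    e1 \in cuts h1 -> e2 \in cuts h2 ->
  (if first_strip (h1 ++ h2) (e1 ++ e2) then pre (strip_prod (h1 ++ h2) (e1 ++ e2)) u else 0) =
  (if first_strip h1 e1 then if first_strip h2 e2 then
      pre (d (strip_prod h1 e1) (strip_prod h2 e2)) u else 0 else 0)
  + (if first_strip h1 e1 then if e2 == inner h2 then pre (strip_prod h1 e1) u else 0 else 0)
  + (if e1 == inner h1 then if first_strip h2 e2 then pre (strip_prod h2 e2) u else 0 else 0).
Proof.
move=> ph j e1_h e2_h; have [/andP[ph1 _] /andP[ph2 _]] := is_pre_cat ph.
have sz1 := size_cuts e1_h.
have j' : (head 0 e2 <= last (head 0 e2) (inner h1))%N.
  move: e2_h; rewrite mem_cuts => /and3P[_ _ le2].
  exact: junction_leq j (all2_leq_refl _) le2.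
have entr_n0 h e : e \in cuts h -> e != inner h -> entries (lo h e) != [::].
  by move=> e_h; rewrite -(nboxes_lo0 e_h) -size_entries size_eq0.
rewrite {1 2}/first_strip /strip_prod inner_cat strip_cat ?size_inner //.
rewrite eqseq_cat ?size_inner // (lo_cat _ _ sz1) entries_cat /first_strip.
have [->|ne1] := eqVneq e1 (inner h1); have [->|ne2] := eqVneq e2 (inner h2).
- by rewrite !andbF !addr0.
- rewrite (strip_self ph1) !andbT !andbF !entries_lo_inner /= !add0r.
  by case: (strip _ _).
- rewrite (strip_self ph2) !andbT !andbF !entries_lo_inner cats0 /= addr0.
  by case: (strip _ _); rewrite ?add0r.
rewrite !andbT !addr0.
case: (strip _ _); case: (strip _ _) => //=; rewrite ?addr0 //.
by rewrite dprod_cat // entr_n0.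
Qed.

(* The first strip of h1 ++ h2 is a pair of strips of h1 and h2, not both empty:
   the three cases are the three terms of the quasi-shuffle recursion. *)
Lemma linearize_cat h1 h2 : is_pre (h1 ++ h2) -> junction h1 h2 ->
  linearize (h1 ++ h2) = qs (linearize h1) (linearize h2).
Proof.
have [n] := ubnP (nboxes h1 + nboxes h2); elim: n h1 h2 => // n IHn h1 h2 lt_n ph j.
have [ph1 ph2] := is_pre_cat ph.
pose u1 e1 := linearize (up h1 e1); pose u2 e2 := linearize (up h2 e2).
pose x1 e1 := strip_prod h1 e1; pose x2 e2 := strip_prod h2 e2.
have qsumr r (P : pred (seq nat)) E y :
    qs y (\sum_(e <- r | P e) E e) = \sum_(e <- r | P e) qs y (E e) by exact: bil_sumr.
have qsuml r (P : pred (seq nat)) E y :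
    qs (\sum_(e <- r | P e) E e) y = \sum_(e <- r | P e) qs (E e) y by exact: bil_suml.
have psumr r (P : pred (seq nat)) E y :
    pre y (\sum_(e <- r | P e) E e) = \sum_(e <- r | P e) pre y (E e) by exact: bil_sumr.
have qDl p q r : qs (p + q) r = qs p r + qs q r by exact: (linD (qsB.1 r)).
have qDr p q r : qs r (p + q) = qs r p + qs r q by exact: (linD (qsB.2 r)).
have pD r p q : pre r (p + q) = pre r p + pre r q by exact: (linD (preB.2 r)).
have q0l y : qs 0 y = 0 by exact: (lin0 (qsB.1 y)).
have q0r y : qs y 0 = 0 by exact: (lin0 (qsB.2 y)).
have p0 y : pre y 0 = 0 by exact: (lin0 (preB.2 y)).
(* In [Sa] the first strip meets both pieces, in [Sb] only [h1], in [Sc] only [h2]. *)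
pose Sa := \sum_(e1 <- cuts h1 | first_strip h1 e1) \sum_(e2 <- cuts h2 | first_strip h2 e2)
  pre (d (x1 e1) (x2 e2)) (qs (u1 e1) (u2 e2)).
pose Sb := \sum_(e1 <- cuts h1 | first_strip h1 e1) pre (x1 e1) (qs (u1 e1) (linearize h2)).
pose Sc := \sum_(e2 <- cuts h2 | first_strip h2 e2) pre (x2 e2) (qs (linearize h1) (u2 e2)).
have tailE : linearize_tail (h1 ++ h2) = Sa + Sb + Sc.
  rewrite /linearize_tail big_mkcond sum_cuts_cat //=.
  (* The induction hypothesis applies to what is left above the strip: the strip is nonempty, so
     boxes have been lost, and the junction persists. *)
  have termE e1 e2 : e1 \in cuts h1 -> e2 \in cuts h2 ->
      (if first_strip (h1 ++ h2) (e1 ++ e2) then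
        pre (strip_prod (h1 ++ h2) (e1 ++ e2)) (linearize (up (h1 ++ h2) (e1 ++ e2))) else 0) =
      (if first_strip (h1 ++ h2) (e1 ++ e2) then
        pre (strip_prod (h1 ++ h2) (e1 ++ e2)) (qs (u1 e1) (u2 e2)) else 0).
    move=> e1_h e2_h; case: ifP => // /andP[_ ne]; congr (pre _ _).
    have e_h := cuts_cat j e1_h e2_h.
    have [_ pup] := cuts_pre ph e_h; have lt := up_cuts_lt e_h ne.
    rewrite (up_cat _ _ (size_cuts e1_h)) nboxes_cat in pup lt *.
    apply: IHn => //; first by move: lt; rewrite !nboxes_cat; lia.
    move: e1_h e2_h; rewrite !mem_cuts => /and3P[s1 le1 le1'] /and3P[s2 le2 le2'].
    apply: (junction_cuts j); first by rewrite (inner_up le1 le1').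
    by rewrite (outer_up le2 le2') all2_leq_refl.
  transitivity (\sum_(e1 <- cuts h1) \sum_(e2 <- cuts h2)
    ((if first_strip h1 e1 then if first_strip h2 e2 then
        pre (d (x1 e1) (x2 e2)) (qs (u1 e1) (u2 e2)) else 0 else 0)
    + (if first_strip h1 e1 then if e2 == inner h2 then
        pre (x1 e1) (qs (u1 e1) (u2 e2)) else 0 else 0)
    + (if e1 == inner h1 then if first_strip h2 e2 then
        pre (x2 e2) (qs (u1 e1) (u2 e2)) else 0 else 0))).
    apply: eq_big_seq => e1 e1_h; apply: eq_big_seq => e2 e2_h.
    by rewrite termE // linearize_cat_term.
  have pick (h : seq (nat * seq A)) (F : seq nat -> W) : is_pre h ->
      \sum_(e <- cuts h) (if e == inner h then F e else 0) = F (inner h).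
    move=> ph'; rewrite (bigD1_seq _ (inner_cuts ph') (uniq_btw _ _)) /= eqxx.
    by rewrite big1 ?addr0 // => e /negPf->.
  under eq_bigr do rewrite !big_split; rewrite !big_split /=; congr (_ + _ + _).
  - rewrite [RHS]big_mkcond; apply: eq_bigr => e1 _; case: ifP => _; last by rewrite big1.
    by rewrite [RHS]big_mkcond.
  - rewrite [RHS]big_mkcond; apply: eq_bigr => e1 _; case: ifP => _; last by rewrite big1.
    by rewrite pick // /u2 up_self.
  rewrite exchange_big /= [RHS]big_mkcond; apply: eq_bigr => e2 _.
  by rewrite (pick h1) // /u1 up_self.
have baseE : linearize_base (h1 ++ h2) = qs (linearize_base h1) (linearize_base h2).
  rewrite /linearize_base nboxes_cat addn_eq0.
  by do 2!case: (_ == 0%N); rewrite ?q0l ?q0r ?qs1l.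
(* The quasi-shuffle of the two tails yields [Sa] in full, but of [Sb] and [Sc] only what involves
   tails on both sides; the remaining products of a base with a tail are isolated in [SbE] and
   [ScE]. *)
have qsEE : qs (linearize_tail h1) (linearize_tail h2) =
    (\sum_(e1 <- cuts h1 | first_strip h1 e1) pre (x1 e1) (qs (u1 e1) (linearize_tail h2)))
    + (\sum_(e2 <- cuts h2 | first_strip h2 e2) pre (x2 e2) (qs (linearize_tail h1) (u2 e2))) + Sa.
  rewrite {1}/linearize_tail qsuml.
  under eq_bigr => e1 _.
    rewrite {1}/linearize_tail qsumr; under eq_bigr do rewrite qs_pre; rewrite !big_split /=.
    rewrite -psumr -qsumr. over.
  rewrite !big_split /=; congr (_ + _ + _).
  rewrite exchange_big /=; apply: eq_bigr => e2 _.
  by rewrite -psumr -qsuml.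
have SbE : Sb = qs (linearize_tail h1) (linearize_base h2)
    + \sum_(e1 <- cuts h1 | first_strip h1 e1) pre (x1 e1) (qs (u1 e1) (linearize_tail h2)).
  rewrite /Sb [linearize h2]linearizeE; under eq_bigr do rewrite qDr pD; rewrite big_split /=.
  congr (_ + _); rewrite /linearize_base; case: (_ == 0%N).
    by rewrite qs1r; under eq_bigr do rewrite qs1r.
  by rewrite q0r big1 // => e _; rewrite q0r p0.
have ScE : Sc = qs (linearize_base h1) (linearize_tail h2)
    + \sum_(e2 <- cuts h2 | first_strip h2 e2) pre (x2 e2) (qs (linearize_tail h1) (u2 e2)).
  rewrite /Sc [linearize h1]linearizeE; under eq_bigr do rewrite qDl pD; rewrite big_split /=.
  congr (_ + _); rewrite /linearize_base; case: (_ == 0%N).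
    by rewrite qs1l; under eq_bigr do rewrite qs1l.
  by rewrite q0l big1 // => e _; rewrite q0l p0.
rewrite linearizeE tailE baseE SbE ScE [linearize h1]linearizeE [linearize h2]linearizeE.
rewrite !qDl !qDr qsEE.
by rewrite [LHS](AC (1*(1*2*2)) ((1*5)*(3*(4*6*2)))) /=.
Qed.

Lemma linearize_cut_mult : cut_mult qs one linearize.
Proof.
split=> [|h1 h2|c h _|]; first exact: linearize0.
- exact: linearize_cat.
- exact: linearize_shift.
exact: linearize0.
Qed.

End AbstractLinearization.

(** * Linearization and deconcatenation *)

Section LinearizationCoproduct.
Variables (k : comNzRingType) (A : choiceType) (W : lmodType k).
Variables (d : {malg k[A]} -> {malg k[A]} -> {malg k[A]}).
Variables (pre : {malg k[A]} -> W -> W) (preB : bil pre) (one : W).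
Local Notation lz := (linearize d pre one).
Local Notation lz_base := (linearize_base one).
Local Notation lz_tail := (linearize_tail d pre one).
Implicit Types h : seq (nat * seq A).

Variables (dec : W -> (W ⊗ W)%type) (cu : W -> k).
Hypotheses (decL : linear dec) (dec1 : dec one = one ⊗ one).
Hypothesis dec_pre : forall x u, dec (pre x u) = one ⊗ pre x u + tmap (pre x) id (dec u).

(* A deconcatenation of the word of a chain cuts the chain at some e: exchange
   the choice of the first strip with that of e. *)
Lemma dec_linearize h : is_pre h -> dec (lz h) = \sum_(e <- cuts h) lz (lo h e) ⊗ lz (up h e).
Proof.
have [n] := ubnP (nboxes h); elim: n h => // n IHn h lt_n ph.
have idL := @lin_id k W.
(* The term with first strip ending at [e] and cut at [e'], where [e] ⊆ [e']: the strip lies in the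
   lower factor. *)
pose G e e' := pre (strip_prod d h e) (lz (lo (up h e) e')) ⊗ lz (up h e').
have baseE : dec (lz_base h) = one ⊗ lz_base h.
  rewrite /linearize_base; case: (_ == 0%N); first exact: dec1.
  by rewrite (lin0 decL) (lin0 ((tensP W W).2 one)).
have tailE : dec (lz_tail h) = one ⊗ lz_tail h +
    \sum_(e <- cuts h) \sum_(e' <- btw e (outer h) | first_strip h e) G e e'.
  rewrite {1}/linearize_tail (lin_sum decL).
  under eq_bigr do rewrite dec_pre.
  rewrite big_split -tens_sumr; congr (_ + _); rewrite big_mkcond /=.
  apply: eq_big_seq => e e_h.
  case st: (first_strip h e); last by rewrite big_pred0.
  have [_ pup] := cuts_pre ph e_h; have /andP[_ ne] := st.
  rewrite IHn //; last by have := up_cuts_lt e_h ne; lia.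
  have tL := tmap_lin (preB.2 (strip_prod d h e)) idL.
  rewrite (lin_sum tL) (cuts_up e_h); apply: eq_big_seq => e'.
  rewrite -(cuts_up e_h) mem_cuts; move: e_h; rewrite mem_cuts => /and3P[s le1 le2].
  rewrite (inner_up le1 le2) (outer_up le1 le2) => /and3P[s' le1' le2'].
  by rewrite (tmapE (preB.2 _) idL) (up_up le1 le1').
have sz : size (inner h) = size (outer h) by rewrite size_inner size_outer.
rewrite linearizeE (linD decL) baseE tailE addrA -(linD ((tensP W W).2 one)) -linearizeE.
rewrite -(@exchange_btw _ _ _ (fun e _ => first_strip h e) (fun _ _ => true) G sz).
pose E e := lz_tail (lo h e) ⊗ lz (up h e).
transitivity (one ⊗ lz h + \sum_(e <- cuts h) E e).
  congr (_ + _); apply: eq_big_seq => e e_h; rewrite /E /linearize_tail tens_suml (cuts_lo e_h).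
  move: (e_h); rewrite mem_cuts => /and3P[s le1 le2].
  rewrite big_seq_cond [RHS]big_seq_cond; apply: eq_big => e'.
    by rewrite /first_strip (inner_lo le1 le2).
  rewrite -(cuts_lo e_h) mem_cuts (inner_lo le1 le2) (outer_lo le1 le2).
  move=> /andP[/and3P[s' le1' le2'] _].
  by rewrite /G /strip_prod lo_lo // up_lo.
(* Only the cut at [inner h] leaves a lower part without boxes; it accounts for cutting the word
   before its first letter. *)
have baseSum : \sum_(e <- cuts h) lz_base (lo h e) ⊗ lz (up h e) = one ⊗ lz h.
  rewrite (bigD1_seq _ (inner_cuts ph) (uniq_btw _ _)) /= up_self.
  rewrite /linearize_base nboxes_lo0 ?inner_cuts // eqxx big_seq_cond big1 ?addr0 // => e.
  case/andP=> e_h /negPf ne; rewrite nboxes_lo0 // ne.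
  exact: lin0 ((tensP W W).1 _).
rewrite -baseSum -big_split; apply: eq_bigr => e _ /=.
by rewrite /E -(linD ((tensP W W).1 _)) -linearizeE.
Qed.

Hypotheses (cuL : scalar cu) (cu1 : cu one = 1) (cu_pre : forall x u, cu (pre x u) = 0).

Lemma cu_linearize h : cu (lz h) = (nboxes h == 0%N)%:R.
Proof.
pose c : {scalar W} := HB.pack cu (GRing.isLinear.Build _ _ _ _ _ cuL).
have tail0 : cu (lz_tail h) = 0.
  apply: etrans (raddf_sum c _ _ _) _; apply: big1 => e _; exact: cu_pre.
rewrite linearizeE; apply: etrans (raddfD c _ _) _; rewrite /= tail0 addr0 /linearize_base.
by case: (_ == 0%N); [exact: cu1 | exact: (raddf0 c)].
Qed.

End LinearizationCoproduct.

(** * Linearization of one-column tableaux *)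

Section Columns.
Variables (k : comNzRingType) (A : choiceType) (W : lmodType k).
Variables (d : {malg k[A]} -> {malg k[A]} -> {malg k[A]}).
Variables (pre : {malg k[A]} -> W -> W) (one : W) (qs : W -> W -> W).
Hypothesis qs1l : left_id one qs.
Local Notation lz := (linearize d pre one).
Hypothesis linearizeM : cut_mult qs one lz.

Definition column (s : seq A) : seq (nat * seq A) := [seq (0%N, [:: a]) | a <- s].

Lemma inner_column s : inner (column s) = nseq (size s) 0%N.
Proof. by elim: s => //= a s ->. Qed.

Lemma outer_column s : outer (column s) = nseq (size s) 1%N.
Proof. by elim: s => //= a s ->. Qed.

Lemma sorted_nseq n x : sorted geq (nseq n x).
Proof. by elim: n => // n IHn; rewrite sorted_geq_cons IHn andbT; case: n {IHn} => /=. Qed.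

Lemma is_tableau_column s : is_tableau (column s).
Proof.
rewrite /is_tableau inner_column outer_column !sorted_nseq /=.
by elim: s.
Qed.

Lemma sorted_geq_head0 e : sorted geq e -> (head 0 e <= 0)%N -> e = nseq (size e) 0%N.
Proof.
elim: e => // x e IHe; rewrite sorted_geq_cons /= leqn0 => /andP[le s] /eqP x0.
by rewrite x0 in le *; rewrite {1}IHe.
Qed.

(** A horizontal strip takes at most one box from a single column, and the first one must be the top
    box. *)
Lemma linearize_column a s : lz (column (a :: s)) = pre << a >> (lz (column s)).
Proof.
pose e0 := 1%N :: inner (column s).
have ph := tableau_is_pre (is_tableau_column (a :: s)).
have e0_in : e0 \in cuts (column (a :: s)).
  rewrite mem_cuts /= inner_column outer_column all2_leq_refl -/(sorted geq (1%N :: _)).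
  rewrite sorted_geq_cons sorted_nseq /= andbT; apply/andP; split.
    by case: s {e0 ph}.
  by elim: s {e0 ph}.
have e0_st : first_strip (column (a :: s)) e0.
  rewrite /first_strip /= inner_column strip_self ?sorted_nseq // andbT.
  by rewrite andbT; case: s {e0 ph e0_in}.
have st_e0 e : e \in cuts (column (a :: s)) -> e != e0 -> first_strip (column (a :: s)) e = false.
  rewrite mem_cuts => /and3P[se le1 le2] ne; apply/negP => /andP[st ne'].
  case: e se le1 le2 ne st ne' => // x e; rewrite sorted_geq_cons.
  move=> /andP[_ se] /andP[_ le1] /andP[le_x1 _] ne /andP[h0 _] ne'.
  have eE : e = inner (column s).
    by rewrite (sorted_geq_head0 se h0) -(all2_leq_size le1) !size_map inner_column.
  move: ne ne'; rewrite eE /e0 /= !eqseq_cons eqxx !andbT.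
  by move: le_x1; rewrite /=; lia.
have loE : entries (lo (column (a :: s)) e0) = [:: a].
  transitivity ([:: a] ++ entries (lo (column s) (inner (column s)))); first by [].
  by rewrite entries_lo_inner.
(* Without its top box the column keeps a boxless row [(1, [::])], which SC cuts off and which has
   the value [one]. *)
have upE : up (column (a :: s)) e0 = [:: (1%N, [::])] ++ column s.
  by rewrite -[in RHS](up_self (column s)).
rewrite linearizeE /linearize_base /= add0r /linearize_tail.
rewrite big_mkcond (bigD1_seq e0 e0_in (uniq_btw _ _)) /= e0_st.
rewrite big_seq_cond big1 ?addr0 => [|e /andP[e_in ne]]; last by rewrite st_e0.
rewrite /strip_prod loE upE; congr (pre _ _).
have ps := tableau_is_pre (is_tableau_column s).
rewrite (cm_cat linearizeM).
- by rewrite linearize0 // qs1l.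
- rewrite is_pre_cons ps inner_column outer_column /= andbT.
  by case: s {loE upE e0 ph e0_in e0_st st_e0 ps}.
by rewrite /junction outer_column; case: s {loE upE e0 ph e0_in e0_st st_e0 ps}.
Qed.

End Columns.

(** * Semi-standard decompositions as chains of partitions *)

Section Chains.
Variables (k : comNzRingType) (A : choiceType) (W : lmodType k).
Variables (d : {malg k[A]} -> {malg k[A]} -> {malg k[A]}).
Variables (pre : {malg k[A]} -> W -> W) (preB : bil pre) (one : W).
Local Notation lz := (linearize d pre one).
Variable w : tableau A.

Fixpoint chain_prod e (es : seq (seq nat)) : W :=
  if es is e' :: es' then pre (dprod d (entries (restrict w e e'))) (chain_prod e' es') else one.

Definition is_chain e (es : seq (seq nat)) : bool :=
  path strip_step e es && (last e es == outer w).

Definition chain_sum n e : W :=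
  \sum_(c : n.-tuple (subpart w) | is_chain e (map (@parts A w) c))
    chain_prod e (map (@parts A w) c).

Lemma big_tuple_cons (T : finType) n (F : seq T -> W) :
  \sum_(c : n.+1.-tuple T) F c = \sum_(x : T) \sum_(c : n.-tuple T) F (x :: c).
Proof.
rewrite pair_big /= (reindex (fun p : T * n.-tuple T => [tuple of p.1 :: p.2])) //=.
exists (fun c => (thead c, [tuple of behead c])) => [[x c]|c] _ /=.
  by congr pair; apply: val_inj.
by rewrite -tuple_eta.
Qed.

Lemma chain_sum0 e : chain_sum 0 e = if e == outer w then one else 0.
Proof.
rewrite /chain_sum big_mkcond (big_pred1 [tuple]) => [|c]; last by rewrite (tuple0 c) /= eqxx.
by rewrite /is_chain.
Qed.

Lemma chain_sumS n e : chain_sum n.+1 e =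
  \sum_(eta : subpart w | strip_step e (parts eta))
    pre (dprod d (entries (restrict w e (parts eta)))) (chain_sum n (parts eta)).
Proof.
rewrite /chain_sum big_mkcond.
pose F (c : seq (subpart w)) := if is_chain e (map (@parts A w) c) then
  chain_prod e (map (@parts A w) c) else 0.
rewrite (@big_tuple_cons _ _ F) [RHS]big_mkcond; apply: eq_bigr => eta _.
case: ifP => st; last by rewrite big1 // => c _; rewrite /F /is_chain /= st.
rewrite (bil_sumr preB) [RHS]big_mkcond; apply: eq_bigr => c _.
by rewrite /F /is_chain /= st.
Qed.

(** Partitions grow along a chain, so one that ends at [outer w] cannot start outside it. *)
Lemma chain_part_le n e : ~~ part_le e (outer w) -> chain_sum n e = 0.
Proof.
move=> not_le; rewrite /chain_sum big_pred0 // => c; apply: contraNF not_le.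
rewrite /is_chain; elim: (map _ _) e => [|e' es IHes] e /=; first by move/eqP->; apply/part_leP.
case/andP=> /andP[/and4P[_ /part_leP le _ _] pa] la.
have /part_leP le' := IHes e' (introT andP (conj pa la)).
by apply/part_leP => i; apply: leq_trans (le i) (le' i).
Qed.

(** Identifies the sum over all chains with the recursion: length 0 gives the base, and removing the
    first step of a longer chain gives the tail. Each step adds a box, so lengths below [N]
    suffice. *)
Lemma sum_chains N e : e \in cuts w -> (nboxes (up w e) < N)%N ->
  \sum_(n < N) chain_sum n e = lz (up w e).
Proof.
elim: N e => // N IHN e e_w lt_N.
have pw := is_pre_tableau w; move: (e_w); rewrite mem_cuts => /and3P[s le1 le2].
rewrite big_ord_recl /= linearizeE; congr (_ + _).
  by rewrite chain_sum0 /linearize_base (nboxes_up0 e_w).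
under eq_bigr => i _ do rewrite /bump /= add1n chain_sumS.
rewrite exchange_big /=.
pose F e' := pre (strip_prod d (up w e) e') (lz (up w e')).
have sz := etrans (size_inner w) (esym (size_outer w)).
transitivity (\sum_(e' <- cuts w | strip_step e e') F e').
  rewrite -(@sum_subpart A w W (fun eta => (parts eta \in cuts w) && strip_step e (parts eta))) //.
  rewrite big_mkcond [RHS]big_mkcond; apply: eq_bigr => eta _.
  rewrite andbC; case: ifP => // st; case/and4P: (st) => s' le ne hs.
  (* [strip_step] does not bound [parts eta] by [outer w]; the terms in excess vanish by
     [chain_part_le]. *)
  rewrite -(bil_sumr preB) /=; case: ifP => [eta_w|eta_nw]; last first.
    rewrite big1 ?(lin0 (preB.2 _)) // => n _; apply: chain_part_le.
    apply: contraFN eta_nw => le'; rewrite mem_cuts s' /=.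
    rewrite part_le_all2 ?size_parts ?size_outer // in le'.
    rewrite le' andbT; apply: (all2_leq_trans le1).
    by rewrite -part_le_all2 // size_parts -(all2_leq_size le1) size_inner.
  move: (eta_w); rewrite mem_cuts => /and3P[_ le1' le2'].
  have le_e : all2 leq e (parts eta).
    by rewrite -part_le_all2 // size_parts -(all2_leq_size le1) size_inner.
  have upE : up (up w e) (parts eta) = up w (parts eta) by rewrite up_up.
  rewrite IHN //.
    rewrite /F /strip_prod; congr (pre (dprod _ _) _).
    by rewrite val_restrict // ?restrict_rowsE ?entries_trim ?up_lo ?part_le_all2 // ?size_parts
      ?(size_cuts e_w) ?size_inner ?size_outer.
  have eta_up : parts eta \in cuts (up w e).
    by rewrite mem_cuts (inner_up le1 le2) (outer_up le1 le2) s' le_e.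
  have := up_cuts_lt eta_up; rewrite (inner_up le1 le2) upE eq_sym ne => /(_ isT) lt.
  exact: leq_trans lt lt_N.
rewrite /linearize_tail (cuts_up e_w) (perm_big _ (btw_sub_r sz e_w)) big_filter_cond -/(cuts w).
rewrite [LHS]big_seq_cond [RHS]big_seq_cond; apply: eq_big => e'.
  have [|//] := boolP (e' \in cuts w).
  rewrite mem_cuts => /and3P[s' le1' le2'].
  have szE : size e = size e' by rewrite (all2_leq_size le2) (all2_leq_size le2').
  rewrite /strip_step s' part_le_all2 // /first_strip (inner_up le1 le2) eq_sym.
  by case le: (all2 leq e e') => //=; rewrite horizontal_strip_btw // andbC.
case/andP=> e'_w /and4P[s' le ne hs]; congr (pre _ _).
rewrite up_up //; rewrite -part_le_all2 //.
by rewrite (size_cuts e_w) (size_cuts e'_w).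
Qed.

End Chains.

(** * The module of words and its operations *)

Lemma malg_mul_bil (k : comNzRingType) (K : monomType) :
  bil (fun x y : {malg k[K]} => x * y).
Proof.
split=> [y|x] c u v /=; first by rewrite mulrDl scalerAl.
rewrite mulrDr; congr (_ + _).
apply/malgP => m; rewrite mcoeffZ.
rewrite (mcoeffMlw m (fsubset_refl _) (msuppZ_le c u)).
rewrite (mcoeffMlw m (fsubset_refl _) (fsubset_refl (msupp u))).
rewrite mulr_sumr; apply: eq_bigr => i _; rewrite mulr_sumr; apply: eq_bigr => j _.
by rewrite mcoeffZ mulrnAr mulrCA.
Qed.

Section Words.
Variables (k : comNzRingType) (A : choiceType).
Local Notation W := (words k A).
Local Notation word := (@word k A).

(** The instance of the abstract [pre] for words. *)
Definition letter_cat (x : {malg k[A]}) (u : W) : W := letters x * u.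

Lemma letter_cat_bil : bil letter_cat.
Proof.
have mB := malg_mul_bil k {fmonom A}.
have lL : linear (@letters k A) by move=> c u v; rewrite /letters linearP.
exact: bil_comp mB lL (@lin_id k W).
Qed.

Lemma word_ind (P : W -> Prop) : submodule P -> (forall w, P (word w)) -> forall x, P x.
Proof. by move=> sP Pw; apply: malg_submodule_ind => // -[w]; exact: Pw. Qed.

Lemma letter_cat_word a w : letter_cat << a >> (word w) = word (a :: w).
Proof.
rewrite /letter_cat /letters lextU /word.
apply: etrans (malgUM _ _ _) _; congr mkmalgU.
exact: fmmulE.
Qed.

Section QShuffle.
Variable d : {bilinear {malg k[A]} -> {malg k[A]} -> {malg k[A]}}.

Lemma qshuffle_bil : bil (qshuffle d).
Proof. exact: qshuffle_bilinear. Qed.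

Lemma qshuffle_words u v : qshuffle d (word u) (word v) = qshuffle_word d u v.
Proof. by rewrite /qshuffle !lextU. Qed.

Lemma qshuffle_nill w : qshuffle d (word [::]) (word w) = word w.
Proof. exact: qshuffle_words. Qed.

Lemma qshuffle_nilr w : qshuffle d (word w) (word [::]) = word w.
Proof. by rewrite qshuffle_words; case: w. Qed.

Lemma qshuffle_cons a u b v : qshuffle d (word (a :: u)) (word (b :: v)) =
  letter_cat << a >> (qshuffle d (word u) (word (b :: v)))
  + letter_cat << b >> (qshuffle d (word (a :: u)) (word v))
  + letter_cat (d << a >> << b >>) (qshuffle d (word u) (word v)).
Proof. by rewrite !qshuffle_words /letter_cat /letters !lextU. Qed.

End QShuffle.

Lemma deconc_word (w : seq A) : deconc (word w) =
  \sum_(i < (size w).+1) word (take i w) ⊗ word (drop i w).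
Proof. by rewrite /deconc lextU. Qed.

Lemma deconc1 : deconc (word [::]) = word [::] ⊗ word [::].
Proof. by rewrite deconc_word big_ord_recl big_ord0 addr0. Qed.

Lemma deconc_letter_cat x u : deconc (letter_cat x u) =
  word [::] ⊗ letter_cat x u + tmap (letter_cat x) id (deconc u).
Proof.
exact: (dec_pre letter_cat_bil word_ind letter_cat_word (linearL (@deconc k A)) deconc_word).
Qed.

Lemma words_counit1 : words_counit (word [::]) = 1.
Proof. by rewrite /words_counit mcoeffUU. Qed.

Lemma words_counit_letter_cat x u : words_counit (letter_cat x u) = 0.
Proof.
have cL : scalar (@words_counit k A) by exact: words_counit_linear.
have cB := letter_cat_bil.
pose c : W -> k^o := @words_counit k A.
have c'L : linear c by exact: cL.
move: u; apply: (@word_ind (fun u => c (letter_cat x u) = 0)) => [|w].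
  apply: (@lin_eq_submodule k W k^o _ (fun _ => 0)); first exact: lin_comp c'L (cB.2 x).
  by move=> a u v; rewrite scaler0 addr0.
move: x; apply: malg_submodule_ind => [|a].
  apply: (@lin_eq_submodule k _ k^o _ (fun _ => 0)); first exact: lin_comp c'L (cB.1 _).
  by move=> a u v; rewrite scaler0 addr0.
by rewrite letter_cat_word /c /words_counit mcoeffU.
Qed.

End Words.

(** * The linearization morphism *)

Section Linearization.
Variables (k : comNzRingType) (A : choiceType).
Variable d : {bilinear {malg k[A]} -> {malg k[A]} -> {malg k[A]}}.
Hypotheses (dA : associative d) (dC : commutative d).
Local Notation Y := (ytab k A).
Local Notation W := (words k A).
Local Notation word := (@word k A).
Local Notation lz := (linearize d (@letter_cat k A) (word [::])).
Implicit Types h : seq (nat * seq A).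

Let dB : bil d := bilinearB d.
Let pB := @letter_cat_bil k A.
Let qB := qshuffle_bil d.

Lemma qshuffle_letter_cat x u y v :
  qshuffle d (letter_cat x u) (letter_cat y v) =
  letter_cat x (qshuffle d u (letter_cat y v)) + letter_cat y (qshuffle d (letter_cat x u) v)
  + letter_cat (d x y) (qshuffle d u v).
Proof. exact: (qs_pre dB pB qB (@word_ind k A) (@letter_cat_word k A) (qshuffle_cons d)). Qed.

Lemma qshuffleA : associative (qshuffle d).
Proof.
exact: (qsA dB pB qB (@word_ind k A) (@letter_cat_word k A) (qshuffle_nill d)
  (qshuffle_nilr d) (qshuffle_cons d) dA).
Qed.

Lemma qshuffleC : commutative (qshuffle d).
Proof.
exact: (qsC qB (@word_ind k A) (qshuffle_nill d) (qshuffle_nilr d) (qshuffle_cons d) dC).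
Qed.

Lemma qshuffle1l : left_id (word [::]) (qshuffle d).
Proof. exact: (qs1l qB (@word_ind k A) (qshuffle_nill d)). Qed.

Lemma qshuffle1r : right_id (word [::]) (qshuffle d).
Proof. exact: (qs1r qB (@word_ind k A) (qshuffle_nilr d)). Qed.

Lemma words_linearize_cut_mult : cut_mult (qshuffle d) (word [::]) lz.
Proof. exact: (linearize_cut_mult pB qB dA qshuffle1l qshuffle1r qshuffle_letter_cat). Qed.

Lemma ytab_linearization : exists L : {linear Y -> W},
  [/\ forall h, is_pre h -> L (rtab k h) = lz h, L 1 = word [::] &
      forall x y, L (ytab_mul k A x y) = qshuffle d (L x) (L y)].
Proof. exact: (ytab_lift qB qshuffleA qshuffleC qshuffle1l words_linearize_cut_mult). Qed.

Lemma linearize_word_column s : lz (column s) = word s.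
Proof.
elim: s => [|a s IHs]; first by rewrite linearize0.
by rewrite (linearize_column qshuffle1l words_linearize_cut_mult) IHs letter_cat_word.
Qed.

Lemma word_nil : word [::] = 1.
Proof. by congr mkmalgU; exact: esym (fmoneE A). Qed.

Lemma ssd_word_chain (w : tableau A) (c : seq (subpart w)) :
  ssd_word d c = chain_prod d (@letter_cat k A) (word [::]) w (inner w) (map (@parts A w) c).
Proof.
rewrite /ssd_word; elim: (map _ c) (inner w) => [|e es IHes] e'.
  by rewrite big_nil -word_nil.
by apply: etrans (big_cons _ _ _ _ _ _) _; rewrite IHes.
Qed.

Lemma linearize_ssd (w : tableau A) : lz w =
  \sum_(n < (nboxes w).+1) \sum_(c : n.-tuple (subpart w) | is_ssd c) ssd_word d c.
Proof.
have pw := is_pre_tableau w.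
have upE := up_self w.
rewrite -[in LHS]upE -(sum_chains d pB (word [::]) (inner_cuts pw) (N := (nboxes w).+1)).
  apply: eq_bigr => n _; rewrite /chain_sum; apply: eq_bigr => c _.
  by rewrite ssd_word_chain.
by rewrite upE.
Qed.

End Linearization.

(** * Linearization as a surjective coalgebra morphism *)

Section LinearizationMorphism.
Variables (k : comNzRingType) (A : choiceType).
Variable d : {bilinear {malg k[A]} -> {malg k[A]} -> {malg k[A]}}.
Local Notation Y := (ytab k A).
Local Notation W := (words k A).
Local Notation lz := (linearize d (@letter_cat k A) (word k [::])).
Variables (L : {linear Y -> W}).
Hypothesis LE : forall h, is_pre h -> L (rtab k h) = lz h.

Let LL : linear L := linearL L.

Lemma linearization_surj : associative d -> forall y, exists x, L x = y.
Proof.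
move=> dA; apply: word_ind => [|s].
  split=> [|c u v [x <-] [y <-]]; first by exists 0; rewrite linear0.
  by exists (c *: x + y); rewrite LL.
exists (rtab k (column s)).
by rewrite LE ?linearize_word_column // tableau_is_pre ?is_tableau_column.
Qed.

Lemma linearization_comul (Delta : {linear Y -> (Y ⊗ Y)%type}) :
    (forall h, is_pre h -> Delta (rtab k h) = rcut k h) ->
  forall y, tmap L L (Delta y) = deconc (L y).
Proof.
move=> DE; have TL := tmap_lin LL LL.
apply: ytab_ind => [|w].
  apply: lin_eq_submodule; first exact: lin_comp TL (linearL Delta).
  exact: lin_comp (linearL (@deconc k A)) LL.
have pw := is_pre_tableau w.
rewrite -rtab_tableau (DE _ pw) (LE pw).
have decE := dec_linearize d (@letter_cat_bil k A) (linearL (@deconc k A)) (@deconc1 k A)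
  (@deconc_letter_cat k A) pw.
rewrite /rcut (lin_sum TL); apply: (etrans _ (esym decE)); apply: eq_big_seq => e e_w.
by have [plo pup] := cuts_pre pw e_w; rewrite (tmapE LL LL) (LE plo) (LE pup).
Qed.

Lemma linearization_counit (eps : {scalar Y}) :
    (forall h, is_pre h -> eps (rtab k h) = (nboxes h == 0%N)%:R) ->
  forall y, words_counit (L y) = eps y.
Proof.
move=> eE.
have cL : scalar (@words_counit k A) by exact: words_counit_linear.
have c'L : linear (@words_counit k A : W -> k^o) by exact: cL.
have eL : linear (eps : Y -> k^o) by move=> c x y; exact: linearP.
apply: (@ytab_ind k A (fun y => (words_counit (L y) : k^o) = eps y)) => [|w].
  by apply: (@lin_eq_submodule k Y k^o _ _ _ eL); exact: lin_comp c'L LL.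
have pw := is_pre_tableau w.
rewrite -rtab_tableau (LE pw) (eE _ pw).
exact: cu_linearize cL (@words_counit1 k A) (@words_counit_letter_cat k A) w.
Qed.

Lemma linearize_is_linearization : is_linearization d L.
Proof. by move=> w; rewrite -rtab_tableau (LE (is_pre_tableau w)) linearize_ssd. Qed.

End LinearizationMorphism.

Lemma ytab_linear_ext (k : comNzRingType) (A : choiceType) (V : lmodType k)
    (f g : ytab k A -> V) : linear f -> linear g ->
  (forall w, f (tab k w) = g (tab k w)) -> f =1 g.
Proof. by move=> fL gL fg; apply: ytab_ind => //; exact: lin_eq_submodule. Qed.

Theorem theorem1 (k : comNzRingType) (A : countType)
    (d : {bilinear {malg k[A]} -> {malg k[A]} -> {malg k[A]}})
    (dA : associative d) (dC : commutative d) :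
  exists (Delta : {linear ytab k A -> (ytab k A ⊗ ytab k A)%type})
         (eps : {scalar ytab k A})
         (S : {linear ytab k A -> ytab k A})
         (L : {linear ytab k A -> words k A}),
    let Y := HopfOps (@qmul k _ (@ytab_rel k A)) 1 Delta eps S in
    [/\ is_the_linear (@is_cut_coproduct k A) Delta,
        is_the_linear (@is_tableau_counit k A) eps,
        is_the_linear (is_linearization d) L,
        [/\ is_hopf_algebra Y,
            commutative (hmul Y),
            is_graded_hopf Y (@ytab_deg k A) &
            is_connected Y (@ytab_deg k A)] &
        exists (YL : hopf_ops (quotmod (fun y => L y = 0)))
               (S' : {linear words k A -> words k A}),
          let W := HopfOps (qshuffle d) (word k [::])
                     (@deconc k A) (@words_counit k A) S' in
          [/\ is_hopf_algebra YL,
              is_hopf_morphism Y YL (qpi (fun y => L y = 0)),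
              is_hopf_algebra W &
              exists Lbar : {linear quotmod (fun y => L y = 0) -> words k A},
                [/\ forall y, Lbar (qpi (fun y => L y = 0) y) = L y,
                    bijective Lbar &
                    is_hopf_morphism YL W Lbar]]].
Proof.
have [Delta [eps [S]]] := ytab_hopf k A; set DY := HopfOps _ _ _ _ _.
move=> /= [DE eE [DH SN] DG Dconn].
have [L [LE L1 LM]] := ytab_linearization dA dC.
have Ls := linearization_surj LE dA; have Lcom := linearization_comul LE DE.
have Lcu := linearization_counit LE eE.
have tabE (w : tableau A) : rtab k w = tab k w := rtab_tableau k w.
have cutD : is_cut_coproduct Delta.
  by move=> w; rewrite -tabE (DE _ (is_pre_tableau w)) rcut_tab.
have eps_tab (w : tableau A) : eps (tab k w) = (nboxes w == 0%N)%:R.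
  by rewrite -tabE (eE _ (is_pre_tableau w)).
have eps_empty : eps (tab k (empty_tableau A)) = 1 by rewrite eps_tab.
have linL := linearize_is_linearization LE.
exists Delta, eps, S, L; split.
- split=> // g gD; apply: ytab_linear_ext => [||w].
  + exact: linearL.
  + exact: linearL.
  by rewrite (gD w) (cutD w).
- split; first split=> // w w_gt0.
    by rewrite eps_tab eqn0Ngt w_gt0.
  move=> g [g1 g0].
  have gL : linear (g : ytab k A -> k^o) by move=> c x y; exact: linearP.
  have eL : linear (eps : ytab k A -> k^o) by move=> c x y; exact: linearP.
  apply: (@ytab_linear_ext k A k^o _ _ gL eL) => w.
  case: (posnP (nboxes w)) => [w0|w_gt0]; last by rewrite g0 // eps_tab eqn0Ngt w_gt0.
  (* A tableau without boxes may still have rows [(m, [::])], but its class is that of the empty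
     tableau, where [g1] fixes the value. *)
  by rewrite eps_tab w0 eqxx -tabE (rtab_nboxes0 k (is_pre_tableau w) w0) -tab_empty g1.
- split=> // g gL; apply: ytab_linear_ext => [||w].
  + exact: linearL.
  + exact: linearL.
  by rewrite (gL w) (linL w).
- split; [exact: DH | exact: ytab_mulC | exact: DG | exact: Dconn].
pose W0 := HopfOps (qshuffle d) (word k [::]) (@deconc k A) (@words_counit k A) 
  (pack_linear (@lin_id k (words k A))).
have kerS x : L x = 0 -> L (S x) = 0.
  (* [S x] is a finite sum of convolution powers, and [L] turns each of them into the same power for
     words, evaluated at [L x = 0]. *)
  have PM := @conv_pow_morph k _ _ DY W0 L LM L1 Lcom Lcu.
  have [N ->] := SN x; move=> Lx; rewrite linear_sum big1 // => n _.
  by rewrite PM Lx; exact: lin0 (conv_powL W0 n).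
have [S' [WH WM]] := @surj_hopf k _ _ DY W0 L Ls LM L1 Lcom Lcu DH kerS.
pose Q := quotmod (fun y => L y = 0).
have [Lbar LbarE] : exists Lbar : {linear Q -> words k A}, forall y, Lbar (qpi _ y) = L y.
  exact: quotmod_lift.
have [r rK] := choice Ls.
(* The inverse of [Lbar]: by [kerL] the class of a preimage of [y] does not depend on its choice. *)
pose g0 y : Q := qpi _ (r y).
have kerL (x : ytab k A) : L x = 0 -> qpi (fun y => L y = 0) x = 0.
  move=> Lx; rewrite -(linear0 (qpi (fun y => L y = 0))); apply/eq_qpi.
  by rewrite subr0; apply: span_gen.
have g0E x : g0 (L x) = qpi _ x.
  apply/eqP; rewrite -subr_eq0 /g0 -linearB; apply/eqP; apply: kerL.
  by rewrite linearB rK subrr.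
have g0L : linear g0.
  move=> c u v; rewrite -[u]rK -[v]rK -linearP !g0E.
  by rewrite linearP.
pose g : {linear words k A -> Q} := pack_linear g0L.
have gK : cancel g Lbar by move=> y; rewrite /= /g0 LbarE rK.
have LbarK : cancel Lbar g by move=> x; rewrite -[x]qreprK LbarE /= g0E.
have [YL [YLH gM LbarM]] := hopf_transport LbarK gK WH.
exists YL, S'; split.
- exact: YLH.
(* By [g0E] the canonical projection is [L] followed by [g], both Hopf morphisms. *)
- exact: hopf_morphism_comp WM gM g0E.
- exact: WH.
exists Lbar; split; [exact: LbarE | by exists g | exact: LbarM].
Qed.
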